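(* Let $a\in BMO(\mathbb{R}^n_+)$, $1<p<\infty$, $w\in A_p$, and let $\varphi:\mathbb{R}^n\times\mathbb{R}_+\to\mathbb{R}_+$ be a weight such that, for some constant $C_1$, for all $x\in\mathbb{R}^n$ and $r>0$, $$\int_r^\infty\Big(1+\ln\frac tr\Big)\frac{\operatorname*{ess\,inf}_{t<s<\infty}\varphi(x,s)\,w(B_s(x))^{\frac1p}}{w(B_t(x))^{\frac1p}}\,\frac{dt}{t}\le C_1\,\varphi(x,r).$$ Let $\mathcal K$ be a variable Calderón–Zygmund kernel, let $\mathcal T(x)$ be the generalized reflection associated with an elliptic matrix $\{a^{ij}\}$, and define the nonsingular integrals $$\widetilde{\mathfrak K}f(x)=\int_{\mathbb{R}^n_+}\mathcal K(x,\mathcal T(x)-y)f(y)\,dy,\qquad \widetilde{\mathfrak C}[a,f](x)=\int_{\mathbb{R}^n_+}\mathcal K(x,\mathcal T(x)-y)[a(x)-a(y)]f(y)\,dy .$$ Then $\widetilde{\mathfrak K}f$ and $\widetilde{\mathfrak C}[a,f]$ are continuous in $M_{p,\varphi}(\mathbb{R}^n_+,w)$, and for all $f\in M_{p,\varphi}(\mathbb{R}^n_+,w)$ $$\|\widetilde{\mathfrak K}f\|_{p,\varphi,w;\mathbb{R}^n_+}\le C\,[w]_{A_p}^{\frac1p}\,\|f\|_{p,\varphi,w;\mathbb{R}^n_+},\qquad \|\widetilde{\mathfrak C}[a,f]\|_{p,\varphi,w;\mathbb{R}^n_+}\le C\,[w]_{A_p}^{\frac1p}\,\|a\|_*\,\|f\|_{p,\varphi,w;\mathbb{R}^n_+}$$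 with constants $C$ dependent on known quantities only (not on $f$ or $a$).
   Context: $\mathbb{R}^n_+=\{x\in\mathbb{R}^n:x_n>0\}$, $\mathbb{R}^n_-=\{x_n<0\}$, $\mathbb{R}_+=(0,\infty)$; $B_r(x)$ is the open ball of center $x$ and radius $r$, $B_r^+(x)=B_r(x)\cap\mathbb{R}^n_+$; $\mathbb{S}^{n-1}$ is the unit sphere. Generalized reflection: $\mathbf a=\{a^{ij}\}_{i,j=1}^n$ is a measurable symmetric matrix function for which there is $\Lambda>0$ with $\Lambda^{-1}|\xi|^2\le a^{ij}(x)\xi_i\xi_j\le\Lambda|\xi|^2$ for a.a. $x$ and all $\xi\in\mathbb{R}^n$ (summation convention). With $\mathbf a^n$ the last row of $\mathbf a$, $$\mathcal T(x;y)=x-2x_n\frac{\mathbf a^n(y)}{a^{nn}(y)},\qquad \mathcal T(x)=\mathcal T(x;x):\mathbb{R}^n_+\to\mathbb{R}^n_-.$$ A weight is a non-negative locally integrable function on its domain; $w(E)=\int_E w\,dx$. The weight $w$ on $\mathbb{R}^n$ belongs to the Muckenhoupt class $A_p$, $1<p<\infty$, if $$[w]_{A_p}=\sup_{B}\left(\frac1{|B|}\int_B w\,dx\right)\left(\frac1{|B|}\int_B w^{-\frac1{p-1}}\,dx\right)^{p-1}<\infty,$$ the supremum being over all balls. $BMO(\mathbb{R}^n_+)$ is the space of locally integrable $a$ on $\mathbb{R}^n_+$ whose mean oscillation $\frac1{|E|}\int_E|a-a_E|\,dy$, $a_E=\frac1{|E|}\int_E a\,dy$, over sets $E=B\cap\mathbb{R}^n_+$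 ($B$ a ball) is bounded; $\|a\|_*$ is the supremum. $M_{p,\varphi}(\mathbb{R}^n_+,w)$ consists of all $f\in L_{p,w}^{\rm loc}(\mathbb{R}^n_+)$ with $$\|f\|_{p,\varphi,w;\mathbb{R}^n_+}=\sup_{x\in\mathbb{R}^n_+,\,r>0}\varphi(x,r)^{-1}\left(w(B_r^+(x))^{-1}\int_{B_r^+(x)}|f(y)|^pw(y)\,dy\right)^{\frac1p}<\infty.$$ A measurable function $\mathcal K(x,\xi):\mathbb{R}^n\times(\mathbb{R}^n\setminus\{0\})\to\mathbb{R}$ is a variable Calderón–Zygmund kernel if: (i) for almost all $x$, $\mathcal K(x,\cdot)\in C^\infty(\mathbb{R}^n\setminus\{0\})$, $\mathcal K(x,\mu\xi)=\mu^{-n}\mathcal K(x,\xi)$ for all $\mu>0$, $\int_{\mathbb{S}^{n-1}}\mathcal K(x,\xi)\,d\sigma_\xi=0$ and $\int_{\mathbb{S}^{n-1}}|\mathcal K(x,\xi)|\,d\sigma_\xi<\infty$; (ii) $\max_{|\beta|\le 2n}\|D_\xi^\beta\mathcal K\|_{L_\infty(\mathbb{R}^n\times\mathbb{S}^{n-1})}=M<\infty$. ''Known quantities'' are $n,p,\varphi,w,\Lambda$ and the kernel $\mathcal K$. *)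

(* Defs.v *)
From HB Require Import structures.
From mathcomp Require Import all_boot all_order all_algebra.
From mathcomp Require Import all_classical all_reals all_analysis.
From mathcomp Require Import measurable_realfun ess_sup_inf hoelder.

Set Implicit Arguments.
Unset Strict Implicit.
Unset Printing Implicit Defensive.

Import Order.TTheory GRing.Theory Num.Theory.
Import numFieldNormedType.Exports.

Local Open Scope classical_set_scope.
Local Open Scope ring_scope.

(* 'rV[R]_n carries the sigma-algebra generated by the n coordinates, i.e. the
   Borel one. *)
Definition rV_display : measure_display -> measure_display.
Proof. exact. Qed.

Section measurable_rV.
Context {R : realType} (n : nat).

Let coord (i : 'I_n) (x : 'rV[R]_n) : measurableTypeR R := x ord0 i.

Let rV_set0 : g_sigma_preimage coord set0.
Proof. exact: sigma_algebra0. Qed.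

Let rV_setC A : g_sigma_preimage coord A -> g_sigma_preimage coord (~` A).
Proof. exact: sigma_algebraC. Qed.

Let rV_bigcup (F : (set _)^nat) : (forall i, g_sigma_preimage coord (F i)) ->
  g_sigma_preimage coord (\bigcup_i (F i)).
Proof. exact: sigma_algebra_bigcup. Qed.

HB.instance Definition _ :=
  @isMeasurable.Build (rV_display default_measure_display)
  'rV[R]_n (g_sigma_preimage coord) rV_set0 rV_setC rV_bigcup.

End measurable_rV.

Section measurable_rV_theory.
Context {R : realType}.

Lemma measurable_coord n (i : 'I_n) :
  measurable_fun [set: 'rV[R]_n] (fun x => x ord0 i).
Proof.
move=> _ B mB; rewrite setTI; apply: sub_sigma_algebra => /=.
rewrite -bigcup_seq/=; exists i => /=; first by rewrite mem_index_enum.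
by exists B => //; rewrite setTI.
Qed.

Lemma measurable_fun_rV d (T : measurableType d) n (f : T -> 'rV[R]_n) :
  (forall i, measurable_fun [set: T] (fun x => f x ord0 i)) ->
  measurable_fun [set: T] f.
Proof.
move=> mf _ A mA; rewrite setTI.
suff: preimage_set_system [set: T] f measurable `<=` measurable.
  by apply; exists A => //; rewrite setTI.
rewrite [X in preimage_set_system _ _ X](_ : _ =
  g_sigma_preimage (fun i (x : 'rV[R]_n) => x ord0 i : measurableTypeR R))//.
rewrite -g_sigma_preimage_comp; apply: smallest_sub.
  exact: sigma_algebra_measurable.
rewrite -bigcup_seq; apply: bigcup_sub => i _ _ [B mB <-].
exact: mf.
Qed.

End measurable_rV_theory.

Section lebesgue_rV.
Context {R : realType}.

Definition rV_cons n (p : measurableTypeR R * 'rV[R]_n) : 'rV[R]_n.+1 :=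
  row_mx (const_mx p.1 : 'rV_1) p.2.

Definition rV_uncons n (x : 'rV[R]_n.+1) : measurableTypeR R * 'rV[R]_n :=
  (x ord0 ord0, @rsubmx R 1 1 n x).

Lemma rV_consK n : cancel (@rV_cons n) (@rV_uncons n).
Proof.
move=> [a x]; rewrite /rV_uncons /rV_cons; congr pair; last first.
  exact: row_mxKr.
by rewrite /= mxE; case: splitP => [j _|k]; rewrite ?mxE.
Qed.

Lemma measurable_rV_cons n : measurable_fun setT (@rV_cons n).
Proof.
apply: measurable_fun_rV => i.
pose j : 'I_(1 + n) := i.
rewrite (_ : (fun _ => _) = fun p : measurableTypeR R * 'rV[R]_n =>
  row_mx (const_mx p.1 : 'rV_1) p.2 ord0 j)//.
case: (split_ordP j) => k ->.
- rewrite (_ : (fun _ => _) = fst); first exact: measurable_fst.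
  by apply/funext => p; rewrite row_mxEl mxE.
- rewrite (_ : (fun _ => _) = (fun x : 'rV[R]_n => x ord0 k) \o snd).
    exact: measurableT_comp (measurable_coord k) measurable_snd.
  by apply/funext => p; rewrite row_mxEr.
Qed.

Lemma measurable_rV_uncons n : measurable_fun setT (@rV_uncons n).
Proof.
apply: measurable_fun_pair; first exact: measurable_coord.
apply: measurable_fun_rV => i.
rewrite (_ : (fun _ => _) =
  fun x : 'rV[R]_n.+1 => x ord0 (rshift 1 i : 'I_n.+1)).
  exact: measurable_coord.
by apply/funext => x; rewrite mxE.
Qed.

HB.instance Definition _ n :=
  isMeasurableFun.Build _ _ _ _ (@rV_cons n) (@measurable_rV_cons n).

Section step.
Variables (n : nat) (mu : {sigma_finite_measure set 'rV[R]_n -> \bar R}).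

Definition lebesgue_step : set 'rV[R]_n.+1 -> \bar R :=
  pushforward (@lebesgue_measure R \x mu)%E (@rV_cons n).

Let lebesgue_step0 : lebesgue_step set0 = 0%E.
Proof. exact: measure0. Qed.

Let lebesgue_step_ge0 A : (0 <= lebesgue_step A)%E.
Proof. exact: measure_ge0. Qed.

Let lebesgue_step_sigma_additive : semi_sigma_additive lebesgue_step.
Proof. exact: measure_semi_sigma_additive. Qed.

HB.instance Definition _ := isMeasure.Build _ _ _ lebesgue_step
  lebesgue_step0 lebesgue_step_ge0 lebesgue_step_sigma_additive.

Lemma lebesgue_step_sigma_finite : sigma_finite setT lebesgue_step.
Proof.
have [F FT Foo] : sigma_finite setT (@lebesgue_measure R \x mu)%E.
  have /sigma_finiteP[F [TF ndF Foo]] := sigma_finiteT (@lebesgue_measure R).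
  have /sigma_finiteP[G [TG ndG Goo]] := sigma_finiteT mu.
  exists (fun k => F k `*` G k).
    rewrite -setXTT TF TG; apply/seteqP; split => -[x y].
      move=> [/= [i _ Fix] [k _ Gky]]; exists (maxn i k) => //; split.
      - by move: x Fix; exact/subsetPset/ndF/leq_maxl.
      - by move: y Gky; exact/subsetPset/ndG/leq_maxr.
    by move=> [k _ []/= ? ?]; split; exists k.
  move=> k; have [? ?] := Foo k; have [? ?] := Goo k.
  split; first exact: measurableX.
  by rewrite product_measure1E// lte_mul_pinfty// ge0_fin_numE.
exists (fun k => @rV_uncons n @^-1` F k).
  by rewrite -preimage_bigcup -FT preimage_setT.
move=> k; have [mF Fk] := Foo k; split.
  by rewrite -[X in measurable X]setTI; exact: measurable_rV_uncons.
rewrite /lebesgue_step /pushforward -comp_preimage.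
by rewrite (_ : _ \o _ = id)//; apply/funext => x /=; exact: rV_consK.
Qed.

HB.instance Definition _ := Measure_isSigmaFinite.Build _ _ _
  lebesgue_step lebesgue_step_sigma_finite.

End step.

(* n-dimensional Lebesgue measure, as an iterated product; see lebesgue_rV_box. *)
Fixpoint lebesgue_rV n : {sigma_finite_measure set 'rV[R]_n -> \bar R} :=
  if n is k.+1 then lebesgue_step (lebesgue_rV k) else \d_(0 : 'rV[R]_0).

Lemma lebesgue_rV_box n (A : 'I_n -> set (measurableTypeR R)) :
  (forall i, measurable (A i)) ->
  lebesgue_rV n [set x | forall i, A i (x ord0 i)] =
  (\big[*%E/1]_(i < n) lebesgue_measure (A i))%E.
Proof.
elim: n A => [|n IH] A mA.
  rewrite big_ord0 /= diracE mem_set// => -[].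
  by move=> ?.
rewrite big_ord_recl -IH//= /lebesgue_step /pushforward.
pose B := [set x : 'rV[R]_n | forall i, A (lift ord0 i) (x ord0 i)].
have mB : measurable B.
  rewrite (_ : B = \big[setI/setT]_(i < n)
    ((fun x : 'rV[R]_n => x ord0 i) @^-1` A (lift ord0 i))).
    apply: bigsetI_measurable => i _; rewrite -[X in measurable X]setTI.
    by apply: measurable_coord => //; exact: mA.
  rewrite -bigcap_seq; apply/seteqP; split => [x Bx i _|x Bx i]; first exact: Bx.
  by apply: Bx; rewrite /= mem_index_enum.
rewrite -[RHS]product_measure1E//; congr (_ \x _)%E.
apply/seteqP; split => -[a x] /=.
- move=> Aax; split.
    have := Aax ord0; rewrite /rV_cons mxE.
    by case: splitP => // j _; rewrite mxE.
  move=> i; have := Aax (lift ord0 i); rewrite /rV_cons mxE.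
  case: splitP => [j|j]; first by rewrite [j]ord1.
  by rewrite lift0 /= add1n => -[] /val_inj ->.
- move=> [Aa Ax] i; rewrite /rV_cons mxE; case: splitP => j ij.
    rewrite mxE (_ : i = ord0)//; apply: ord_inj.
    by rewrite ij [j]ord1.
  by rewrite (_ : i = lift ord0 j)//; apply: ord_inj; rewrite ij lift0.
Qed.

End lebesgue_rV.
Arguments lebesgue_rV {R} n.

Section euclidean.
Context {R : realType}.

Definition enorm n (x : 'rV[R]_n) : R := Num.sqrt (\sum_i x ord0 i ^+ 2).

(* The norm of the normed space 'rV[R]_n is the sup norm, with the same
   topology; balls and spheres here are Euclidean. *)
Definition eball n (x : 'rV[R]_n) (r : R) : set 'rV[R]_n :=
  [set y | enorm (y - x) < r].

Definition sphere n : set 'rV[R]_n := [set x | enorm x = 1].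

Definition halfspace n : set 'rV[R]_n.+1 := [set x | 0 < x ord0 ord_max].

Definition hball n (x : 'rV[R]_n.+1) (r : R) : set 'rV[R]_n.+1 :=
  eball x r `&` @halfspace n.

Lemma measurable_enorm n : measurable_fun setT (@enorm n).
Proof.
apply: (@measurableT_comp _ _ _ _ _ _ (@Num.sqrt R)).
  by apply: continuous_measurable_fun; exact: sqrt_continuous.
apply: measurable_sum => i.
by apply: measurable_funX; exact: measurable_coord.
Qed.

Definition direction n (x : 'rV[R]_n) : 'rV[R]_n := (enorm x)^-1 *: x.

Lemma measurable_direction n : measurable_fun setT (@direction n).
Proof.
apply: measurable_fun_rV => i.
rewrite (_ : (fun _ => _) = fun x : 'rV[R]_n => enorm x `^ (-1) * x ord0 i).
  apply: measurable_funM; last exact: measurable_coord.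
  apply: (@measurableT_comp _ _ _ _ _ _ (fun x : R => x `^ (-1))).
    exact: measurable_powR.
  exact: measurable_enorm.
by apply/funext => x; rewrite mxE powR_inv1// sqrtr_ge0.
Qed.

HB.instance Definition _ n :=
  isMeasurableFun.Build _ _ _ _ (@direction n) (@measurable_direction n).

Lemma measurable_annulus n :
  measurable [set x : 'rV[R]_n | 0 < enorm x < 1].
Proof.
rewrite (_ : [set _ | _] = @enorm n @^-1` `]0, 1[%classic); last first.
  by apply/seteqP; split => x /=; rewrite in_itv.
by rewrite -[X in measurable X]setTI; apply: measurable_enorm.
Qed.

End euclidean.

Section surface_measure.
Context {R : realType} (n : nat).

Definition cone_measure : set 'rV[R]_n -> \bar R :=
  pushforward (mrestr (lebesgue_rV n) (@measurable_annulus R n))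
    (@direction R n).

Let cone_measure0 : cone_measure set0 = 0%E.
Proof. exact: measure0. Qed.

Let cone_measure_ge0 A : (0 <= cone_measure A)%E.
Proof. exact: measure_ge0. Qed.

Let cone_measure_sigma_additive : semi_sigma_additive cone_measure.
Proof. exact: measure_semi_sigma_additive. Qed.

HB.instance Definition _ := isMeasure.Build _ _ _ cone_measure
  cone_measure0 cone_measure_ge0 cone_measure_sigma_additive.

(* Surface measure of the unit sphere, as a measure on R^n carried by the sphere:
   sigma(E) = n |{t xi : xi in E, 0 < t < 1}|. *)
Definition surface_measure : set 'rV[R]_n -> \bar R :=
  mscale (NngNum (ler0n R n)) cone_measure.

HB.instance Definition _ := Measure.on surface_measure.

End surface_measure.
Arguments surface_measure {R} n.

Section lebesgue_measurability.
Context d (T : measurableType d) {R : realType}.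
Variable mu : {measure set T -> \bar R}.
Implicit Types (D : set T).

(* Measurability with respect to the completion of mu: when mu is a Lebesgue
   measure, this is Lebesgue (rather than Borel) measurability. The integral of a
   function of constant sign being a supremum over measurable simple functions,
   \int[mu] agrees on such f with the integral for the completed measure. *)
Definition ae_measurable D (f : T -> R) : Prop :=
  exists2 g : T -> R, measurable_fun D g &
    {ae mu, forall x, D x -> f x = g x}.

Definition ae_integrable D (f : T -> R) : Prop :=
  ae_measurable D f /\ (\int[mu]_(x in D) `|f x|%:E < +oo)%E.

(* In \bar R, 0^-1 = +oo and +oo * 0 = 0, so that the mean over the empty set
   is 0. *)
Definition mean D (f : T -> \bar R) : \bar R :=
  ((mu D)^-1 * \int[mu]_(x in D) f x)%E.

End lebesgue_measurability.

Section weights.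
Context {R : realType}.

Definition loc_integrable n (D : set 'rV[R]_n) (f : 'rV[R]_n -> R) : Prop :=
  ae_measurable (lebesgue_rV n) D f /\
  forall K, compact K -> K `<=` D -> ae_integrable (lebesgue_rV n) K f.

Definition weight n (D : set 'rV[R]_n) (w : 'rV[R]_n -> R) : Prop :=
  (forall x, D x -> 0 <= w x) /\ loc_integrable D w.

Definition wmeasure n (w : 'rV[R]_n -> R) (E : set 'rV[R]_n) : \bar R :=
  (\int[lebesgue_rV n]_(x in E) (w x)%:E)%E.

(* w^(-1/(p-1)) is taken in \bar R, where it is +oo at the zeros of w; the power
   function of R would give 0. *)
Definition Ap_const n (p : R) (w : 'rV[R]_n -> R) : \bar R :=
  ereal_sup [set c | exists x r, 0 < r /\
    c = (mean (lebesgue_rV n) (eball x r) (EFin \o w) *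
         mean (lebesgue_rV n) (eball x r)
           (fun y => ((w y)%:E^-1) `^ (p - 1)^-1) `^ (p - 1))%E].

(* Because 0 * +oo = 0 in \bar R, finiteness of the constant alone would let in
   the zero weight (and only it, up to null sets). *)
Definition in_Ap n (p : R) (w : 'rV[R]_n -> R) : Prop :=
  [/\ weight setT w, {ae lebesgue_rV n, forall x, 0 < w x} &
      (Ap_const p w < +oo)%E].

(* A weight on R^n x ]0, +oo[ with values in ]0, +oo[. *)
Definition phi_weight n (phi : 'rV[R]_n -> R -> R) : Prop :=
  let mu := (lebesgue_rV n \x @lebesgue_measure R)%E in
  let D := [set z : 'rV[R]_n * R | 0 < z.2] in
  [/\ forall x r, 0 < r -> 0 < phi x r,
      ae_measurable mu D (fun z => phi z.1 z.2) &
      forall K : set ('rV[R]_n * R), compact K -> K `<=` D ->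
        ae_integrable mu K (fun z => phi z.1 z.2)].

Definition phi_condition n (p : R) (w : 'rV[R]_n -> R)
    (phi : 'rV[R]_n -> R -> R) : Prop :=
  exists C1 : R, forall x r, 0 < r ->
    (\int[lebesgue_measure]_(t in `]r, +oo[)
       ((1 + ln (t / r))%:E *
        (ess_inf (mrestr (@lebesgue_measure R) (measurable_itv `]t, +oo[))
           (fun s => (phi x s)%:E * wmeasure w (eball x s) `^ p^-1)
         / wmeasure w (eball x t) `^ p^-1) * (t^-1)%:E)
     <= (C1 * phi x r)%:E)%E.

End weights.

Section function_spaces.
Context {R : realType} (n : nat).
Let mu : {measure set 'rV[R]_n.+1 -> \bar R} := lebesgue_rV n.+1.
Let H : set 'rV[R]_n.+1 := @halfspace R n.
Implicit Types (f a w : 'rV[R]_n.+1 -> R) (phi : 'rV[R]_n.+1 -> R -> R).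

(* If a is not integrable over E, then its mean is infinite (+oo - oo = -oo in
   \bar R) and so is its oscillation over E. *)
Definition bmo_norm a : \bar R :=
  ereal_sup [set c | exists x r, 0 < r /\
    c = mean mu (hball x r)
          (fun y => `|(a y)%:E - mean mu (hball x r) (EFin \o a)|%E)].

Definition BMO a : Prop := loc_integrable H a /\ (bmo_norm a < +oo)%E.

Definition morrey_norm (p : R) phi w f : \bar R :=
  ereal_sup [set c | exists x r, [/\ H x, 0 < r &
    c = ((phi x r)^-1%:E *
         ((wmeasure w (hball x r))^-1 *
          \int[mu]_(y in hball x r) (`|f y| `^ p * w y)%:E) `^ p^-1)%E]].

Definition morrey (p : R) phi w f : Prop :=
  [/\ ae_measurable mu H f,
      forall K, compact K -> K `<=` H ->
        (\int[mu]_(y in K) (`|f y| `^ p * w y)%:E < +oo)%E &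
      (morrey_norm p phi w f < +oo)%E].

Definition morrey_continuous (p : R) phi w
    (S : ('rV[R]_n.+1 -> R) -> ('rV[R]_n.+1 -> R)) : Prop :=
  (forall f, morrey p phi w f -> morrey p phi w (S f)) /\
  (forall f, morrey p phi w f -> forall e : R, 0 < e -> exists2 d : R, 0 < d &
     forall g, morrey p phi w g ->
       (morrey_norm p phi w (g \- f)%R < d%:E)%E ->
       (morrey_norm p phi w (S g \- S f)%R < e%:E)%E).

End function_spaces.

Section kernels.
Context {R : realType}.

Definition partial n (i : 'I_n) (g : 'rV[R]_n -> R) : 'rV[R]_n -> R :=
  fun x => 'D_(delta_mx ord0 i) g x.

Definition partials n (s : seq 'I_n) (g : 'rV[R]_n -> R) : 'rV[R]_n -> R :=
  foldr (@partial n) g s.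

Definition multi_partial n (b : 'I_n -> nat) : ('rV[R]_n -> R) -> 'rV[R]_n -> R :=
  partials (flatten [seq nseq (b i) i | i <- enum 'I_n]).

Definition smooth_on n (U : set 'rV[R]_n) (g : 'rV[R]_n -> R) : Prop :=
  forall (s : seq 'I_n) x, U x ->
    {for x, continuous (partials s g)} /\
    forall i, derivable (partials s g) x (delta_mx ord0 i).

(* The essential supremum in the last clause is over R^n x S^(n-1), on which the
   product of the Lebesgue and surface measures is carried. *)
Definition cz_kernel n (K : 'rV[R]_n -> 'rV[R]_n -> R) : Prop :=
  let mu := lebesgue_rV n in
  let sigma := surface_measure n in
  [/\ ae_measurable (mu \x mu)%E [set z | z.2 != 0] (fun z => K z.1 z.2),
      {ae mu, forall x,
        [/\ smooth_on [set xi | xi != 0] (K x),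
            forall m xi, 0 < m -> xi != 0 -> K x (m *: xi) = m ^- n * K x xi,
            (\int[sigma]_(xi in @sphere R n) (K x xi)%:E = 0)%E &
            (\int[sigma]_(xi in @sphere R n) `|K x xi|%:E < +oo)%E]} &
      exists M : R, forall b : 'I_n -> nat, (\sum_i b i <= 2 * n)%N ->
        (Lnorm (mu \x^ sigma) +oo (fun z => (multi_partial b (K z.1) z.2)%:E)
           <= M%:E)%E].

End kernels.

Section nonsingular_integrals.
Context {R : realType} (n : nat).
Let mu : {measure set 'rV[R]_n.+1 -> \bar R} := lebesgue_rV n.+1.
Let H : set 'rV[R]_n.+1 := @halfspace R n.
Implicit Types (A : 'rV[R]_n.+1 -> 'M[R]_n.+1) (f a : 'rV[R]_n.+1 -> R).
Implicit Types (K : 'rV[R]_n.+1 -> 'rV[R]_n.+1 -> R) (x y : 'rV[R]_n.+1).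

Definition elliptic (Lambda : R) A : Prop :=
  [/\ forall i j, ae_measurable mu H (fun x => A x i j),
      forall x, H x -> (A x)^T = A x &
      {ae mu, forall x, H x -> forall xi : 'rV[R]_n.+1,
        Lambda^-1 * enorm xi ^+ 2
          <= \sum_i \sum_j A x i j * xi ord0 i * xi ord0 j
          <= Lambda * enorm xi ^+ 2}].

Definition refl_at A x y : 'rV[R]_n.+1 :=
  x - (2 * x ord0 ord_max) *: ((A y ord_max ord_max)^-1 *: row ord_max (A y)).

Definition refl A x : 'rV[R]_n.+1 := refl_at A x x.

Definition Kt_integrand K A f x y : R := K x (refl A x - y) * f y.

Definition Ct_integrand K A a f x y : R :=
  K x (refl A x - y) * (a x - a y) * f y.

Definition Kt K A f x : R := \int[mu]_(y in H) Kt_integrand K A f x y.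

Definition Ct K A a f x : R := \int[mu]_(y in H) Ct_integrand K A a f x y.

End nonsingular_integrals.

(* Main.v *)
From HB Require Import structures.
Require Import Defs.
From mathcomp Require Import all_boot all_order all_algebra.
From mathcomp Require Import all_classical all_reals all_analysis.
From mathcomp Require Import measurable_realfun ess_sup_inf hoelder.
From mathcomp Require Import ring lra ssrAC.

(* Ellipticity gives |T(x) - y| >= c t(x,y) for x, y in the half-space, where
   t(x,y) = |x - y| + x_n + y_n, so both operators are dominated by the positive
   operator with kernel t^(-n) b, where b = 1 or b(x,y) = |a(x) - a(y)| / D with D
   a multiple of the BMO norm of a. All that is used of b is that it is a
   pseudometric whose double means over cubes in the half-space are at most 1.

   By homogeneity and continuity of the kernel, t^(-n) is comparable to the sum of
   h^(-n) over the dyadic h for which x and y lie at distance at most h in the strip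
   0 < x_n < h. For x in a half-ball of radius r, the scales h <= r form a near part,
   bounded on L_{p,w} by a Schur test with weight x_n^(-e): the A_p condition makes
   the w-mass of a strip of width d along a side of a cube decay like a power of d,
   likewise for the dual weight, and a stopping time argument (John-Nirenberg) gives
   the means of powers of b against w. The scales 2^k r are treated by Hoelder's
   inequality, which gives sum_k (1 + k) |f|_{L_{p,w}(B_{2^k r}^+)} w(B_{2^(k+1) r})^(-1/p).
   The norm of f over B_s^+ is at most the Morrey norm times the essential infimum in
   the condition on phi, so this sum is a lower Riemann sum of the integral there. *)

Set Implicit Arguments.
Unset Strict Implicit.
Unset Printing Implicit Defensive.

Import Order.TTheory GRing.Theory Num.Theory.
Import numFieldNormedType.Exports.

Local Open Scope classical_set_scope.
Local Open Scope ring_scope.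

(** * Cubes *)

(** The sum over the near scales converges because scale h only sees points with x_n < h. On both
    sides of the Schur test a factor (x_n / h)^e can be spent, and its values over the dyadic h >
    x_n form a geometric series. The admissible e is dictated by how fast the weight and its dual
    decay in boundary strips. The other difficulty is that the data are known only up to null sets
    while [K] is evaluated at a reflected point. The weight is therefore replaced by an everywhere
    positive Borel version, and K(x, T(x) - y) by a truncated Borel version that obeys its size
    bound at every pair of points. For fixed x, the exceptional arguments of [K] give a null set of
    y because y -> d - y preserves null sets. Bounds of integrals under almost everywhere hypotheses
    are proved without measurability, straight from the supremum over simple functions. The constant
    of the theorem may depend on w, so it is enough to bound the operators by some constant: the
    factor [w]^(1/p) is finite and positive and is divided out at the end. *)

Section cubes.
Context {R : realType} (n : nat).
Local Notation N := n.+1.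
Local Notation V := 'rV[R]_N.
Local Notation mu := (lebesgue_rV N : {measure set V -> \bar R}).
Implicit Types (c x y : V) (l : R) (A E : set V).

(** Half-open, so that the children partition the cube exactly. As the lower faces are excluded, a
    cube whose bottom face lies on the boundary hyperplane is still inside the open half-space. *)
Definition cube c l : set V :=
  [set x | forall i, c ord0 i < x ord0 i <= c ord0 i + l].

Definition child_corner (e : {ffun 'I_N -> bool}) c l : V :=
  \row_i (c ord0 i + l / 2 * (e i)%:R).

Lemma measurable_coord_set (i : 'I_N) (B : set R) :
  measurable B -> measurable [set x : V | B (x ord0 i)].
Proof.
by move=> mB; rewrite -[X in measurable X]setTI; exact: measurable_coord.
Qed.

Lemma measurable_forall (P : 'I_N -> set V) :
  (forall i, measurable (P i)) -> measurable [set x | forall i, P i x].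
Proof.
move=> mP; rewrite (_ : [set _ | _] = \big[setI/setT]_(i < N) P i).
  exact: bigsetI_measurable.
rewrite -bigcap_seq; apply/seteqP; split => [x Bx i _|x Bx i]; first exact: Bx.
by apply: Bx; rewrite /= mem_index_enum.
Qed.

Lemma measurable_le_coord (i : 'I_N) (q : R) :
  measurable [set x : V | x ord0 i <= q].
Proof.
rewrite (_ : mkset _ = [set x : V | `]-oo, q]%classic (x ord0 i)]).
  by apply: measurable_coord_set; exact: measurable_itv.
by apply/seteqP; split => x /=; rewrite in_itv.
Qed.

Lemma measurable_box c (d : 'I_N -> R) :
  measurable [set x : V | forall i, c ord0 i < x ord0 i <= c ord0 i + d i].
Proof.
apply: (@measurable_forall (fun i =>
  [set x : V | c ord0 i < x ord0 i <= c ord0 i + d i])) => i.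
have := @measurable_coord_set i `]c ord0 i, c ord0 i + d i]%classic
  (measurable_itv _).
by congr measurable; apply/seteqP; split => x /=; rewrite in_itv.
Qed.

Lemma measurable_cube c l : measurable (cube c l).
Proof. exact: (@measurable_box c (fun=> l)). Qed.
Hint Resolve measurable_cube : core.

Lemma mu_box c (d : 'I_N -> R) : (forall i, 0 <= d i) ->
  mu [set x : V | forall i, c ord0 i < x ord0 i <= c ord0 i + d i] =
  (\prod_i d i)%:E.
Proof.
move=> d0.
have -> : [set x : V | forall i, c ord0 i < x ord0 i <= c ord0 i + d i] =
    [set x : V | forall i, `]c ord0 i, c ord0 i + d i]%classic (x ord0 i)].
  by apply/seteqP; split => x /= h i; have := h i; rewrite in_itv.
apply: etrans (@lebesgue_rV_box R N
  (fun i => `]c ord0 i, c ord0 i + d i]%classic) (fun=> measurable_itv _)) _.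
rewrite (eq_bigr (fun i => (d i)%:E)); last first.
  move=> i _; rewrite lebesgue_measure_itv /= lte_fin ltrDl.
  have [l1|l1] := ltP 0 (d i); first by rewrite -EFinB addrAC subrr add0r.
  by congr EFin; apply/eqP; rewrite eq_le d0 l1.
by elim/big_rec2 : _ => // i x y _ ->; rewrite EFinM.
Qed.

Lemma mu_cube c l : 0 <= l -> mu (cube c l) = (l ^+ N)%:E.
Proof. by move=> l0; rewrite mu_box// prodr_const card_ord. Qed.

Definition child_of c l x : {ffun 'I_N -> bool} :=
  [ffun i => c ord0 i + l / 2 < x ord0 i].

Lemma in_child e c l x : 0 < l ->
  cube (child_corner e c l) (l / 2) x <-> cube c l x /\ e = child_of c l x.
Proof.
move=> l0; split.
  move=> h; split.
    move=> i; have := h i; rewrite mxE.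
    by case: (e i) => /= /andP[h1 h2]; apply/andP; lra.
  apply/ffunP => i; have := h i; rewrite mxE ffunE.
  case: (e i) => /= /andP[h1 h2]; first by apply/esym; lra.
  by apply: esym; apply: negbTE; rewrite -leNgt; lra.
move=> [h ->] i; have := h i; rewrite !mxE ffunE => /andP[h1 h2].
by case: (ltP (c ord0 i + l / 2)) => /= h3; apply/andP; lra.
Qed.

Lemma child_sub e c l : 0 < l ->
  cube (child_corner e c l) (l / 2) `<=` cube c l.
Proof. by move=> l0 x /(in_child _ _ _ l0)[]. Qed.

Lemma cube_children c l A : 0 < l ->
  A `&` cube c l = \bigcup_(e in [set: {ffun 'I_N -> bool}])
    (A `&` cube (child_corner e c l) (l / 2)).
Proof.
move=> l0; apply/seteqP; split => x.
  move=> [Ax Qx]; exists (child_of c l x) => //; split => //.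
  exact/in_child.
by move=> [e _ [Ax /(child_sub l0)]].
Qed.

Lemma trivIset_children c l A : 0 < l -> trivIset [set: {ffun 'I_N -> bool}]
    (fun e => A `&` cube (child_corner e c l) (l / 2)).
Proof.
move=> l0; apply/trivIsetP => e e' _ _ /eqP ee'; apply/seteqP; split => // x.
move=> [[_ /(in_child _ _ _ l0)[_ h]] [_ /(in_child _ _ _ l0)[_ h']]].
by apply: ee'; rewrite h h'.
Qed.

Lemma measure_children (nu : {measure set V -> \bar R}) c l A : 0 < l ->
  measurable A ->
  nu (A `&` cube c l) =
  (\sum_(e : {ffun 'I_N -> bool})
    nu (A `&` cube (child_corner e c l) (l / 2)))%E.
Proof.
move=> l0 mA; rewrite cube_children// measure_fin_bigcup//; last 3 first.
  exact: finite_finset.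
  exact: trivIset_children.
  by move=> e _; exact: measurableI.
rewrite (_ : [set: {ffun 'I_N -> bool}] =
  [set` index_enum {ffun 'I_N -> bool}]).
  by rewrite -fsbig_seq// index_enum_uniq.
by apply/seteqP; split => // e _ /=; rewrite mem_index_enum.
Qed.

(* The cubes cube c l contained in the half-space are those with adm c. *)
Definition adm c := 0 <= c ord0 ord_max.

Lemma adm_child e c l : 0 < l -> adm c -> adm (child_corner e c l).
Proof.
by rewrite /adm mxE => l0 c0; rewrite addr_ge0// mulr_ge0// divr_ge0// ltW.
Qed.

End cubes.
#[global] Hint Extern 0 (measurable (cube _ _)) => solve [apply: measurable_cube] : core.

Section density.
Context d (T : measurableType d) {R : realType}.
Variables (mu : {measure set T -> \bar R}) (g : T -> \bar R).

(** The two proofs are arguments of the definition so that the measure structure can be attached to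
    the term [dens mg g0]. *)
Definition dens of measurable_fun setT g & (forall x, 0 <= g x)%E :=
  fun A : set T => (\int[mu]_(x in A) g x)%E.

Variables (mg : measurable_fun setT g) (g0 : forall x, (0 <= g x)%E).

Let dens0 : dens mg g0 set0 = 0%E.
Proof. exact: integral_set0. Qed.

Let dens_ge0 A : (0 <= dens mg g0 A)%E.
Proof. exact: integral_ge0. Qed.

Let dens_sigma_additive : semi_sigma_additive (dens mg g0).
Proof.
move=> F mF tF mUF; rewrite /dens ge0_integral_bigcup//.
  apply: is_cvg_ereal_nneg_natsum_cond => i _ _; exact: integral_ge0.
exact: measurable_funS mg.
Qed.

HB.instance Definition _ := isMeasure.Build _ _ _ (dens mg g0)
  dens0 dens_ge0 dens_sigma_additive.

End density.

(** * Dyadic approximation of measurable sets *)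

Section dyadic.
Context {R : realType} (n : nat).
Local Notation N := n.+1.
Local Notation V := 'rV[R]_N.
Local Notation mu := (lebesgue_rV N : {measure set V -> \bar R}).
Implicit Types (c x y : V) (l : R) (A E U : set V).

(** Inside the cube, U is a union of dyadic subcubes of generation K. *)
Fixpoint dyadic K c l U : Prop :=
  if K is K'.+1 then forall e, dyadic K' (child_corner e c l) (l / 2) U
  else cube c l `<=` U \/ cube c l `<=` ~` U.

Lemma dyadicS K c l U : 0 < l -> dyadic K c l U -> dyadic K.+1 c l U.
Proof.
elim: K c l => [|K IH] c l l0.
  by move=> [h|h] e; [left|right]; apply: subset_trans h; exact: child_sub.
by move=> h e; apply: (IH _ _ _ (h e)); rewrite divr_gt0.
Qed.

Lemma dyadicW K K' c l U : 0 < l -> (K <= K')%N ->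
  dyadic K c l U -> dyadic K' c l U.
Proof.
move=> l0 /subnK <-; elim: (K' - K)%N => [//|m IH] h.
by rewrite addSn; apply: dyadicS => //; exact: IH.
Qed.

Lemma dyadicC K c l U : dyadic K c l U -> dyadic K c l (~` U).
Proof.
elim: K c l => [|K IH] c l /=; last by move=> h e; exact: IH.
by rewrite setCK => -[]; [right|left].
Qed.

Lemma dyadicU K c l U U' : dyadic K c l U -> dyadic K c l U' ->
  dyadic K c l (U `|` U').
Proof.
elim: K c l => [|K IH] c l /=; last by move=> h h' e; exact: IH.
move=> [h|h] [h'|h'].
- by left => x /h; left.
- by left => x /h; left.
- by left => x /h'; right.
- by right => x xQ -[]; [exact: h|exact: h'].
Qed.

Lemma dyadic_lehalf K c l i (m : int) : 0 < l ->
  dyadic K c l [set x : V | x ord0 i <= c ord0 i + l * m%:~R / 2 ^+ K].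
Proof.
elim: K c l m => [|K IH] c l m l0 /=.
  have [m0|m0] := leP m 0; [right|left] => x /(_ i) /andP[h1 h2] /=.
    apply/negP; rewrite -ltNge; apply: le_lt_trans h1.
    by rewrite expr0 divr1 gerDl pmulr_rle0// lerz0.
  apply: (le_trans h2); rewrite expr0 divr1 lerD2l; apply: ler_peMr; first exact: ltW.
  by rewrite ler1z -gtz0_ge1.
move=> e.
(* When e_i = 1 the corner of the child moves by l / 2, which is 2^K steps of the grid of mesh l /
   2^(K+1). Negative m can occur, hence the integers. *)
have -> : [set x : V | x ord0 i <= c ord0 i + l * m%:~R / 2 ^+ K.+1] =
  [set x : V | x ord0 i <= child_corner e c l ord0 i +
     l / 2 * (m - (e i : nat)%:Z * 2 ^+ K)%:~R / 2 ^+ K].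
  rewrite (_ : child_corner e c l ord0 i + _ = c ord0 i + l * m%:~R / 2 ^+ K.+1)//.
  rewrite mxE intrB intrM rmorphXn /= exprS.
  by field; rewrite expf_neq0.
by apply: IH; rewrite divr_gt0.
Qed.

Let sdiff A U := (A `\` U) `|` (U `\` A).

(** This approximation takes the place of Lebesgue differentiation along dyadic cubes; see
    [unstopped_null]. *)
Definition dyadic_approx c l A := forall e : R, 0 < e ->
  exists K U, [/\ measurable U, dyadic K c l U &
    (mu (cube c l `&` sdiff A U) <= e%:E)%E].

(** Rounding q down to the grid of mesh l / 2^K changes the set only in a slab of that thickness,
    whose part in the cube has measure at most l^N / 2^K. *)
Lemma dyadic_approx_lehalf c l i (q : R) : 0 < l ->
  dyadic_approx c l [set x : V | x ord0 i <= q].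
Proof.
move=> l0 e e0.
have [K Ke] : exists K : nat, l ^+ N / 2 ^+ K <= e.
  exists (Num.truncn (l ^+ N / e)).+1.
  rewrite ler_pdivrMr ?exprn_gt0// mulrC -ler_pdivrMr//.
  apply: (le_trans (ltW (truncnS_gt _))).
  by rewrite -natrX ler_nat ltnW// ltn_expl.
pose h := l / 2 ^+ K.
have h0 : 0 < h by rewrite divr_gt0// exprn_gt0.
pose m := Num.floor ((q - c ord0 i) / h).
have [m1 m2] : m%:~R * h <= q - c ord0 i /\ q - c ord0 i < (m%:~R + 1) * h.
  split; first by rewrite -ler_pdivlMr// floor_le_tmp.
  by rewrite -ltr_pdivrMr// -(intrD _ m 1) floorD1_gt.
have hE : l * m%:~R / 2 ^+ K = m%:~R * h by rewrite /h mulrAC mulrC mulrA.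
exists K, [set x : V | x ord0 i <= c ord0 i + l * m%:~R / 2 ^+ K]; split.
- exact: measurable_le_coord.
- exact: dyadic_lehalf.
pose c' : V := \row_j if j == i then c ord0 i + m%:~R * h else c ord0 j.
pose d (j : 'I_N) := l * (if j == i then (2 ^+ K)^-1 else 1).
apply: (@le_trans _ _
  (mu [set x : V | forall j, c' ord0 j < x ord0 j <= c' ord0 j + d j])).
  apply: le_measure; rewrite ?inE.
  - by apply: measurableI => //; apply: measurableU; apply: measurableD;
      exact: measurable_le_coord.
  - exact: measurable_box.
  rewrite hE => x [Qx [[/= xq /negP]|[/= xq /negP]]]; rewrite -ltNge => h1 j.
    rewrite /c' /d mxE; have := Qx j.
    have [->|ji] := eqVneq j i; last by rewrite mulr1.
    by move=> _; apply/andP; split => //; rewrite -/h; lra.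
  exfalso; lra.
rewrite mu_box => [|j]; last first.
  by rewrite /d mulr_ge0 ?ltW//; case: ifP => //; rewrite invr_ge0 exprn_ge0.
rewrite lee_fin big_split /= prodr_const card_ord -big_mkcond big_pred1_eq.
exact: Ke.
Qed.

Lemma dyadic_approxC c l A : dyadic_approx c l A -> dyadic_approx c l (~` A).
Proof.
move=> h e /h[K [U [mU dU AU]]]; exists K, (~` U); split.
- exact: measurableC.
- exact: dyadicC.
by move: AU; rewrite /sdiff !setDE !setCK setUC (setIC U) (setIC A).
Qed.

Lemma measurable_sdiff A U : measurable A -> measurable U ->
  measurable (sdiff A U).
Proof. by move=> mA mU; apply: measurableU; exact: measurableD. Qed.

Lemma dyadic_approxU c l A B : 0 < l -> measurable A -> measurable B ->
  dyadic_approx c l A -> dyadic_approx c l B -> dyadic_approx c l (A `|` B).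
Proof.
move=> l0 mA mB hA hB e e0.
have e2 : 0 < e / 2 by rewrite divr_gt0.
have [K [U [mU dU AU]]] := hA _ e2.
have [K' [U' [mU' dU' AU']]] := hB _ e2.
exists (maxn K K'), (U `|` U'); split; first exact: measurableU.
  apply: dyadicU; [apply: dyadicW dU|apply: dyadicW dU'] => //.
    exact: leq_maxl.
  exact: leq_maxr.
rewrite [e]splitr EFinD; apply: le_trans (leeD AU AU').
apply: le_trans (measureU2 _ _ _); last 2 first.
- by apply: measurableI => //; exact: measurable_sdiff.
- by apply: measurableI => //; exact: measurable_sdiff.
apply: le_measure; rewrite ?inE.
- apply: measurableI => //; apply: measurable_sdiff; exact: measurableU.
- apply: measurableU; apply: measurableI => //; exact: measurable_sdiff.
move=> x [Qx [[[Ax|Bx] /not_orP[nU nU']]|[[Ux|Ux] /not_orP[nU nU']]]].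
- by left; split => //; left.
- by right; split => //; left.
- by left; split => //; right.
- by right; split => //; right.
Qed.

(** By continuity from above, a finite union misses at most e/2 of the measure in the cube; the
    other e/2 is spent on approximating that finite union. *)
Lemma dyadic_approx_bigcup c l (F : (set V)^nat) : 0 < l ->
  (forall i, measurable (F i)) -> (forall i, dyadic_approx c l (F i)) ->
  dyadic_approx c l (\bigcup_i F i).
Proof.
move=> l0 mF hF e e0.
have e2 : 0 < e / 2 by rewrite divr_gt0.
pose G m := \big[setU/set0]_(i < m) F i.
have mG m : measurable (G m) by exact: bigsetU_measurable.
have hG m : dyadic_approx c l (G m).
  elim: m => [|m IH]; last first.
    by rewrite /G big_ord_recr /=; apply: dyadic_approxU => //; exact: bigsetU_measurable.
  move=> r r0; exists 0%N, set0; split => //; first by right=> x _ [].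
  by rewrite /G big_ord0 /sdiff !setD0 setU0 setI0 measure0 lee_fin ltW.
have mUF : measurable (\bigcup_i F i) by exact: bigcupT_measurable.
have mFG m : measurable (cube c l `&` (\bigcup_i F i `\` G m)).
  by apply: measurableI; [exact: measurable_cube|exact: measurableD].
have cvg0 : mu (cube c l `&` (\bigcup_i F i `\` G m)) @[m --> \oo] --> (0 : \bar R)%E.
  rewrite [X in _ --> X](_ : _ =
      mu (\bigcap_m (cube c l `&` (\bigcup_i F i `\` G m)))).
    apply: nonincreasing_cvg_mu.
    - apply: (@le_lt_trans _ _ (mu (cube c l))); last by rewrite mu_cube ?ltry// ltW.
      by apply: le_measure; rewrite ?inE//; exact: subIsetl.
    - exact: mFG.
    - exact: bigcapT_measurable.
    - move=> a b ab; apply/subsetPset; apply: setIS; apply: setDS.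
      exact: subset_bigsetU.
  rewrite (_ : \bigcap__ _ = set0) ?measure0//.
  apply/seteqP; split => // x /= h; have [_ [[i _ Fix] _]] := h 0%N I.
  have [_ [_]] := h i.+1 I; apply.
  by rewrite /G -bigcup_mkord; exists i => /=.
have [m hm] : exists m, (mu (cube c l `&` (\bigcup_i F i `\` G m)) <= (e / 2)%:E)%E.
  have : \forall m \near \oo, (mu (cube c l `&` (\bigcup_i F i `\` G m)) < (e / 2)%:E)%E.
    by apply: (cvg0 (fun u => (u < _)%E)); apply: open_ereal_lt'; rewrite lte_fin.
  by move=> [m _ /(_ m (leqnn m)) h]; exists m; exact: ltW.
have [K [U [mU dU AU]]] := hG m _ e2.
exists K, U; split => //.
rewrite [e]splitr EFinD; apply: le_trans (leeD hm AU).
have mQ := @measurable_cube R n c l.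
apply: le_trans (measureU2 _ _ _); last 2 first.
- exact: mFG.
- by apply: measurableI; [exact: mQ|exact: measurable_sdiff].
apply: le_measure; rewrite ?inE.
- by apply: measurableI; [exact: mQ|exact: measurable_sdiff].
- apply: measurableU; first exact: mFG.
  by apply: measurableI; [exact: mQ|exact: measurable_sdiff].
have GF : G m `<=` \bigcup_i F i.
  by rewrite /G -bigcup_mkord; apply: bigcup_subset => //; exact: subsetT.
move=> x [Qx [[Ax nUx]|[Ux nAx]]].
  have [Gx|nGx] := pselect (G m x); first by right; split => //; left.
  by left.
by right; split => //; right; split => // /GF.
Qed.

(** The approximable measurable sets form a sigma-algebra. It contains the sets x_i <= q, hence the
    preimages of the intervals ]a, b] that generate the Borel sets of the line. *)
Lemma measurable_dyadic_approx c l A : 0 < l -> measurable A ->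
  dyadic_approx c l A.
Proof.
move=> l0.
pose G := [set B : set V | measurable B /\ dyadic_approx c l B].
have G0 : G set0.
  split => // r r0; exists 0%N, set0; split => //; first by right=> x _ [].
  by rewrite /sdiff !setD0 setU0 setI0 measure0 lee_fin ltW.
have GC B : G B -> G (~` B).
  by move=> [mB hB]; split; [exact: measurableC|exact: dyadic_approxC].
have Gcup (F : (set V)^nat) : (forall i, G (F i)) -> G (\bigcup_i F i).
  move=> GF; split; first by apply: bigcupT_measurable => i; exact: (GF i).1.
  by apply: dyadic_approx_bigcup => // i; [exact: (GF i).1|exact: (GF i).2].
suff: (measurable : set (set V)) `<=` G by move=> h /h[].
apply: smallest_sub.
  split => //; first by move=> B /GC; rewrite setTD.
  rewrite -bigcup_seq; apply: bigcup_sub => i _ _ [B mB <-].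
rewrite setTI.
suff: (measurable : set (set (measurableTypeR R))) `<=`
   [set B | G ((fun x : V => x ord0 i) @^-1` B)] by exact.
apply: smallest_sub.
  split; first exact: G0.
  - by move=> C /GC; rewrite setTD.
  - by move=> F GF; rewrite /= preimage_bigcup; exact: Gcup.
have Gle q : G [set x : V | x ord0 i <= q].
  split; last exact: dyadic_approx_lehalf.
  exact: measurable_le_coord.
move=> _ [[a b] _ <-] /=.
rewrite (_ : _ @^-1` _ =
  ~` ((~` [set x : V | x ord0 i <= b]) `|` [set x : V | x ord0 i <= a])).
  apply: (GC _); split; first by apply: measurableU; [exact: (GC _ (Gle b)).1|exact: (Gle a).1].
  apply: dyadic_approxU => //; [exact: (GC _ (Gle b)).1|exact: (Gle a).1|
    exact: (GC _ (Gle b)).2|exact: (Gle a).2].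
rewrite setCU setCK; apply/seteqP; split => x /=; rewrite in_itv/=.
  by move=> /andP[ax xb]; split => //; apply/negP; rewrite -ltNge.
by move=> [xb /negP]; rewrite -ltNge xb andbT.
Qed.

End dyadic.

(** * Stopping cubes and the John-Nirenberg inequality *)

Section stopping.
Context {R : realType} (n : nat).
Local Notation N := n.+1.
Local Notation V := 'rV[R]_N.
Local Notation mu := (lebesgue_rV N : {measure set V -> \bar R}).
Implicit Types (c x y : V) (l : R) (A E U : set V).
Variables (g : V -> \bar R) (mg : measurable_fun setT g)
  (g0 : forall x, (0 <= g x)%E).
Let gm : {measure set V -> \bar R} := dens mu mg g0.

(** The threshold is twice the bound 1 that [mm_mean] gives for the initial cube, so that the
    stopped cubes fill at most half of it. *)
Definition bad c l := (2%:E * mu (cube c l) < gm (cube c l))%E.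

(* The union of the maximal cubes, among the dyadic subcubes of the first K
   generations, on which the mean of g exceeds 2. *)
Fixpoint stopped K c l : set V :=
  if K is K'.+1 then [set x | exists e : {ffun 'I_N -> bool},
    cube (child_corner e c l) (l / 2) x /\
    (bad (child_corner e c l) (l / 2) \/
     stopped K' (child_corner e c l) (l / 2) x)]
  else set0.

Lemma stopped_sub K c l : 0 < l -> stopped K c l `<=` cube c l.
Proof. by case: K => [|K] l0 x //= [e [xe _]]; exact: child_sub xe. Qed.

Lemma stopped_child K c l (e : {ffun 'I_N -> bool}) : 0 < l ->
  stopped K.+1 c l `&` cube (child_corner e c l) (l / 2) =
  if bad (child_corner e c l) (l / 2) then cube (child_corner e c l) (l / 2)
  else stopped K (child_corner e c l) (l / 2).
Proof.
move=> l0; apply/seteqP; split => x.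
  move=> [[e' [xe' h]] xe].
  have ee' : e' = e.
    by have [_ ->] := (in_child _ _ _ l0).1 xe'; have [_ ->] := (in_child _ _ _ l0).1 xe.
  by move: h; rewrite ee'; case: ifPn => // /negP nb [//|].
case: ifPn => [be xe|be xe].
  by split => //; exists e; split => //; left.
have xe' : cube (child_corner e c l) (l / 2) x.
  by apply: stopped_sub xe; rewrite divr_gt0.
by split => //; exists e; split => //; right.
Qed.

Lemma measurable_stopped K c l : 0 < l -> measurable (stopped K c l).
Proof.
elim: K c l => [|K IH] c l l0; first exact: measurable0.
rewrite -(setIidl (@stopped_sub K.+1 c l l0)) cube_children//.
apply: fin_bigcup_measurable; first exact: finite_finset.
move=> e _; rewrite stopped_child//; case: ifP => _; first exact: measurable_cube.
by apply: IH; rewrite divr_gt0.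
Qed.

Lemma stoppedS K c l : 0 < l -> stopped K c l `<=` stopped K.+1 c l.
Proof.
elim: K c l => [|K IH] c l l0 //=.
move=> x [e [xe h]]; exists e; split => //; case: h => [h|h]; [by left|right].
by apply: (IH _ _ _ _ h); rewrite divr_gt0.
Qed.

Lemma measure_stopped (nu : {measure set V -> \bar R}) K c l A : 0 < l ->
  measurable A ->
  nu (A `&` stopped K.+1 c l) = (\sum_(e : {ffun 'I_N -> bool})
    nu (A `&` if bad (child_corner e c l) (l / 2)
              then cube (child_corner e c l) (l / 2)
              else stopped K (child_corner e c l) (l / 2)))%E.
Proof.
move=> l0 mA; rewrite -(setIidl (@stopped_sub K.+1 c l l0)) setIA.
rewrite measure_children//; last first.
  by apply: measurableI => //; exact: measurable_stopped.
by apply: eq_bigr => e _; rewrite -setIA stopped_child.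
Qed.

Lemma stopped_mean K c l : 0 < l ->
  (2%:E * mu (stopped K c l) <= gm (stopped K c l))%E.
Proof.
elim: K c l => [|K IH] c l l0 /=; first by rewrite !measure0 mule0.
have h := @measure_stopped mu K c l setT l0 measurableT.
have h' := @measure_stopped gm K c l setT l0 measurableT.
rewrite setTI in h; rewrite setTI in h'; rewrite [X in mu X]/= in h.
rewrite (h : mu _ = _) (h' : gm _ = _) ge0_sume_distrr//.
apply: lee_sum => e _; rewrite !setTI; case: ifPn => [/ltW//|_].
by apply: IH; rewrite divr_gt0.
Qed.

(** The parent of a maximal bad cube is not bad and has 2^N times its measure, so the mean of g on a
    stopped cube is at most 2^(N+1). The hypothesis on nu is thus only asked of cubes with that
    bound. *)
Lemma measure_stopped_le (nu : {measure set V -> \bar R}) (r : R) K c l A :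
  0 < l -> adm c -> measurable A -> ~~ bad c l ->
  (forall c' l', 0 < l' -> adm c' ->
     (gm (cube c' l') <= (2 ^+ N.+1)%:E * mu (cube c' l'))%E ->
     (nu (A `&` cube c' l') <= r%:E * nu (cube c' l'))%E) ->
  0 <= r ->
  (nu (A `&` stopped K c l) <= r%:E * nu (stopped K c l))%E.
Proof.
move=> + + mA + H r0.
elim: K c l => [|K IH] c l l0 ac nb.
  by rewrite setI0 !measure0 mule0.
have h := @measure_stopped nu K c l setT l0 measurableT.
rewrite setTI in h; rewrite h measure_stopped// ge0_sume_distrr//.
have l20 : 0 < l / 2 by rewrite divr_gt0.
apply: lee_sum => e _; rewrite !setTI; case: ifPn => [be|nbe]; last first.
  by apply: IH => //; exact: adm_child.
apply: H => //; first exact: adm_child.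
apply: (@le_trans _ _ (gm (cube c l))).
  apply: le_measure; rewrite ?inE; [exact: measurable_cube|exact: measurable_cube|].
  exact: child_sub.
apply: (@le_trans _ _ (2%:E * mu (cube c l))%E); first by rewrite leNgt.
have [l0' l20'] := (ltW l0, ltW l20).
rewrite !mu_cube// -!EFinM lee_fin expr_div_n (exprS 2).
by rewrite -mulrA (mulrCA _ (l ^+ N)) divff ?mulr1// expf_neq0.
Qed.

(** What remains of U after K generations is a union of cubes that are not bad, and the bound adds
    up over them. *)
Lemma unstopped_mean K c l U : 0 < l -> ~~ bad c l -> dyadic K c l U ->
  measurable U ->
  (gm ((U `&` cube c l) `\` stopped K c l) <=
   2%:E * mu ((U `&` cube c l) `\` stopped K c l))%E.
Proof.
elim: K c l => [|K IH] c l l0 nb dU mU.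
  rewrite setD0; case: dU => h; last first.
    rewrite (_ : U `&` _ = set0) ?measure0 ?mule0//.
    by apply/seteqP; split => // x [Ux /h].
  by rewrite setIidr//; move: nb; rewrite /bad -leNgt.
have mS K' c' l' : 0 < l' -> measurable (U `\` stopped K' c' l').
  by move=> ?; apply: measurableD => //; exact: measurable_stopped.
rewrite (_ : _ `\` _ = (U `\` stopped K.+1 c l) `&` cube c l); last first.
  by rewrite !setDE setIAC.
rewrite !measure_children//; [|exact: mS|exact: mS].
rewrite ge0_sume_distrr//; apply: lee_sum => e _.
have l20 : 0 < l / 2 by rewrite divr_gt0.
have -> : (U `\` stopped K.+1 c l) `&` cube (child_corner e c l) (l / 2) =
   (U `&` cube (child_corner e c l) (l / 2)) `\`
   (stopped K.+1 c l `&` cube (child_corner e c l) (l / 2)).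
  apply/seteqP; split => x.
    by move=> [[Ux nx] cx]; split => // -[].
  by move=> [[Ux cx] nx]; split => //; split => // sx; apply: nx.
rewrite stopped_child//; case: ifPn => [be|nbe].
  rewrite (_ : _ `\` _ = set0) ?measure0 ?mule0//.
  by apply/seteqP; split => // x [[]].
by apply: IH => //; exact: dU.
Qed.

(** If g >= 2 + d on a part F of E with measure t > 0, approximate F by a dyadic U. The unstopped
    part W of U contains most of F and little else, but g has integral at most 2 |W| over it, which
    is too small. *)
Lemma unstopped_null c l E : 0 < l -> ~~ bad c l -> measurable E ->
  E `<=` cube c l -> (forall K, E `&` stopped K c l = set0) ->
  (forall x, E x -> (2%:E < g x)%E) -> mu E = 0%E.
Proof.
move=> l0 nb mE EQ ES Eg.
pose F (m : nat) := E `&` [set x | ((2 + m.+1%:R^-1)%:E <= g x)%E].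
have mF m : measurable (F m).
  apply: measurableI => //; rewrite -[X in measurable X]setTI.
  exact: emeasurable_fun_c_infty.
suff H m : mu (F m) = 0%E.
  apply/negligibleP => //; apply: (@negligibleS _ _ _ _ (\bigcup_m F m)).
    move=> x Ex; have := Eg _ Ex; case E1 : (g x) => [r| |//] h; last first.
      by exists 0%N => //; split => //=; rewrite E1 leey.
    rewrite lte_fin -subr_gt0 in h.
    exists (Num.truncn (r - 2)^-1) => //; split => //=.
    rewrite E1 lee_fin addrC -lerBrDr invf_ple ?posrE//.
    exact/ltW/truncnS_gt.
  by apply: negligible_bigcup => m; apply: (negligibleP _ (mF m)).2; exact: H.
have mQ : measurable (cube c l) by exact: measurable_cube.
have Qfin : (mu (cube c l) < +oo)%E by rewrite mu_cube ?ltry// ltW.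
have fin A : measurable A -> A `<=` cube c l -> mu A \is a fin_num.
  move=> mA AQ; rewrite ge0_fin_numE//; apply: le_lt_trans Qfin.
  by apply: le_measure; rewrite ?inE.
have FQ : F m `<=` cube c l by move=> x [/EQ].
set d : R := m.+1%:R^-1; have d0 : 0 < d by rewrite invr_gt0.
have [//|t0] := eqVneq (mu (F m)) 0%E; exfalso.
set t := fine (mu (F m)).
have tE : mu (F m) = t%:E by rewrite fineK// fin.
have {}t0 : 0 < t.
  by rewrite -lte_fin -tE lt0e t0 measure_ge0.
(* For this e the inequality (2 + d) (t - e) <= 2 (t + e), reached at the end, would read d t <= (4
   + d) e = d t / 2. *)
set e := d * t / (2 * (4 + d)).
have e0 : 0 < e by rewrite divr_gt0// ?mulr_gt0// addr_gt0.
have [K [U [mU dU FU]]] := measurable_dyadic_approx c l0 (mF m) e0.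
have mS := @measurable_stopped K c l l0.
set W := (U `&` cube c l) `\` stopped K c l.
have mW : measurable W by apply: measurableD => //; exact: measurableI.
have mFW : measurable (F m `&` W) by exact: measurableI.
have mFU : measurable (cube c l `&` (F m `\` U `|` U `\` F m)).
  by apply: measurableI => //; apply: measurableU; exact: measurableD.
have gW := unstopped_mean l0 nb dU mU; rewrite -/W in gW.
have h1 : (mu W <= (t + e)%:E)%E.
  rewrite EFinD -tE; apply: le_trans (leeD2l _ FU).
  apply: le_trans (measureU2 _ _ _) => //; apply: le_measure; rewrite ?inE//.
    exact: measurableU.
  move=> x [[Ux Qx] _]; have [Fx|nFx] := pselect (F m x); first by left.
  by right; split => //; right.
have h2 : (t%:E <= mu (F m `&` W) + e%:E)%E.
  rewrite -tE; apply: le_trans (leeD2l _ FU).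
  apply: le_trans (measureU2 _ _ _) => //; apply: le_measure; rewrite ?inE//.
    exact: measurableU.
  move=> x Fx; have [Ux|nUx] := pselect (U x); last first.
    by right; split; [exact: FQ|left].
  left; split => //; split; first by split => //; exact: FQ.
  by move=> Sx; have : (E `&` stopped K c l) x by [split => //; case: Fx]; rewrite ES.
have h3 : ((2 + d)%:E * mu (F m `&` W) <= 2%:E * mu W)%E.
  apply: le_trans gW; apply: (@le_trans _ _ (gm (F m `&` W))); last first.
    by apply: le_measure; rewrite ?inE//; exact: subIsetr.
  rewrite -integral_cst//; apply: ge0_le_integral => //.
  - by move=> x _; rewrite lee_fin addr_ge0// ltW.
  - exact: measurable_funS mg.
  - by move=> x [[_ Fx] _].
have fW : mu (F m `&` W) \is a fin_num.
  by apply: fin => // x [/FQ].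
have fW' : mu W \is a fin_num by apply: fin => // x [[]].
move: h1 h2 h3; rewrite -(fineK fW) -(fineK fW') -EFinD -!EFinM !lee_fin.
set s := fine (mu (F m `&` W)); set u := fine _ => h1 h2 h3.
have : (2 + d) * (t - e) <= 2 * (t + e).
  apply: (@le_trans _ _ ((2 + d) * s)); first by rewrite ler_pM2l; lra.
  by apply: (le_trans h3); rewrite ler_pM2l//; lra.
have : e * (2 * (4 + d)) = d * t by rewrite /e divfK// gt_eqF// mulr_gt0// addr_gt0.
have : 0 < d * t by rewrite mulr_gt0.
by nra.
Qed.

End stopping.

(** * Means of a pseudometric over cubes *)

Section mean_metric.
Context {R : realType} (n : nat).
Local Notation N := n.+1.
Local Notation V := 'rV[R]_N.
Local Notation mu := (lebesgue_rV N : {measure set V -> \bar R}).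
Implicit Types (c x y z : V) (l : R) (A E U : set V).

Definition avg (b : V -> V -> R) c l x : \bar R :=
  ((l ^- N)%:E * \int[mu]_(y in cube c l) (b x y)%:E)%E.

(* Both b = 1 and b x y = |a x - a y| / D, with a of mean oscillation at most D,
   qualify: they yield the operators Kt and Ct respectively. *)
Record mean_metric (b : V -> V -> R) : Prop := MeanMetric {
  mm_measurable : measurable_fun setT (fun z : V * V => b z.1 z.2) ;
  mm_ge0 : forall x y, 0 <= b x y ;
  mm_sym : forall x y, b x y = b y x ;
  mm_triangle : forall x y z, b x z <= b x y + b y z ;
  mm_mean : forall c l, 0 < l -> adm c ->
    (\int[mu]_(x in cube c l) avg b c l x <= (l ^+ N)%:E)%E }.

Variables (b : V -> V -> R) (bP : mean_metric b).

Let b0 x y : (0 <= (b x y)%:E)%E. Proof. by rewrite lee_fin mm_ge0. Qed.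

Lemma measurable_mm1 x : measurable_fun setT (b x).
Proof. exact: measurable_fun_pair2 (mm_measurable bP). Qed.

Lemma measurable_mmE x A : measurable_fun A (fun y => (b x y)%:E).
Proof. by apply: measurable_funTS; apply/measurable_EFinP; exact: measurable_mm1. Qed.

Lemma avg_ge0 c l x : 0 < l -> (0 <= avg b c l x)%E.
Proof.
move=> l0; apply: mule_ge0; last by apply: integral_ge0 => y _; exact: b0.
by rewrite lee_fin invr_ge0 exprn_ge0// ltW.
Qed.

Lemma measurable_avg c l : measurable_fun setT (avg b c l).
Proof.
apply: measurable_funeM.
rewrite [X in measurable_fun _ X](_ : _ = fubini_F (lebesgue_rV N)
  (fun z : V * V => (b z.1 z.2 * \1_(cube c l) z.2)%:E)); last first.
  apply/funext => x; rewrite /fubini_F [LHS]integral_mkcond; apply: eq_integral => y _.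
  by rewrite patchE indicE; case: ifPn => _ /=; rewrite ?mulr1 ?mulr0.
apply: measurable_fun_fubini_tonelli_F.
  apply/measurable_EFinP; apply: measurable_funM; first exact: mm_measurable.
  by apply: measurableT_comp measurable_snd; exact: measurable_indic.
by move=> z; rewrite lee_fin mulr_ge0// mm_ge0.
Qed.

Lemma int_cube_cst c l (r : \bar R) : 0 < l ->
  ((l ^- N)%:E * \int[mu]_(_ in cube c l) r = r)%E.
Proof.
move=> l0; rewrite integral_cst//= mu_cube ?ltW//.
by rewrite muleCA -EFinM mulVf ?mule1// expf_neq0// gt_eqF.
Qed.

Lemma avg_le_point c l x y : 0 < l -> (avg b c l x <= (b x y)%:E + avg b c l y)%E.
Proof.
move=> l0; rewrite -(@int_cube_cst c l (b x y)%:E)// -ge0_muleDr; last 2 first.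
- by apply: integral_ge0 => z _; exact: b0.
- by apply: integral_ge0 => z _; exact: b0.
rewrite -ge0_integralD//; last exact: measurable_mmE.
apply: lee_wpmul2l; first by rewrite lee_fin invr_ge0 exprn_ge0// ltW.
apply: ge0_le_integral => //.
- exact: measurable_mmE.
- by apply: emeasurable_funD => //; exact: measurable_mmE.
- by move=> z _; rewrite -EFinD lee_fin mm_triangle.
Qed.

Lemma le_avg_add c l x y : 0 < l -> ((b x y)%:E <= avg b c l x + avg b c l y)%E.
Proof.
move=> l0; rewrite -(@int_cube_cst c l (b x y)%:E)// -ge0_muleDr; last 2 first.
- by apply: integral_ge0 => z _; exact: b0.
- by apply: integral_ge0 => z _; exact: b0.
rewrite -ge0_integralD//; [|exact: measurable_mmE|exact: measurable_mmE].
apply: lee_wpmul2l; first by rewrite lee_fin invr_ge0 exprn_ge0// ltW.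
apply: ge0_le_integral => //.
- by apply: emeasurable_funD; exact: measurable_mmE.
- by move=> z _; rewrite -EFinD lee_fin (mm_sym bP y) mm_triangle.
Qed.

(** This is [avg_le_point] averaged over its second point. It changes the reference cube: to a
    stopped subcube in [john_nirenberg], to a cube of half the side in [avg_outer_le]. *)
Lemma avg_compare c l c' l' x : 0 < l -> 0 < l' ->
  (avg b c l x <= avg b c' l' x +
     (l' ^- N)%:E * \int[mu]_(z in cube c' l') avg b c l z)%E.
Proof.
move=> l0 l0'; rewrite -(@int_cube_cst c' l' (avg b c l x))// /(avg b c' l' x).
have a0 z : (0 <= avg b c l z)%E by exact: avg_ge0.
have ma A : measurable_fun A (avg b c l).
  by apply: measurable_funTS; exact: measurable_avg.
rewrite -ge0_muleDr; [|exact: integral_ge0|exact: integral_ge0].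
rewrite -ge0_integralD//; last exact: measurable_mmE.
apply: lee_wpmul2l; first by rewrite lee_fin invr_ge0 exprn_ge0// ltW.
apply: ge0_le_integral => //.
- by apply: emeasurable_funD => //; exact: measurable_mmE.
- by move=> z _; exact: avg_le_point.
Qed.

Section john_nirenberg.
Variables (nu : {measure set V -> \bar R}) (beta : R).
Hypothesis beta0 : 0 <= beta.
Hypothesis nu_half : forall c l A, 0 < l -> adm c -> measurable A ->
  A `<=` cube c l -> (2%:E * mu A <= mu (cube c l))%E ->
  (nu A <= beta%:E * nu (cube c l))%E.
Hypothesis nu_null : forall A, measurable A -> mu A = 0%E -> nu A = 0%E.

(** Stop on g = [avg b c l]. The union O of the stopped cubes has at most half of the Lebesgue
    measure, hence at most beta of the nu-measure. On a stopped cube the mean of g is at most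
    2^(N+1), so by [avg_compare] a point where g exceeds k+1 steps of that size exceeds k steps
    relative to the stopped cube, and induction on k applies there. Off O the set where g > 2 is
    null. Working with nu from the start yields the decay for a weight and for its dual alike. *)
Lemma john_nirenberg k c l : 0 < l -> adm c ->
  (nu (cube c l `&` [set x | ((k%:R * 2 ^+ N.+1)%:E < avg b c l x)%E]) <=
   (beta ^+ k)%:E * nu (cube c l))%E.
Proof.
have mI c' l' (r : R) : measurable [set x | (r%:E < avg b c' l' x)%E].
  rewrite -[X in measurable X]setTI; apply: emeasurable_fun_o_infty => //.
  exact: measurable_avg.
elim: k c l => [|k IH] c l l0 ac.
  rewrite expr0 mul1e; apply: le_measure; rewrite ?inE//.
  exact: measurableI.
have mQ : measurable (cube c l) by exact: measurable_cube.
set r : R := k.+1%:R * 2 ^+ N.+1.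
pose g := avg b c l.
have mg : measurable_fun setT g by exact: measurable_avg.
have g0 x : (0 <= g x)%E by exact: avg_ge0.
pose gm : {measure set V -> \bar R} := dens mu mg g0.
pose A := [set x | (r%:E < g x)%E].
have mA : measurable A by exact: mI.
have gQ : (gm (cube c l) <= mu (cube c l))%E.
  have l0' := ltW l0.
  by rewrite [leRHS]mu_cube//; exact: (mm_mean bP).
have Qfin : (mu (cube c l) < +oo)%E by rewrite mu_cube ?ltry// ltW.
have nb : ~~ bad mg g0 c l.
  rewrite /bad -leNgt; apply: (le_trans gQ).
  rewrite -[leLHS]mul1e; apply: lee_wpmul2r => //.
  by rewrite lee_fin ler1n.
pose S K := stopped mg g0 K c l.
have mS K : measurable (S K) by exact: measurable_stopped.
have SQ K : S K `<=` cube c l by exact: stopped_sub.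
have ndS : nondecreasing_seq S.
  by apply/nondecreasing_seqP => K; apply/subsetPset; exact: stoppedS.
pose O := \bigcup_K S K.
have mO : measurable O by exact: bigcupT_measurable.
have OQ : O `<=` cube c l by exact: bigcup_sub.
have muO : (2%:E * mu O <= mu (cube c l))%E.
  have h : (2%:E * mu (S K))%E @[K --> \oo] --> (2%:E * mu O)%E.
    by apply: cvgeZl => //; exact: nondecreasing_cvg_mu.
  apply: (cvge_le _ h); near=> K.
  apply: le_trans (@stopped_mean _ _ _ mg g0 K c l l0) _.
  by apply: le_trans gQ; apply: le_measure; rewrite ?inE; [exact: mS|exact: mQ|exact: SQ].
have nuO : (nu O <= beta%:E * nu (cube c l))%E by exact: nu_half.
have nuOA : (nu (A `&` O) <= (beta ^+ k.+1)%:E * nu (cube c l))%E.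
  have h : nu (A `&` S K) @[K --> \oo] --> nu (A `&` O).
    rewrite setI_bigcupr; apply: nondecreasing_cvg_mu.
    - by move=> K; exact: measurableI.
    - by apply: bigcupT_measurable => K; exact: measurableI.
    - move=> i j ij; apply/subsetPset; apply: setIS.
      by apply/subsetPset; exact: ndS.
  apply: (cvge_le _ h); near=> K.
  rewrite exprSr EFinM -muleA.
  have h1 : ((beta ^+ k)%:E * nu (S K) <= (beta ^+ k)%:E * (beta%:E * nu (cube c l)))%E.
    apply: lee_wpmul2l; first by rewrite lee_fin exprn_ge0.
    by apply: le_trans nuO; apply: le_measure; rewrite ?inE; [exact: mS|exact: mO|exact: bigcup_sup].
  apply: le_trans h1; apply: measure_stopped_le => //; last exact: exprn_ge0.
  move=> c' l' l0' ac' gm'; apply: le_trans (IH _ _ l0' ac').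
  apply: le_measure; rewrite ?inE.
  - by apply: measurableI => //; exact: measurable_cube.
  - by apply: measurableI => //; exact: measurable_cube.
  move=> x [Ax Qx]; split => //=; rewrite ltNge; apply/negP => h2.
  move: Ax; rewrite /A/= ltNge => /negP; apply.
  apply: le_trans (@avg_compare c l c' l' x l0 l0') _.
  rewrite /r -natr1 mulrDl mul1r EFinD; apply: leeD => //.
  apply: (@le_trans _ _ ((l' ^- N)%:E * ((2 ^+ N.+1)%:E * mu (cube c' l')))%E).
    by apply: lee_wpmul2l => //; rewrite lee_fin invr_ge0 exprn_ge0// ltW.
  have l0'' := ltW l0'; rewrite mu_cube// muleCA -!EFinM mulVf ?mulr1//.
  by rewrite expf_neq0// gt_eqF.
have mB : measurable ((cube c l `\` O) `&` A).
  by apply: measurableI => //; exact: measurableD.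
have nuB : nu ((cube c l `\` O) `&` A) = 0%E.
  apply: nu_null => //; apply: (@unstopped_null _ _ _ mg g0 c l) => //.
  - by move=> x [[]].
  - by move=> K; apply/seteqP; split => // x [[[_ nO] _] Sx]; apply: nO; exists K.
  - move=> x [_]; apply: le_lt_trans; rewrite lee_fin /r.
    rewrite exprS mulrCA ler_peMr// mulr_ege1//; first by rewrite ler1n.
    by rewrite exprn_ege1// ler1n.
rewrite (_ : _ `&` _ = (A `&` O) `|` ((cube c l `\` O) `&` A)).
  apply: (le_trans (measureU2 _ _ _)) => //; first exact: measurableI.
  by rewrite [X in (_ + X)%E](_ : _ = 0%E) ?adde0.
apply/seteqP; split => x.
  move=> [Qx Ax]; have [Ox|nOx] := pselect (O x); first by left.
  by right.
by move=> [[Ax /OQ]|[[Qx _] Ax]].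
Unshelve. all: by end_near. Qed.

End john_nirenberg.

End mean_metric.

(** * Weights of class A_infinity *)

Section series_bounds.
Context {R : realType}.

Lemma nneseries_geometric_le (a r : R) : 0 <= a -> 0 <= r -> r < 1 ->
  (\sum_(0 <= k <oo) (a * r ^+ k)%:E <= (a / (1 - r))%:E)%E.
Proof.
move=> a0 r0 r1; have r1' : 0 < 1 - r by rewrite subr_gt0.
apply: lime_le.
  by apply: is_cvg_nneseries => k _ _; rewrite lee_fin mulr_ge0// exprn_ge0.
near=> m; rewrite sumEFin lee_fin -mulr_sumr ler_wpM2l//.
rewrite big_mkord -[leRHS]mul1r ler_pdivlMr// mulrC -opprB mulNr -subrX1.
by rewrite opprB gerBl exprn_ge0.
Unshelve. all: by end_near. Qed.

Lemma exp_growth (r : R) : 0 <= r -> r < 1 -> exists2 e : R, 0 < e & expR e * r < 1.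
Proof.
(* Then expR e * r = 2 r / (1 + r), which is below 1. *)
move=> r0 r1; exists (- ln ((1 + r) / 2)).
  by rewrite oppr_gt0 ln_lt0//; apply/andP; split; lra.
rewrite expRN lnK ?posrE; last by lra.
by rewrite invf_div mulrAC ltr_pdivrMr; lra.
Qed.

(** The inequality 1 + z <= exp z at z = e (k + 1) / q, raised to the power q. *)
Lemma powR_expR_le (q e : R) : 0 < q -> 0 < e -> exists2 C : R, 0 <= C &
  forall k : nat, k.+1%:R `^ q <= C * expR e ^+ k.
Proof.
move=> q0 e0; exists ((q / e) `^ q * expR e).
  by rewrite mulr_ge0// ?powR_ge0// expR_ge0.
move=> k; rewrite -mulrA -exprS -expRM_natl.
have Z0 : 0 < e / q * k.+1%:R by rewrite mulr_gt0// divr_gt0.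
have -> : k.+1%:R `^ q = (q / e) `^ q * (e / q * k.+1%:R) `^ q.
  rewrite -powRM ?(ltW Z0) ?divr_ge0 ?(ltW q0) ?(ltW e0)//.
  by congr (_ `^ _); field; rewrite !gt_eqF.
apply: ler_wpM2l; first exact: powR_ge0.
have -> : expR (k.+1%:R * e) = expR (e / q * k.+1%:R) `^ q.
  by rewrite -expRM; congr expR; field; rewrite gt_eqF.
apply: ge0_ler_powR; rewrite ?nnegrE ?expR_ge0 ?(ltW q0) ?(ltW Z0)//.
by apply: le_trans (expR_ge1Dx _); rewrite lerDr.
Qed.

Lemma nneseries_powR_le (q r : R) : 0 < q -> 0 <= r -> r < 1 ->
  exists C : R, (\sum_(0 <= k <oo) (k.+1%:R `^ q * r ^+ k)%:E <= C%:E)%E.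
Proof.
move=> q0 r0 r1; have [e e0 er] := exp_growth r0 r1.
have [C C0 hC] := powR_expR_le q0 e0.
exists (C / (1 - expR e * r)).
apply: le_trans (nneseries_geometric_le C0 _ er); last first.
  by rewrite mulr_ge0// expR_ge0.
apply: lee_nneseries => [k _ _|k _].
  by rewrite lee_fin mulr_ge0// ?powR_ge0// exprn_ge0.
by rewrite lee_fin exprMn mulrA ler_wpM2r// exprn_ge0.
Qed.

End series_bounds.

Section weights.
Context {R : realType} (n : nat).
Local Notation N := n.+1.
Local Notation V := 'rV[R]_N.
Local Notation mu := (lebesgue_rV N : {measure set V -> \bar R}).
Implicit Types (c x y z : V) (l : R) (A E U : set V).

(** One of the equivalent forms of the A_infinity condition. This one follows from Hoelder's
    inequality and the A_p bound, for w and for its dual weight, and it contains the doubling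
    property. *)
Definition Ainf (v : V -> R) := forall t : R, 0 < t -> exists2 C : R, 0 < C &
  forall c l E, 0 < l -> measurable E -> E `<=` cube c l ->
    (t%:E * mu (cube c l) <= mu E)%E ->
    (wmeasure v (cube c l) <= C%:E * wmeasure v E)%E.

Record good_weight (v : V -> R) : Prop := GoodWeight {
  gw_measurable : measurable_fun setT v ;
  gw_gt0 : forall x, 0 < v x ;
  gw_fin : forall c l, (wmeasure v (cube c l) < +oo)%E ;
  gw_Ainf : Ainf v }.

Variables (v : V -> R) (vP : good_weight v).

Let mv : measurable_fun setT (fun x => (v x)%:E).
Proof. by apply/measurable_EFinP; exact: gw_measurable. Qed.
Let v0 x : (0 <= (v x)%:E)%E. Proof. by rewrite lee_fin ltW// gw_gt0. Qed.

Definition wm : {measure set V -> \bar R} := dens mu mv v0.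

(** The complement of A has at least half of the cube, so it carries at least the fraction 1 / C of
    the weight. Using C + 1 instead of C keeps beta nonnegative. *)
Lemma wm_half : exists beta : R, [/\ 0 <= beta, beta < 1 &
  forall c l A, 0 < l -> measurable A -> A `<=` cube c l ->
    (2%:E * mu A <= mu (cube c l))%E -> (wm A <= beta%:E * wm (cube c l))%E].
Proof.
have h2 : 0 < 2^-1 :> R by rewrite invr_gt0.
have [C C0 hC] := gw_Ainf vP h2.
exists (1 - (C + 1)^-1); have C1 : 0 < C + 1 by rewrite addr_gt0.
split.
- by rewrite subr_ge0 invf_le1// lerDr ltW.
- by rewrite ltrBlDr ltrDl invr_gt0.
move=> c l A l0 mA AQ hA.
have mQ := measurable_cube c l.
have mQA : measurable (cube c l `\` A) by exact: measurableD.
have fQ : wm (cube c l) \is a fin_num by rewrite ge0_fin_numE// (gw_fin vP).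
have muQ : mu (cube c l) \is a fin_num by rewrite mu_cube// ltW.
have muA : mu A \is a fin_num.
  rewrite ge0_fin_numE//; apply: (@le_lt_trans _ _ (mu (cube c l))).
    by apply: le_measure; rewrite ?inE.
  by rewrite ltey_eq muQ.
have fA : wm A \is a fin_num.
  rewrite ge0_fin_numE//; apply: (@le_lt_trans _ _ (wm (cube c l))).
    by apply: le_measure; rewrite ?inE.
  by rewrite ltey_eq fQ.
have : (wm (cube c l) <= C%:E * wm (cube c l `\` A))%E.
  apply: hC => //.
  have -> : mu (cube c l `\` A) = (mu (cube c l) - mu A)%E.
    by rewrite measureD// ?setIidr// ltey_eq muQ.
  move: hA; rewrite -(fineK muQ) -(fineK muA) -EFinM lee_fin => hA.
  by rewrite -EFinM -EFinB lee_fin; lra.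
have -> : wm (cube c l `\` A) = (wm (cube c l) - wm A)%E.
  by rewrite measureD// ?setIidr// ltey_eq fQ.
move: (measure_ge0 wm (cube c l)) (measure_ge0 wm A).
have : (wm A <= wm (cube c l))%E by apply: le_measure; rewrite ?inE.
rewrite -(fineK fQ) -(fineK fA); set q := fine _; set a := fine _.
rewrite -EFinB -!EFinM !lee_fin => aq q0 a0 h.
rewrite mulrBl mul1r lerBrDr -lerBrDl ler_pdivrMl//.
nra.
Qed.

Lemma wm_null A : measurable A -> mu A = 0%E -> wm A = 0%E.
Proof. by move=> mA A0; apply: null_set_integral => //; exact: measurable_funTS. Qed.

(** The layer of relative thickness 2^-(k+1) misses the upper children and is, in each lower child,
    the layer of relative thickness 2^-k. Induction gives beta^k times the weight of the lower half
    of the cube, and that half costs one more factor beta. *)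
Lemma boundary_layer (beta : R) k c l : 0 <= beta ->
  (forall c l A, 0 < l -> measurable A -> A `<=` cube c l ->
    (2%:E * mu A <= mu (cube c l))%E -> (wm A <= beta%:E * wm (cube c l))%E) ->
  0 < l ->
  (wm ([set x : V | (x ord0 ord_max <= c ord0 ord_max + l / 2 ^+ k)%R] `&` cube c l)
     <= (beta ^+ k)%:E * wm (cube c l))%E.
Proof.
move=> b0 H; elim: k c l => [|k IH] c l l0.
  by rewrite mul1e; apply: le_measure; rewrite ?inE//; apply: measurableI => //;
    exact: measurable_le_coord.
have l20 : 0 < l / 2 by rewrite divr_gt0.
have mL (r : R) : measurable [set x : V | x ord0 ord_max <= r].
  exact: measurable_le_coord.
rewrite measure_children//.
apply: (@le_trans _ _ (\sum_(e : {ffun 'I_N -> bool}) (beta ^+ k)%:E *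
  wm ([set x : V | (x ord0 ord_max <= c ord0 ord_max + l / 2)%R] `&`
      cube (child_corner e c l) (l / 2)))%E).
  apply: lee_sum => e _; case eE : (e ord_max).
    rewrite (_ : _ `&` _ = set0) ?measure0 ?mule_ge0//.
      by rewrite lee_fin exprn_ge0.
    apply/seteqP; split => // x [/= h /(_ ord_max)/andP[]]; rewrite mxE eE => + _.
    rewrite ltNge => /negP; apply; apply: (le_trans h).
    rewrite lerD2l mulr1 exprS invfM mulrA ler_piMr ?(ltW l20)//.
    by rewrite invf_le1 ?exprn_gt0// exprn_ege1// ler1n.
  have := IH (child_corner e c l) _ l20; rewrite mxE eE mulr0 addr0.
  rewrite exprS invfM mulrA => /le_trans; apply.
  apply: lee_wpmul2l; first by rewrite lee_fin exprn_ge0.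
  rewrite setIidr//; move=> x /(_ ord_max)/andP[_]; rewrite mxE eE mulr0 addr0.
  exact.
rewrite -ge0_sume_distrr// -measure_children// exprSr EFinM -muleA.
apply: lee_wpmul2l; first by rewrite lee_fin exprn_ge0.
apply: H => //; first by apply: measurableI => //; exact: measurable_cube.
have l0' := ltW l0.
have -> : [set x : V | x ord0 ord_max <= c ord0 ord_max + l / 2] `&` cube c l =
  [set x : V | forall i, c ord0 i < x ord0 i <= c ord0 i +
     l * (if i == ord_max then 2^-1 else 1)].
  apply/seteqP; split => x.
    move=> [/= h Qx] i; have /andP[h1 h2] := Qx i; rewrite h1 /=.
    by have [->|_] := eqVneq i ord_max; rewrite ?mulr1.
  move=> h; split => /=.
    by have := h ord_max; rewrite eqxx => /andP[].
  move=> i; have /andP[h1 h2] := h i; rewrite h1 (le_trans h2)// lerD2l.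
  by case: ifP => _; rewrite ler_piMr//; lra.
rewrite mu_box => [|i]; last by case: ifP => _; rewrite mulr_ge0.
rewrite mu_cube// big_split /= prodr_const card_ord -big_mkcond big_pred1_eq.
by rewrite -EFinM lee_fin mulrCA divff ?mulr1.
Qed.

(** A crude layer-cake bound: at each point one term of the sum of [psi k] times the indicator of
    [S k] already dominates Phi. It serves for the level sets of [avg] and for the boundary
    layers. *)
Lemma layer_integral Q (S : (set V)^nat) (Phi : V -> \bar R) (psi : nat -> R)
    (beta C M : R) :
  measurable Q -> measurable_fun Q Phi -> (forall x, Q x -> 0 <= Phi x)%E ->
  (forall k, measurable (S k)) -> (forall k, 0 <= psi k) -> 0 <= beta ->
  0 <= M ->
  (forall x, Q x -> exists2 k, S k x & (Phi x <= (psi k)%:E)%E) ->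
  (forall k, wm (S k) <= (beta ^+ k * M)%:E)%E ->
  (\sum_(0 <= k <oo) (psi k * beta ^+ k)%:E <= C%:E)%E ->
  (\int[mu]_(x in Q) (Phi x * (v x)%:E) <= (C * M)%:E)%E.
Proof.
move=> mQ mPhi Phi0 mS psi0 b0 M0 cov hS hC.
have h0 k x : (0 <= (psi k * \1_(S k) x * v x)%:E)%E.
  by rewrite lee_fin !mulr_ge0// ltW// gw_gt0.
have mh k : measurable_fun setT (fun x : V => (psi k * \1_(S k) x * v x)%:E).
  apply/measurable_EFinP; apply: measurable_funM (gw_measurable vP).
  by apply: measurable_funM => //; exact: measurable_indic.
apply: (@le_trans _ _ (\int[mu]_(x in Q)
    (\sum_(0 <= k <oo) (psi k * \1_(S k) x * v x)%:E))%E).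
  apply: ge0_le_integral => //.
  - by move=> x Qx; rewrite mule_ge0// Phi0.
  - by apply: emeasurable_funM => //; exact: (measurable_funTS mv).
  - by apply: ge0_emeasurable_sum => [k x _ _|k _]; [exact: h0|exact: measurable_funTS].
  move=> x /cov[k Sx hx].
  apply: (@le_trans _ _ (psi k * \1_(S k) x * v x)%:E).
    rewrite indicE mem_set// mulr1 EFinM; exact: lee_wpmul2r.
  apply: le_trans (nneseries_lim_ge k.+1 _); last by move=> *; exact: h0.
  rewrite big_nat_recr//= leeDr// sume_ge0// => i _; exact: h0.
rewrite integral_nneseries//; last by move=> k; exact: measurable_funTS.
apply: (@le_trans _ _ (\sum_(0 <= k <oo) (M%:E * (psi k * beta ^+ k)%:E))%E).
  apply: lee_nneseries => [k _ _|k _]; first exact: integral_ge0.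
  apply: (@le_trans _ _ ((psi k)%:E * wm (S k))%E); last first.
    rewrite -EFinM mulrCA EFinM (mulrC M); by apply: lee_wpmul2l; [rewrite lee_fin|exact: hS].
  apply: (@le_trans _ _ (\int[mu]_x (psi k * \1_(S k) x * v x)%:E)%E).
    by apply: ge0_subset_integral.
  rewrite (_ : wm (S k) = \int[mu]_(x in S k) (v x)%:E)%E//.
  rewrite (integral_mkcond (S k)) -ge0_integralZl//; last 3 first.
  - exact: ((measurable_restrictT _ (mS k)).1 (measurable_funTS mv)).
  - by move=> x _; rewrite patchE; case: ifP.
  - by rewrite lee_fin.
  rewrite le_eqVlt; apply/orP; left; apply/eqP; apply: eq_integral => x _.
  by rewrite patchE indicE; case: ifP => _; rewrite ?mulr1 ?mulr0 ?mul0r ?mule0.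
rewrite nneseriesZl//; last by move=> k _; rewrite lee_fin mulr_ge0// exprn_ge0.
by rewrite mulrC EFinM; exact: lee_wpmul2l.
Qed.

End weights.

(** * Weighted integrals of powers of the means and of the depth *)

Section weight_integrals.
Context {R : realType} (n : nat).
Local Notation N := n.+1.
Local Notation V := 'rV[R]_N.
Local Notation mu := (lebesgue_rV N : {measure set V -> \bar R}).
Implicit Types (c x y z : V) (l : R) (A E U : set V) (b : V -> V -> R).

(** By the triangle inequality, finiteness at one point spreads to every point, and [mm_mean] fails
    if [avg] is infinite everywhere. *)
Lemma avg_lty b c l x : mean_metric b -> 0 < l -> adm c ->
  (avg b c l x < +oo)%E.
Proof.
move=> bP l0 ac.
suff [y yoo] : exists y, (avg b c l y < +oo)%E.
  apply: le_lt_trans (avg_le_point bP c x y l0) _.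
  by rewrite lte_add_pinfty// ltry.
apply: contrapT => h.
have hoo y : avg b c l y = +oo%E.
  by apply/eqP; rewrite eq_le leey/= leNgt; apply/negP => yoo; apply: h; exists y.
have := mm_mean bP l0 ac; rewrite (eq_integral (fun=> +oo%E)); last first.
  by move=> y _; rewrite hoo.
have l0' := ltW l0.
by rewrite integral_cst//= ?mu_cube// gt0_mulye ?lte_fin ?exprn_gt0.
Qed.

Definition depth c l x : R := (x ord0 ord_max - c ord0 ord_max) / l.

Lemma depth_gt0 c l x : 0 < l -> cube c l x -> 0 < depth c l x.
Proof. by move=> l0 /(_ ord_max)/andP[h _]; rewrite divr_gt0// subr_gt0. Qed.

Lemma depth_le1 c l x : 0 < l -> cube c l x -> depth c l x <= 1.
Proof. by move=> l0 /(_ ord_max)/andP[_ h]; rewrite ler_pdivrMr// mul1r lerBlDl. Qed.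

Lemma measurable_depth c l (d : R) :
  measurable_fun setT (fun x : V => depth c l x `^ d).
Proof.
apply: (@measurableT_comp _ _ _ _ _ _ (fun t : R => t `^ d)).
  exact: measurable_powR.
apply: measurable_funM => //; apply: measurable_funB => //.
exact: measurable_coord.
Qed.

Lemma measurable_avg_powR b c l (q : R) : mean_metric b ->
  measurable_fun setT (fun x => avg b c l x `^ q)%E.
Proof.
move=> bP; apply: (@measurableT_comp _ _ _ _ _ _ (fun t : \bar R => (t `^ q)%E)).
  exact: measurable_poweR.
exact: measurable_avg.
Qed.

Variables (v : V -> R) (vP : good_weight v).
Local Notation wm := (wm vP).

Let v0 x : (0 <= (v x)%:E)%E. Proof. by rewrite lee_fin ltW// (gw_gt0 vP). Qed.
Let mv : measurable_fun setT (fun x => (v x)%:E).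
Proof. by apply/measurable_EFinP; exact: (gw_measurable vP). Qed.

Let wm_fin c l : wm (cube c l) = (fine (wm (cube c l)))%:E.
Proof. by rewrite fineK// ge0_fin_numE// (gw_fin vP). Qed.

Lemma avg_powR_integral (q : R) : 0 < q -> exists C : R, forall b c l,
  mean_metric b -> 0 < l -> adm c ->
  (\int[mu]_(x in cube c l) (avg b c l x `^ q * (v x)%:E) <=
    C%:E * wm (cube c l))%E.
Proof.
move=> q0; have [beta [b0 b1 hb]] := wm_half vP.
have [C hC] := nneseries_powR_le q0 b0 b1.
pose L : R := 2 ^+ N.+1.
have L0 : 0 < L by rewrite exprn_gt0.
exists (L `^ q * C) => b c l bP l0 ac.
have mQ := measurable_cube c l.
rewrite wm_fin -EFinM.
(* [S 0] has to be the whole cube, because [avg] may vanish. *)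
pose S k := cube c l `&` [set x | k = 0%N \/ ((k%:R * L)%:E < avg b c l x)%E].
pose psi k := (k.+1%:R * L) `^ q.
have mS k : measurable (S k).
  apply: measurableI => //; case: k => [|k].
    by rewrite (_ : mkset _ = setT)//; apply/seteqP; split => // x _; left.
  rewrite (_ : mkset _ = [set x | ((k.+1%:R * L)%:E < avg b c l x)%E]).
    rewrite -[X in measurable X]setTI; apply: emeasurable_fun_o_infty => //.
    exact: measurable_avg.
  by apply/seteqP; split => x /=; [case|right].
apply: (@layer_integral _ _ v vP _ S _ psi beta) => //.
- by apply: measurable_funTS; exact: measurable_avg_powR.
- by move=> x _; exact: poweR_ge0.
- by move=> k; exact: powR_ge0.
- move=> x Qx.
  have fa : avg b c l x \is a fin_num by rewrite ge0_fin_numE ?avg_lty// avg_ge0.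
  set a := fine (avg b c l x); have aE : avg b c l x = a%:E by rewrite fineK.
  have a0 : 0 <= a by rewrite fine_ge0// avg_ge0.
  have ex : exists k : nat, a <= k.+1%:R * L.
    exists (Num.truncn (a / L)); rewrite -ler_pdivrMr//.
    exact/ltW/truncnS_gt.
  exists (ex_minn ex).
    split => //=; rewrite aE lte_fin; case: ex_minnP => -[|k]; first by left.
    move=> _ mk; right; rewrite ltNge; apply/negP => /mk.
    by rewrite ltnn.
  rewrite aE poweR_EFin lee_fin /psi; case: ex_minnP => k hk _.
  by apply: ge0_ler_powR; rewrite ?nnegrE ?(ltW q0) ?a0// mulr_ge0// ltW.
- case=> [|k].
    rewrite expr0 mul1r -wm_fin; apply: le_measure; rewrite ?inE//.
    by move=> x [].
  rewrite EFinM -wm_fin.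
  apply: le_trans (@john_nirenberg _ _ b bP wm beta b0 _ (@wm_null _ _ v vP) k.+1 c l l0 ac).
    apply: le_measure; rewrite ?inE//.
      apply: measurableI => //; rewrite -[X in measurable X]setTI.
      by apply: emeasurable_fun_o_infty => //; exact: measurable_avg.
    by move=> x [Qx [//|h]].
  by move=> c' l' A' ? ?; exact: hb.
- rewrite (eq_eseriesr (g := fun k => ((L `^ q)%:E * (k.+1%:R `^ q * beta ^+ k)%:E)%E)).
    rewrite nneseriesZl; last first.
      by move=> k _; rewrite lee_fin mulr_ge0 ?powR_ge0// exprn_ge0.
    by rewrite EFinM; apply: lee_wpmul2l => //; rewrite lee_fin powR_ge0.
  move=> k _; rewrite -EFinM; congr EFin.
  by rewrite /psi powRM ?(ltW L0)// mulrA (mulrC (L `^ q)).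
Qed.

Lemma boundary_integral : exists2 d : R, 0 < d & exists C : R, forall c l,
  0 < l -> (\int[mu]_(x in cube c l) ((depth c l x `^ (- d))%:E * (v x)%:E) <=
    C%:E * wm (cube c l))%E.
Proof.
have [beta [b0 b1 hb]] := wm_half vP.
have [e e0 he] := exp_growth b0 b1.
have ln20 : 0 < ln 2 :> R by rewrite ln_gt0// ltr1n.
(* With d = e / ln 2 one has 2^d = exp e, so that depth^(-d) is at most (exp e)^(k+1) where the
   depth exceeds 2^-(k+1). *)
exists (e / ln 2); first by rewrite divr_gt0.
exists (expR e / (1 - expR e * beta)) => c l l0.
have mQ := measurable_cube c l.
rewrite wm_fin -EFinM.
pose S k := [set x : V | x ord0 ord_max <= c ord0 ord_max + l / 2 ^+ k] `&` cube c l.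
apply: (@layer_integral _ _ v vP _ S _ (fun k => expR e ^+ k.+1) beta) => //.
- by apply: measurable_funTS; apply/measurable_EFinP; exact: measurable_depth.
- by move=> x _; rewrite lee_fin powR_ge0.
- by move=> k; apply: measurableI => //; exact: measurable_le_coord.
- move=> x Qx; have t0 := depth_gt0 l0 Qx; have t1 := depth_le1 l0 Qx.
  have ex : exists k : nat, 2 ^- k.+1 < depth c l x.
    exists (Num.truncn (depth c l x)^-1).
    rewrite invf_plt ?posrE ?exprn_gt0//.
    apply: (lt_le_trans (truncnS_gt _)).
    by rewrite -natrX ler_nat ltnW// ltn_expl.
  exists (ex_minn ex).
    split => //=; rewrite -lerBlDl -ler_pdivrMl// mulrC.
    rewrite -/(depth c l x); case: ex_minnP => -[|k]; first by rewrite expr0 invr1.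
    by move=> _ mk; rewrite leNgt; apply/negP => /mk; rewrite ltnn.
  case: ex_minnP => k hk _; rewrite lee_fin -expRM_natl /powR gt_eqF//.
  rewrite ler_expR mulNr -mulrN.
  rewrite -mulrA [leRHS]mulrC ler_pM2l//.
  rewrite ler_pdivrMl// lerNl.
  have -> : - (ln 2 * k.+1%:R) = ln (2 ^- k.+1) :> R.
    by rewrite lnV ?posrE ?exprn_gt0// lnXn// mulr_natr.
  by rewrite ler_ln ?posrE ?invr_gt0 ?exprn_gt0// ltW.
- move=> k; rewrite EFinM -wm_fin; apply: boundary_layer => //.
- rewrite (eq_eseriesr (g := fun k => (expR e * (expR e * beta) ^+ k)%:E)).
    by apply: nneseries_geometric_le => //; rewrite ?mulr_ge0 ?expR_ge0.
  by move=> k _; rewrite exprS exprMn mulrA.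
Qed.

(** The two factors are separated pointwise: for h >= 1 one has (1 + A) h <= A^2 + 2 h^2. Hence the
    boundary exponent is halved and the power of the mean is doubled. *)
Lemma weight_integral : exists2 d : R, 0 < d & forall q : R, 0 < q ->
  exists2 C : R, 0 < C & forall b c l, mean_metric b -> 0 < l -> adm c ->
  (\int[mu]_(x in cube c l)
     ((1 + avg b c l x `^ q) * (depth c l x `^ (- d))%:E * (v x)%:E) <=
    C%:E * wm (cube c l))%E.
Proof.
have [d d0 [C1 h1]] := boundary_integral.
exists (d / 2); first by rewrite divr_gt0.
move=> q q0; have [|C2 h2] := @avg_powR_integral (q * 2); first by rewrite mulr_gt0.
exists (`|C2 + 2 * C1| + 1); first by rewrite ltr_wpDl.
move=> b c l bP l0 ac.
have ma : measurable_fun (cube c l) (fun x => avg b c l x `^ (q * 2))%E.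
  by apply: measurable_funTS; exact: measurable_avg_powR.
have md r : measurable_fun (cube c l) (fun x => (depth c l x `^ r)%:E).
  by apply: measurable_funTS; apply/measurable_EFinP; exact: measurable_depth.
have mv' : measurable_fun (cube c l) (fun x => (v x)%:E) by exact: (measurable_funTS mv).
apply: (@le_trans _ _ (\int[mu]_(x in cube c l)
  (avg b c l x `^ (q * 2) * (v x)%:E +
   2%:E * ((depth c l x `^ (- d))%:E * (v x)%:E)))%E).
  apply: ge0_le_integral => //.
  - move=> x _; rewrite !mule_ge0// ?lee_fin ?powR_ge0// adde_ge0// ?poweR_ge0//.
  - apply: emeasurable_funM => //; apply: emeasurable_funM => //.
    by apply: emeasurable_funD => //; apply: measurable_funTS; exact: measurable_avg_powR.
  - apply: emeasurable_funD; first exact: emeasurable_funM.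
    by apply: measurable_funeM; exact: emeasurable_funM.
  move=> x Qx.
  have fa : avg b c l x \is a fin_num by rewrite ge0_fin_numE ?avg_lty// avg_ge0.
  set a := fine (avg b c l x); have aE : avg b c l x = a%:E by rewrite fineK.
  have a0 : 0 <= a by rewrite fine_ge0// avg_ge0.
  rewrite aE !poweR_EFin -EFinD -!EFinM -EFinD lee_fin mulrA -mulrDl.
  rewrite ler_wpM2r// ?(ltW (gw_gt0 vP _))//.
  have t0 := depth_gt0 l0 Qx; have t1 := depth_le1 l0 Qx.
  have -> : - d = - (d / 2) * 2 by rewrite mulNr divfK.
  rewrite !powRrM !powR_mulrn ?powR_ge0//.
  have h3 : 1 <= depth c l x `^ (- (d / 2)).
    rewrite powRN invf_ge1 ?powR_gt0//.
    have h : depth c l x `^ (d / 2) <= 1 `^ (d / 2).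
      by apply: ge0_ler_powR; rewrite ?nnegrE ?(ltW t0)// divr_ge0// ltW.
    by rewrite powR1 in h.
  move: h3 (powR_ge0 a q); set A := a `^ q; set h := _ `^ _ => h3 A0.
  nra.
rewrite ge0_integralD//; last 4 first.
- by move=> x _; rewrite mule_ge0// poweR_ge0.
- exact: emeasurable_funM.
- by move=> x _; rewrite !mule_ge0// lee_fin powR_ge0.
- by apply: measurable_funeM; exact: emeasurable_funM.
rewrite ge0_integralZl//; last 2 first.
- exact: emeasurable_funM.
- by move=> x _; rewrite !mule_ge0// lee_fin powR_ge0.
apply: (le_trans (leeD (h2 _ _ _ bP l0 ac) (lee_wpmul2l _ (h1 _ _ l0)))) => //.
rewrite wm_fin -!EFinM -EFinD lee_fin mulrA -mulrDl ler_wpM2r ?fine_ge0//.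
by rewrite (le_trans (ler_norm _))// lerDl.
Qed.

(** The mean over the cube is an intermediate point: b(x, z) is at most the sum of the means seen
    from x and from z. The bound then splits into a factor in x, which may lie outside the cube, and
    the integral of [weight_integral]. *)
Lemma metric_weight_integral : exists2 d : R, 0 < d & forall q : R, 0 < q ->
  exists2 C : R, 0 < C & forall b c l x, mean_metric b -> 0 < l -> adm c ->
  (\int[mu]_(z in cube c l)
     (b x z `^ q * depth c l z `^ (- d) * v z)%:E <=
    C%:E * (1 + avg b c l x `^ q) * wm (cube c l))%E.
Proof.
have [d d0 H] := weight_integral; exists d => // q q0.
have [C C0 hC] := H _ q0.
exists (2 `^ q * C); first by rewrite mulr_gt0// powR_gt0.
move=> b c l x bP l0 ac.
have fa y : avg b c l y = (fine (avg b c l y))%:E.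
  by rewrite fineK// ge0_fin_numE ?avg_lty// avg_ge0.
have md r : measurable_fun (cube c l) (fun x => (depth c l x `^ r)%:E).
  by apply: measurable_funTS; apply/measurable_EFinP; exact: measurable_depth.
have mv' : measurable_fun (cube c l) (fun x => (v x)%:E) by exact: (measurable_funTS mv).
have mF : measurable_fun (cube c l) (fun z =>
     ((1 + avg b c l z `^ q) * (depth c l z `^ (- d))%:E * (v z)%:E))%E.
  apply: emeasurable_funM => //; apply: emeasurable_funM => //.
  by apply: emeasurable_funD => //; apply: measurable_funTS; exact: measurable_avg_powR.
have F0 z : cube c l z ->
    (0 <= (1 + avg b c l z `^ q) * (depth c l z `^ (- d))%:E * (v z)%:E)%E.
  by move=> _; rewrite !mule_ge0// ?lee_fin ?powR_ge0// adde_ge0// poweR_ge0.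
apply: (@le_trans _ _ (\int[mu]_(z in cube c l)
  ((2 `^ q)%:E * (1 + avg b c l x `^ q) *
   ((1 + avg b c l z `^ q) * (depth c l z `^ (- d))%:E * (v z)%:E)))%E).
  apply: ge0_le_integral => //.
  - by move=> z _; rewrite lee_fin !mulr_ge0 ?powR_ge0// ltW// (gw_gt0 vP).
  - apply: measurable_funTS; apply/measurable_EFinP; apply: measurable_funM (gw_measurable vP).
    apply: measurable_funM; last exact: measurable_depth.
    apply: (@measurableT_comp _ _ _ _ _ _ (fun t : R => t `^ q)).
      exact: measurable_powR.
    exact: (measurable_mm1 bP).
  - by apply: measurable_funeM.
  move=> z Qz; have := le_avg_add bP c x z l0.
  rewrite (fa x) (fa z) !poweR_EFin -!EFinD -!EFinM !lee_fin.
  have ax : 0 <= fine (avg b c l x) by rewrite fine_ge0// avg_ge0.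
  have az : 0 <= fine (avg b c l z) by rewrite fine_ge0// avg_ge0.
  move: ax az; set ax := fine _; set az := fine _ => ax0 az0 hb.
  rewrite !mulrA ler_wpM2r ?(ltW (gw_gt0 vP _))// ler_wpM2r ?powR_ge0//.
  have h4 : b x z `^ q <= 2 `^ q * Num.max ax az `^ q.
    rewrite -powRM// ?le_max ?ax0//; apply: ge0_ler_powR; rewrite ?nnegrE ?(ltW q0)//.
    - exact: (mm_ge0 bP).
    - by rewrite mulr_ge0// le_max ax0.
    apply: (le_trans hb); rewrite mulr_natl mulr2n lerD// le_max lexx ?orbT//.
  apply: (le_trans h4); rewrite -mulrA ler_wpM2l ?powR_ge0//.
  move: (powR_ge0 ax q) (powR_ge0 az q).
  have hp (t t' : R) : 0 <= t -> 0 <= t' -> t' <= (1 + t) * (1 + t').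
    move=> t0 t'0; rewrite mulrDl mul1r (addrC 1 t') -addrA lerDl.
    by rewrite addr_ge0// mulr_ge0// addr_ge0.
  by case: (leP ax az) => _ hx hz; [|rewrite mulrC]; exact: hp.
rewrite ge0_integralZl//; last first.
  by rewrite mule_ge0// ?lee_fin ?powR_ge0// adde_ge0// poweR_ge0.
rewrite EFinM -!muleA; apply: lee_wpmul2l; first by rewrite lee_fin powR_ge0.
rewrite muleCA; apply: lee_wpmul2l; first by rewrite adde_ge0// poweR_ge0.
exact: hC.
Qed.

End weight_integrals.

(** * Weights of class A_p *)

Section hoelder_weighted.
Context {R : realType} d (T : measurableType d) (mu : {measure set T -> \bar R}).
Variables (p : R) (p1 : 1 < p) (w : T -> R).
Hypotheses (mw : measurable_fun setT w) (w0 : forall x, 0 < w x).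

Definition dual_weight (x : T) : R := w x `^ (- (p - 1)^-1).

Lemma measurable_dual_weight : measurable_fun setT dual_weight.
Proof.
apply: (@measurableT_comp _ _ _ _ _ _ (fun t : R => t `^ (- (p - 1)^-1))).
  exact: measurable_powR.
exact: mw.
Qed.

Lemma dual_weight_gt0 x : 0 < dual_weight x.
Proof. exact: powR_gt0. Qed.

(** Hoelder's inequality for F w^(1/p) and G w^(-1/p). It is stated for p-th powers, so that the
    integral of F^p w occurs without a root and can be integrated again. *)
Lemma hoelder_weighted D (F G : T -> R) : measurable D ->
  measurable_fun D F -> measurable_fun D G ->
  (forall x, D x -> 0 <= F x) -> (forall x, D x -> 0 <= G x) ->
  ((\int[mu]_(x in D) (G x * F x)%:E) `^ p <=
   (\int[mu]_(x in D) (G x `^ (p / (p - 1)) * dual_weight x)%:E) `^ (p - 1) *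
   \int[mu]_(x in D) (F x `^ p * w x)%:E)%E.
Proof.
move=> mD mF mG F0 G0.
have p0 : 0 < p by rewrite (lt_trans ltr01).
have p10 : 0 < p - 1 by rewrite subr_gt0.
set q := p / (p - 1); have q0 : 0 < q by rewrite divr_gt0.
have mpow r : measurable_fun setT (fun t : R => t `^ r) by exact: measurable_powR.
have mwr r : measurable_fun D (fun x => w x `^ r).
  by apply: measurable_funTS; apply: (@measurableT_comp _ _ _ _ _ _ (fun t : R => t `^ r)).
pose f := (fun x => F x * w x `^ p^-1) \_ D.
pose g := (fun x => G x * w x `^ (- p^-1)) \_ D.
have mf : measurable_fun setT f.
  by apply: (measurable_restrictT _ mD).1; exact: measurable_funM.
have mg : measurable_fun setT g.
  by apply: (measurable_restrictT _ mD).1; exact: measurable_funM.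
have pq : p^-1 + q^-1 = 1.
  by rewrite /q invf_div -[X in X + _]mul1r -mulrDl addrC subrK divff// gt_eqF.
have H := hoelder mu mf mg p0 q0 pq.
have E1 : ('N[mu]_1[EFin \o (f \* g)%R] = \int[mu]_(x in D) (G x * F x)%:E)%E.
  rewrite Lnorm1 [RHS]integral_mkcond; apply: eq_integral => x _ /=.
  rewrite /f /g !patchE; case: ifPn => [/set_mem Dx|_]; last by rewrite mul0r normr0.
  rewrite mulrACA -powRD; last by rewrite (gt_eqF (w0 x)) implybT.
  by rewrite subrr powRr0 mulr1 mulrC ger0_norm// mulr_ge0// ?F0 ?G0.
have E2 : ('N[mu]_p%:E[EFin \o f] `^ p = \int[mu]_(x in D) (F x `^ p * w x)%:E)%E.
  rewrite poweR_Lnorm ?gt_eqF// [RHS]integral_mkcond; apply: eq_integral => x _ /=.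
  rewrite /f !patchE; case: ifPn => [/set_mem Dx|_]; last first.
    by rewrite normr0 powR0 ?gt_eqF.
  rewrite ger0_norm ?mulr_ge0 ?F0 ?powR_ge0// powRM ?F0 ?powR_ge0//.
  by rewrite -powRrM mulVf ?gt_eqF// powRr1// ltW.
have E3 : ('N[mu]_q%:E[EFin \o g] `^ q =
    \int[mu]_(x in D) (G x `^ q * dual_weight x)%:E)%E.
  rewrite poweR_Lnorm ?gt_eqF// [RHS]integral_mkcond; apply: eq_integral => x _ /=.
  rewrite /g !patchE; case: ifPn => [/set_mem Dx|_]; last first.
    by rewrite normr0 powR0 ?gt_eqF.
  rewrite ger0_norm ?mulr_ge0 ?G0 ?powR_ge0// powRM ?G0 ?powR_ge0//.
  by rewrite -powRrM mulNr mulrA mulVf ?gt_eqF// mul1r.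
rewrite E1 in H.
have qp : q * (p - 1) = p by rewrite /q divfK// gt_eqF.
rewrite -E3 -poweRrM qp -E2 muleC -poweRM ?Lnorm_ge0//.
apply: gt0_ler_poweR; rewrite ?in_itv/= ?(ltW p0) ?leey ?andbT//.
- by apply: integral_ge0 => x Dx; rewrite lee_fin mulr_ge0// ?G0 ?F0.
- by rewrite mule_ge0// Lnorm_ge0.
Qed.

End hoelder_weighted.

Section Ap_cubes.
Context {R : realType} (n : nat).
Local Notation N := n.+1.
Local Notation V := 'rV[R]_N.
Local Notation mu := (lebesgue_rV N : {measure set V -> \bar R}).
Implicit Types (c x y z : V) (l : R) (A E U : set V) (b : V -> V -> R).

(** The working form of the A_p condition: a Borel, everywhere positive weight, and cubes instead of
    balls. [Ap_weight_exists] provides it. *)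
Record Ap_weight (p : R) (w : V -> R) : Prop := ApWeight {
  Ap_measurable : measurable_fun setT w ;
  Ap_gt0 : forall x, 0 < w x ;
  Ap_fin : forall c l, (wmeasure w (cube c l) < +oo)%E ;
  Ap_dual_fin : forall c l, (wmeasure (dual_weight p w) (cube c l) < +oo)%E ;
  Ap_cube : exists2 K : R, 0 < K & forall c l, 0 < l ->
   (wmeasure w (cube c l) * wmeasure (dual_weight p w) (cube c l) `^ (p - 1) <=
    (K * (l ^+ N) `^ p)%:E)%E }.

Variables (p : R) (p1 : 1 < p) (w : V -> R) (wP : Ap_weight p w).
Local Notation s := (dual_weight p w).
Let p10 : 0 < p - 1. Proof. by rewrite subr_gt0. Qed.
Let p0 : 0 < p. Proof. by rewrite (lt_trans ltr01). Qed.

Let mw := Ap_measurable wP.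
Let w0 := Ap_gt0 wP.
Let ms := measurable_dual_weight p mw.
Let s0 := dual_weight_gt0 p w0.

Lemma wmeasure_ge0 (v : V -> R) E : (forall x, 0 < v x) -> (0 <= wmeasure v E)%E.
Proof. by move=> v0; apply: integral_ge0 => x _; rewrite lee_fin ltW. Qed.

Lemma wmeasure_le (v : V -> R) A E : measurable_fun setT v -> (forall x, 0 < v x) ->
  measurable A -> measurable E -> A `<=` E -> (wmeasure v A <= wmeasure v E)%E.
Proof.
move=> mv v0 mA mE AE; apply: ge0_subset_integral => //.
  by apply: measurable_funTS; exact/measurable_EFinP.
by move=> x _; rewrite lee_fin ltW.
Qed.

Lemma mu_powR_le E : measurable E ->
  (mu E `^ p <= wmeasure s E `^ (p - 1) * wmeasure w E)%E.
Proof.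
move=> mE.
have := @hoelder_weighted R _ _ mu p p1 w mw w0 E (fun=> 1) (fun=> 1) mE
  (measurable_cst _) (measurable_cst _) (fun _ _ => ler01) (fun _ _ => ler01).
under eq_integral do rewrite mul1r.
under [X in (_ <= X `^ _ * _)%E -> _]eq_integral do rewrite powR1 mul1r.
under [X in (_ <= _ * X)%E -> _]eq_integral do rewrite powR1 mul1r.
by rewrite integral_cst// mul1e.
Qed.

Let fin_num_cube c l : wmeasure w (cube c l) \is a fin_num /\
  wmeasure s (cube c l) \is a fin_num.
Proof.
by split; rewrite ge0_fin_numE ?wmeasure_ge0//; [exact: (Ap_fin wP)|exact: (Ap_dual_fin wP)].
Qed.

(** All four masses are finite, so the comparison of the A_p bound on the cube with the lower bound
    of Hoelder's inequality on E becomes real arithmetic in the two lemmas below. *)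
Lemma Ap_real_bounds : exists2 K : R, 0 < K & forall t c l E, 0 < t -> 0 < l ->
  measurable E -> E `<=` cube c l -> (t%:E * mu (cube c l) <= mu E)%E ->
  exists a A e F : R, [/\ wmeasure w (cube c l) = A%:E, wmeasure w E = a%:E,
    wmeasure s (cube c l) = F%:E, wmeasure s E = e%:E &
    [/\ 0 <= a <= A, 0 <= e <= F, A * F `^ (p - 1) <= K * (l ^+ N) `^ p &
      t `^ p * (l ^+ N) `^ p <= e `^ (p - 1) * a]].
Proof.
have [K K0 hK] := Ap_cube wP; exists K => // t c l E t0 l0 mE EQ tE.
have [fA fF] := fin_num_cube c l.
have mQ := measurable_cube c l.
have wE : (wmeasure w E <= wmeasure w (cube c l))%E by exact: wmeasure_le.
have sE : (wmeasure s E <= wmeasure s (cube c l))%E by exact: wmeasure_le.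
have fa : wmeasure w E \is a fin_num.
  by rewrite ge0_fin_numE ?wmeasure_ge0//; apply: le_lt_trans wE _; exact: (Ap_fin wP).
have fe : wmeasure s E \is a fin_num.
  by rewrite ge0_fin_numE ?wmeasure_ge0//; apply: le_lt_trans sE _; exact: (Ap_dual_fin wP).
exists (fine (wmeasure w E)), (fine (wmeasure w (cube c l))),
  (fine (wmeasure s E)), (fine (wmeasure s (cube c l))).
split; rewrite ?fineK//; split.
- by rewrite -!lee_fin !fineK// wmeasure_ge0.
- by rewrite -!lee_fin !fineK// wmeasure_ge0.
- by rewrite -lee_fin EFinM -poweR_EFin !fineK// hK.
- rewrite -lee_fin [leRHS]EFinM -poweR_EFin !fineK//.
  apply: le_trans (mu_powR_le mE).
  rewrite -powRM ?(ltW t0) ?exprn_ge0 ?(ltW l0)// -poweR_EFin.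
  have l0' := ltW l0.
  apply: gt0_ler_poweR; rewrite ?in_itv/= ?leey ?andbT ?measure_ge0 ?(ltW p0)//.
    by rewrite lee_fin mulr_ge0 ?exprn_ge0// ltW.
  by rewrite EFinM -(mu_cube c l0').
Qed.

(** Multiply (t |Q|)^p <= s(E)^(p-1) w(E) by w(Q), bound s(E) by s(Q), and use w(Q) s(Q)^(p-1) <= K
    |Q|^p. Cancelling |Q|^p leaves the constant K / t^p. *)
Lemma Ap_good_weight : good_weight w.
Proof.
split; [exact: mw|exact: w0|exact: (Ap_fin wP)|].
have [K K0 hK] := Ap_real_bounds.
move=> t t0; exists (K / t `^ p); first by rewrite divr_gt0// powR_gt0.
move=> c l E l0 mE EQ tE.
have [a [A [e [F [-> -> _ _ [/andP[a0 aA] /andP[e0 eF] h1 h2]]]]]] :=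
  hK t c l E t0 l0 mE EQ tE.
rewrite -EFinM lee_fin mulrAC ler_pdivlMr ?powR_gt0//.
have T0 : 0 < t `^ p by rewrite powR_gt0.
have L0 : 0 < (l ^+ N) `^ p by rewrite powR_gt0// exprn_gt0.
have ef : e `^ (p - 1) <= F `^ (p - 1).
  by apply: ge0_ler_powR; rewrite ?nnegrE ?(ltW p10)// (le_trans e0).
have f0 : 0 <= F `^ (p - 1) by exact: powR_ge0.
have A0 : 0 <= A by exact: le_trans aA.
rewrite -(ler_pM2r L0) -mulrA.
apply: (@le_trans _ _ (A * (F `^ (p - 1) * a))).
  by apply: ler_wpM2l => //; apply: (le_trans h2); exact: ler_wpM2r.
by rewrite mulrA [leRHS]mulrAC; exact: ler_wpM2r.
Qed.

(** The same computation with the roles exchanged: multiply by s(Q)^(p-1) and bound w(E) by w(Q),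
    then take the root of order p - 1. *)
Lemma Ap_good_dual : good_weight s.
Proof.
split; [exact: ms|exact: s0|exact: (Ap_dual_fin wP)|].
have [K K0 hK] := Ap_real_bounds.
move=> t t0; exists ((K / t `^ p) `^ (p - 1)^-1).
  by rewrite powR_gt0// divr_gt0// powR_gt0.
move=> c l E l0 mE EQ tE.
have [a [A [e [F [_ _ -> -> [/andP[a0 aA] /andP[e0 eF] h1 h2]]]]]] :=
  hK t c l E t0 l0 mE EQ tE.
have T0 : 0 < t `^ p by rewrite powR_gt0.
have L0 : 0 < (l ^+ N) `^ p by rewrite powR_gt0// exprn_gt0.
have F0 : 0 <= F by exact: le_trans eF.
have powK (x : R) : 0 <= x -> x = (x `^ (p - 1)) `^ (p - 1)^-1.
  by move=> x0; rewrite -powRrM divff ?gt_eqF// powRr1.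
rewrite -EFinM lee_fin [leLHS]powK// [X in _ <= _ * X]powK//.
rewrite -powRM ?powR_ge0//; last by rewrite divr_ge0// ltW.
apply: ge0_ler_powR; rewrite ?nnegrE ?invr_ge0 ?(ltW p10) ?powR_ge0//.
  by rewrite mulr_ge0 ?powR_ge0// divr_ge0// ltW.
rewrite mulrAC ler_pdivlMr// -(ler_pM2r L0) -mulrA.
apply: (@le_trans _ _ (F `^ (p - 1) * (e `^ (p - 1) * A))).
  apply: ler_wpM2l; first exact: powR_ge0.
  by apply: (le_trans h2); apply: ler_wpM2l => //; exact: powR_ge0.
rewrite mulrCA (mulrC _ A) (mulrC K) -mulrA; apply: ler_wpM2l => //.
exact: powR_ge0.
Qed.

End Ap_cubes.

Section series_tools.
Context {R : realType}.

(** Each c_j is at most the l^p norm of the sequence c, so the sum of the a_j is at most B times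
    that norm. *)
Lemma nneseries_powR_sup (p B : R) (t : nat -> R) (a c : nat -> \bar R) :
  0 < p -> 0 < B -> (forall j, 0 <= t j) -> (forall j, 0 <= a j)%E ->
  (forall j, 0 <= c j)%E -> (forall j, a j <= (t j)%:E * c j)%E ->
  (\sum_(0 <= j <oo) (t j)%:E <= B%:E)%E ->
  ((\sum_(0 <= j <oo) a j) `^ p <=
    (B `^ p)%:E * \sum_(0 <= j <oo) (c j `^ p))%E.
Proof.
move=> p0 B0 t0 a0 c0 atc tB.
set S := (\sum_(0 <= j <oo) (c j `^ p))%E.
have S0 : (0 <= S)%E by apply: nneseries_ge0 => j _ _; exact: poweR_ge0.
have cS j : (c j <= S `^ p^-1)%E.
  have -> : c j = ((c j `^ p) `^ p^-1)%E.
    by rewrite -poweRrM divff ?gt_eqF// poweRe1.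
  apply: gt0_ler_poweR; rewrite ?in_itv/= ?leey ?andbT ?poweR_ge0// ?invr_ge0 ?(ltW p0)//.
  apply: le_trans (nneseries_lim_ge j.+1 _); last by move=> *; exact: poweR_ge0.
  by rewrite big_nat_recr//= leeDr// sume_ge0// => i _; exact: poweR_ge0.
case: (eqVneq S +oo%E) => [->|Soo].
  by rewrite gt0_muley ?leey// lte_fin powR_gt0.
have fS : S \is a fin_num by rewrite ge0_fin_numE// lt_neqAle Soo leey.
have fS' : (S `^ p^-1)%E \is a fin_num by exact: fin_num_poweR.
set m := fine (S `^ p^-1)%E; have mE : (S `^ p^-1)%E = m%:E by rewrite fineK.
have m0 : 0 <= m by rewrite fine_ge0// poweR_ge0.
have h : (\sum_(0 <= j <oo) a j <= (B * m)%:E)%E.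
  apply: (@le_trans _ _ (\sum_(0 <= j <oo) (m%:E * (t j)%:E))%E).
    apply: lee_nneseries => // j _; apply: (le_trans (atc j)).
    by rewrite muleC -mE; apply: lee_wpmul2r => //; rewrite lee_fin.
  rewrite nneseriesZl; last by move=> j _; rewrite lee_fin.
  by rewrite mulrC EFinM; apply: lee_wpmul2l.
apply: (@le_trans _ _ (((B * m)%:E) `^ p)%E).
  apply: gt0_ler_poweR; rewrite ?in_itv/= ?leey ?andbT ?(ltW p0)//.
  - by apply: nneseries_ge0 => j _ _; exact: a0.
  - by rewrite lee_fin mulr_ge0// ltW.
rewrite poweR_EFin powRM ?(ltW B0)// EFinM -(poweR_EFin m) -mE -poweRrM.
by rewrite mulVf ?gt_eqF// poweRe1.
Qed.

Lemma nneseries_dyadic_le (e : R) : 0 < e -> exists2 B : R, 0 < B &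
  forall t : R, 0 < t -> (\sum_(0 <= j <oo)
    (if t * 2 ^+ j < 1 then (t * 2 ^+ j) `^ e else 0)%:E <= B%:E)%E.
Proof.
move=> e0.
have h2 : 1 < 2 `^ e :> R.
  have h : 1 `^ e < 2 `^ e :> R by rewrite gt0_ltr_powR// ?nnegrE// ltr1n.
  by rewrite powR1 in h.
pose A : R := (2 `^ e - 1)^-1; have A0 : 0 < A by rewrite invr_gt0 subr_gt0.
have hA : 1 + A = A * 2 `^ e.
  by rewrite /A; field; rewrite gt_eqF// subr_gt0.
exists (1 + A); first by rewrite addr_gt0.
(* The strengthened bound reproduces itself when t is doubled: by [hA], t^e + (1 + A - A (2t)^e) = 1
   + A - A t^e. *)
suff H (m : nat) (t : R) : 0 < t ->
    \sum_(0 <= j < m) (if t * 2 ^+ j < 1 then (t * 2 ^+ j) `^ e else 0) <=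
    if t < 1 then 1 + A - A * t `^ e else 0.
  move=> t t0; apply: lime_le.
    apply: is_cvg_nneseries => k _ _; rewrite lee_fin.
    by case: ifP => // _; exact: powR_ge0.
  near=> m; rewrite sumEFin lee_fin; apply: (le_trans (H m t t0)).
  case: ifP => _; first by rewrite gerBl mulr_ge0 ?powR_ge0// ltW.
  by rewrite addr_ge0// ltW.
elim: m t => [|m IH] t t0.
  rewrite big_geq//; case: ifPn => // t1.
  have : t `^ e <= 1 `^ e by apply: ge0_ler_powR; rewrite ?nnegrE ?(ltW e0) ?(ltW t0) ?(ltW t1).
  by rewrite powR1; nra.
rewrite big_nat_recl// expr0 mulr1.
under eq_bigr do rewrite exprS mulrA.
have t20 : 0 < t * 2 by rewrite mulr_gt0.
move: (IH _ t20); set S := \sum_(0 <= i < m) _ => hS.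
case: (ltP t 1) => t1.
  have t1' : t `^ e <= 1 `^ e by apply: ge0_ler_powR; rewrite ?nnegrE ?(ltW e0) ?(ltW t0) ?(ltW t1).
  rewrite powR1 in t1'.
  move: hS; case: ifP => _ hS; last by nra.
  rewrite powRM ?(ltW t0)// in hS.
  have := powR_ge0 t e; nra.
move: hS; rewrite ltNge (le_trans t1)/= ?add0r//.
by rewrite ler_peMr ?(ltW t0)// ler1n.
Unshelve. all: by end_near. Qed.

End series_tools.

Section dual_bound.
Context {R : realType} (n : nat).
Local Notation N := n.+1.
Local Notation V := 'rV[R]_N.
Local Notation mu := (lebesgue_rV N : {measure set V -> \bar R}).
Implicit Types (c x y z : V) (l : R) (A E U : set V) (b : V -> V -> R).
Variables (p : R) (p1 : 1 < p) (w : V -> R) (wP : Ap_weight p w).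
Local Notation s := (dual_weight p w).
Let p10 : 0 < p - 1. Proof. by rewrite subr_gt0. Qed.
Let p0 : 0 < p. Proof. by rewrite (lt_trans ltr01). Qed.

(** With q = p / (p - 1), the power p - 1 required by [hoelder_weighted] turns the q-th power of the
    mean into its p-th power, which [weight_integral] then handles against w. *)
Lemma dual_bound : exists2 d : R, 0 < d & exists2 C : R, 0 < C &
  forall b c l x, mean_metric b -> 0 < l -> adm c ->
  ((\int[mu]_(z in cube c l)
     (b x z `^ (p / (p - 1)) * depth c l z `^ (- d) * s z)%:E) `^ (p - 1) <=
    C%:E * (1 + avg b c l x `^ p) * wmeasure s (cube c l) `^ (p - 1))%E.
Proof.
have [d d0 H] := metric_weight_integral (Ap_good_dual p1 wP).
exists d => //; set q := p / (p - 1); have q0 : 0 < q by rewrite divr_gt0.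
have [C C0 hC] := H _ q0.
exists (C `^ (p - 1) * 2 `^ (p - 1)); first by rewrite mulr_gt0// powR_gt0.
move=> b c l x bP l0 ac.
have fa : avg b c l x = (fine (avg b c l x))%:E.
  by rewrite fineK// ge0_fin_numE ?avg_lty// avg_ge0.
set a := fine _ in fa; have a0 : 0 <= a by rewrite fine_ge0// avg_ge0.
have sQ0 : (0 <= wmeasure s (cube c l))%E.
  by apply: wmeasure_ge0 => z; exact: (dual_weight_gt0 p (Ap_gt0 wP)).
apply: (@le_trans _ _ ((C%:E * (1 + avg b c l x `^ q) * wmeasure s (cube c l)) `^ (p - 1))%E).
  apply: gt0_ler_poweR; rewrite ?in_itv/= ?leey ?andbT ?(ltW p10)//.
  - apply: integral_ge0 => z _.
    by rewrite lee_fin !mulr_ge0 ?powR_ge0// ltW// (dual_weight_gt0 p (Ap_gt0 wP)).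
  - by rewrite !mule_ge0 ?lee_fin ?(ltW C0)// adde_ge0// poweR_ge0.
  - exact: hC.
have A1 : (0 <= 1 + avg b c l x `^ q)%E by rewrite adde_ge0// poweR_ge0.
have C0' : (0 <= C%:E)%E by rewrite lee_fin ltW.
rewrite (poweRM _ (mule_ge0 C0' A1) sQ0) (poweRM _ C0' A1).
rewrite EFinM -!muleA poweR_EFin; apply: lee_wpmul2l; first by rewrite lee_fin powR_ge0.
rewrite !muleA; apply: lee_wpmul2r; first exact: poweR_ge0.
rewrite fa !poweR_EFin -?EFinD ?poweR_EFin -EFinM lee_fin.
have -> : a `^ p = (a `^ q) `^ (p - 1) by rewrite -powRrM /q divfK// gt_eqF.
have A0 := powR_ge0 a q; set A := a `^ q in A0 *.
have h : (1 + A) `^ (p - 1) <= (2 * Num.max 1 A) `^ (p - 1).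
  apply: ge0_ler_powR; rewrite ?nnegrE ?(ltW p10) ?addr_ge0//.
    by rewrite mulr_ge0// le_max ler01.
  by rewrite mulr_natl mulr2n lerD// le_max lexx ?orbT.
apply: (le_trans h); rewrite powRM ?le_max ?ler01// ler_wpM2l ?powR_ge0//.
have := powR_ge0 A (p - 1).
by case: (leP 1 A) => _ h3; rewrite ?powR1 ?lerDl ?lerDr.
Qed.

End dual_bound.

(** * The near part *)

Section near_part.
Context {R : realType} (n : nat).
Local Notation N := n.+1.
Local Notation V := 'rV[R]_N.
Local Notation mu := (lebesgue_rV N : {measure set V -> \bar R}).
Implicit Types (c x y z : V) (l r h : R) (A E U : set V) (b : V -> V -> R).

Local Notation "x `n" := ((x : V) ord0 ord_max) (at level 2, format "x `n").

(** One scale of the near part. Symmetry lets Tonelli's theorem exchange the two variables, and the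
    sup-norm distance keeps the sections inside cubes. *)
Definition rel h : set (V * V) := [set u |
  [/\ 0 < u.1 `n < h, 0 < u.2 `n < h &
      forall i, `|u.1 ord0 i - u.2 ord0 i| < h]].

Lemma measurable_rel h : measurable (rel h).
Proof.
have mlt (f : V * V -> R) a : measurable_fun setT f -> measurable [set u | f u < a].
  move=> mf; rewrite -[X in measurable X]setTI.
  rewrite (_ : mkset _ = f @^-1` `]-oo, a[%classic).
    by apply: mf => //; exact: measurable_itv.
  by apply/seteqP; split => u /=; rewrite in_itv.
have mgt (f : V * V -> R) a : measurable_fun setT f -> measurable [set u | a < f u].
  move=> mf; rewrite -[X in measurable X]setTI.
  rewrite (_ : mkset _ = f @^-1` `]a, +oo[%classic).
    by apply: mf => //; exact: measurable_itv.
  by apply/seteqP; split => u /=; rewrite in_itv/= andbT.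
have m1 i : measurable_fun setT (fun u : V * V => u.1 ord0 i).
  exact: (measurableT_comp (measurable_coord i) measurable_fst).
have m2 i : measurable_fun setT (fun u : V * V => u.2 ord0 i).
  exact: (measurableT_comp (measurable_coord i) measurable_snd).
rewrite (_ : rel h = ([set u | 0 < u.1 `n] `&` [set u | u.1 `n < h]) `&`
  ([set u | 0 < u.2 `n] `&` [set u | u.2 `n < h]) `&`
  \big[setI/setT]_(i < N) [set u : V * V | `|u.1 ord0 i - u.2 ord0 i| < h]).
  apply: measurableI; first by apply: measurableI; apply: measurableI;
    [exact: mgt|exact: mlt|exact: mgt|exact: mlt].
  apply: bigsetI_measurable => i _; apply: mlt.
  by apply: measurableT_comp => //; exact: measurable_funB.
rewrite -bigcap_seq; apply/seteqP; split => -[u1 u2].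
  move=> [/andP[h1 h2] /andP[h3 h4] h5]; split => //= i _; exact: h5.
move=> [[[h1 h2] [h3 h4]] h5]; split => /=; [exact/andP|exact/andP|].
by move=> i; apply: h5; rewrite /= mem_index_enum.
Qed.

Definition rsec h x : set V := [set y | rel h (x, y)].

Lemma measurable_rsec h x : measurable (rsec h x).
Proof.
rewrite -[X in measurable X]setTI.
exact: (pair1_measurable x measurableT (measurable_rel h)).
Qed.

Lemma rel_sym h x y : rel h (x, y) -> rel h (y, x).
Proof. by move=> [h1 h2 h3]; split => //= i; rewrite distrC; exact: h3. Qed.

Lemma integral_rsecE h (g : V * V -> R) x :
  (\int[mu]_(y in rsec h x) (g (x, y))%:E)%E =
  fubini_F (lebesgue_rV N) (fun u => (\1_(rel h) u * g u)%:E) x.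
Proof.
rewrite /fubini_F [LHS]integral_mkcond; apply: eq_integral => y _.
rewrite patchE indicE; have [yr|yr] := boolP (y \in rsec h x).
  by rewrite mem_set ?mul1r//; exact: set_mem yr.
rewrite memNset ?mul0r// => yr'; move: yr; rewrite mem_set//.
Qed.

Lemma measurable_integral_rsec h (g : V * V -> R) :
  measurable_fun setT g -> (forall u, 0 <= g u) ->
  measurable_fun setT (fun x => \int[mu]_(y in rsec h x) (g (x, y))%:E)%E.
Proof.
move=> mg g0; under eq_fun do rewrite integral_rsecE.
apply: measurable_fun_fubini_tonelli_F.
  apply/measurable_EFinP; apply: measurable_funM => //.
  by apply: measurable_indic; exact: measurable_rel.
by move=> u; rewrite lee_fin mulr_ge0.
Qed.

(* The cube containing all points that are two steps of rel h away from y. *)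
Definition base_corner h y : V :=
  \row_i if i == ord_max then 0 else y ord0 i - 2 * h.

Lemma adm_base h y : adm (base_corner h y).
Proof. by rewrite /adm mxE eqxx. Qed.

Lemma rel_base2 h y x z : rel h (x, y) -> rel h (x, z) ->
  cube (base_corner h y) (4 * h) z.
Proof.
move=> [/= /andP[x0 xh] /andP[y0 yh] hxy] [/= _ /andP[z0 zh] hxz] i.
rewrite mxE; case: (eqVneq i ord_max) => [->|_].
  by apply/andP; split; lra.
have := hxy i; have := hxz i; rewrite !ltr_norml => /andP[? ?] /andP[? ?].
by apply/andP; split; lra.
Qed.

Lemma rel_base1 h y x : rel h (x, y) -> cube (base_corner h y) (4 * h) x.
Proof.
move=> [/= /andP[x0 xh] /andP[y0 yh] hxy] i.
rewrite mxE; case: (eqVneq i ord_max) => [->|_].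
  by apply/andP; split; lra.
have := hxy i; rewrite !ltr_norml => /andP[? ?].
by apply/andP; split; lra.
Qed.

Lemma depth_base h y x : depth (base_corner h y) (4 * h) x = x `n / (4 * h).
Proof. by rewrite /depth mxE eqxx subr0. Qed.

Variables (p : R) (p1 : 1 < p) (w : V -> R) (wP : Ap_weight p w).
Local Notation s := (dual_weight p w).
Local Notation q := (p / (p - 1)).
Let p10 : 0 < p - 1. Proof. by rewrite subr_gt0. Qed.
Let p0 : 0 < p. Proof. by rewrite (lt_trans ltr01). Qed.
Let q0 : 0 < q. Proof. by rewrite divr_gt0. Qed.
Let s0 := dual_weight_gt0 p (Ap_gt0 wP).
Let w0 := Ap_gt0 wP.
Let mw := Ap_measurable wP.
Let ms := measurable_dual_weight p mw.

(** The dual factor that Hoelder's inequality leaves at scale h when the test function (y_n /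
    h)^(-e) is inserted. *)
Definition G b (e h : R) x : \bar R :=
  (\int[mu]_(y in rsec h x) ((b x y * (y `n / h) `^ (- e)) `^ q * s y)%:E)%E.

(** For x related to y, every z related to x lies in the cube of side 4h based at y. There
    [dual_bound] controls the inner factor, [weight_integral] the integral in x, and what remains is
    w(Q) s(Q)^(p-1) h^(-Np), which the A_p condition bounds independently of h and y. *)
Lemma near_schur : exists2 e : R, 0 < e & exists2 C : R, 0 < C &
  forall b h y, mean_metric b -> 0 < h ->
  (\int[mu]_(x in rsec h y)
     (((x `n / h) `^ (- (e * p)))%:E * ((h ^+ N) `^ (- p))%:E *
      G b e h x `^ (p - 1) * (w x)%:E) <= C%:E)%E.
Proof.
have [d1 d10 [C1 C10 h1]] := dual_bound p1 wP.
have [d2 d20 H2] := weight_integral (Ap_good_weight p1 wP).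
have [C2 C20 h2] := H2 p p0.
have [K K0 hK] := Ap_cube wP.
(* Raised to the powers q and p, the test function must not exceed the boundary powers allowed for
   the dual weight and for w. *)
pose e := Num.min (d1 / q) (d2 / p).
have e0 : 0 < e by rewrite lt_min !divr_gt0.
have ed1 : e * q <= d1 by rewrite -ler_pdivlMr// ge_min lexx.
have ed2 : e * p <= d2 by rewrite -ler_pdivlMr// ge_min lexx orbT.
exists e => //; exists (C1 * C2 * (K * (4 ^+ N) `^ p)).
  by rewrite !mulr_gt0// powR_gt0// exprn_gt0.
move=> b h y bP h0.
pose c := base_corner h y; pose l := 4 * h.
have l0 : 0 < l by rewrite mulr_gt0.
have ac : adm c by exact: adm_base.
have mQ := measurable_cube c l.
have dle (a d : R) x : 0 <= a -> a <= d -> cube c l x ->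
    (x `n / h) `^ (- a) <= depth c l x `^ (- d).
  move=> a0 ad Qx; have t0 := depth_gt0 l0 Qx; have t1 := depth_le1 l0 Qx.
  have x0 : 0 < x `n by move: t0; rewrite depth_base pmulr_lgt0// invr_gt0.
  have tx : depth c l x <= x `n / h.
    rewrite depth_base ler_pM2l// lef_pV2 ?posrE//.
    by rewrite ler_peMl ?(ltW h0)// ler1n.
  apply: (@le_trans _ _ (depth c l x `^ (- a))).
    have xh0 : 0 < x `n / h by rewrite divr_gt0.
    rewrite !powRN lef_pV2 ?posrE ?powR_gt0//.
    by apply: ge0_ler_powR; rewrite ?nnegrE ?(ltW t0)// divr_ge0// ltW.
  by apply: ger_powR; rewrite ?t0 ?t1// lerN2.
have mavg r : measurable_fun setT (fun x => avg b c l x `^ r)%E.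
  exact: measurable_avg_powR.
have sQ0 : (0 <= wmeasure s (cube c l))%E by exact: wmeasure_ge0.
have hG x : rel h (y, x) -> (G b e h x `^ (p - 1) <=
    C1%:E * (1 + avg b c l x `^ p) * wmeasure s (cube c l) `^ (p - 1))%E.
  move=> yx; apply: le_trans (h1 b c l x bP l0 ac).
  have Dc : rsec h x `<=` cube c l.
    by move=> z xz; apply: rel_base2 xz; exact: rel_sym.
  apply: gt0_ler_poweR; rewrite ?in_itv/= ?leey ?andbT ?(ltW p10)//.
  - apply: integral_ge0 => z _.
    by rewrite lee_fin !mulr_ge0 ?powR_ge0// ltW.
  - apply: integral_ge0 => z _.
    by rewrite lee_fin !mulr_ge0 ?powR_ge0// ltW.
  have mi : measurable_fun setT (fun z => (b x z `^ q * depth c l z `^ (- d1) * s z)%:E).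
    apply/measurable_EFinP; apply: measurable_funM => //.
    apply: measurable_funM; last exact: measurable_depth.
    apply: (@measurableT_comp _ _ _ _ _ _ (fun t : R => t `^ q)).
      exact: measurable_powR.
    exact: (measurable_mm1 bP).
  apply: (@le_trans _ _ (\int[mu]_(z in rsec h x)
      (b x z `^ q * depth c l z `^ (- d1) * s z)%:E)%E).
    apply: ge0_le_integral => //.
    - exact: measurable_rsec.
    - by move=> z _; rewrite lee_fin !mulr_ge0 ?powR_ge0// ltW.
    - apply: measurable_funTS; apply/measurable_EFinP; apply: measurable_funM => //.
      apply: (@measurableT_comp _ _ _ _ _ _ (fun t : R => t `^ q)).
        exact: measurable_powR.
      apply: measurable_funM; first exact: (measurable_mm1 bP).
      apply: (@measurableT_comp _ _ _ _ _ _ (fun t : R => t `^ (- e))).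
        exact: measurable_powR.
      by apply: measurable_funM => //; exact: measurable_coord.
    - exact: measurable_funTS.
    move=> z xz; rewrite lee_fin ler_wpM2r ?(ltW (s0 z))//.
    rewrite powRM ?powR_ge0 ?(mm_ge0 bP)// ler_wpM2l ?powR_ge0//.
    rewrite -powRrM mulNr; apply: dle => //; last exact: Dc.
    by rewrite mulr_ge0// ltW.
  apply: ge0_subset_integral => //.
  - exact: measurable_rsec.
  - exact: measurable_funTS.
  - by move=> z _; rewrite lee_fin !mulr_ge0 ?powR_ge0// ltW.
have Dy : rsec h y `<=` cube c l.
  by move=> x yx; apply: rel_base1; exact: rel_sym.
have mGx : measurable_fun setT (fun x => G b e h x `^ (p - 1))%E.
  apply: (@measurableT_comp _ _ _ _ _ _ (fun t : \bar R => (t `^ (p - 1))%E)).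
    exact: measurable_poweR.
  apply: (@measurable_integral_rsec h (fun u : V * V =>
    (b u.1 u.2 * (u.2 `n / h) `^ (- e)) `^ q * s u.2)).
    apply: measurable_funM.
      apply: (@measurableT_comp _ _ _ _ _ _ (fun t : R => t `^ q)).
        exact: measurable_powR.
      apply: measurable_funM; first exact: (mm_measurable bP).
      apply: (@measurableT_comp _ _ _ _ _ _ (fun t : R => t `^ (- e))).
        exact: measurable_powR.
      apply: measurable_funM => //.
      exact: (measurableT_comp (measurable_coord ord_max) measurable_snd).
    exact: (measurableT_comp ms measurable_snd).
  by move=> u; rewrite mulr_ge0 ?powR_ge0// ltW.
have mI : measurable_fun setT (fun x => ((1 + avg b c l x `^ p) *
    (depth c l x `^ (- d2))%:E * (w x)%:E)%E).
  apply: emeasurable_funM; last exact/measurable_EFinP.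
  apply: emeasurable_funM; last by apply/measurable_EFinP; exact: measurable_depth.
  exact: emeasurable_funD.
have I0 x : (0 <= (1 + avg b c l x `^ p) * (depth c l x `^ (- d2))%:E * (w x)%:E)%E.
  by rewrite !mule_ge0 ?lee_fin ?powR_ge0 ?(ltW (w0 x))// adde_ge0// poweR_ge0.
pose k : \bar R := (C1%:E * ((h ^+ N) `^ (- p))%:E * wmeasure s (cube c l) `^ (p - 1))%E.
have k0 : (0 <= k)%E by rewrite !mule_ge0 ?lee_fin ?powR_ge0 ?(ltW C10)// poweR_ge0.
apply: (@le_trans _ _ (\int[mu]_(x in cube c l) (k * ((1 + avg b c l x `^ p) *
    (depth c l x `^ (- d2))%:E * (w x)%:E)))%E).
  apply: (@le_trans _ _ (\int[mu]_(x in rsec h y) (k * ((1 + avg b c l x `^ p) *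
    (depth c l x `^ (- d2))%:E * (w x)%:E)))%E); last first.
    apply: ge0_subset_integral => //.
    - exact: measurable_rsec.
    - by apply: measurable_funTS; exact: measurable_funeM.
    - by move=> x _; rewrite mule_ge0.
  apply: ge0_le_integral => //.
  - exact: measurable_rsec.
  - by move=> x _; rewrite !mule_ge0 ?lee_fin ?powR_ge0 ?(ltW (w0 x))// poweR_ge0.
  - apply: measurable_funTS; apply: emeasurable_funM; last exact/measurable_EFinP.
    apply: emeasurable_funM => //; apply: emeasurable_funM => //.
    apply/measurable_EFinP; apply: (@measurableT_comp _ _ _ _ _ _ (fun t : R => t `^ (- (e * p)))).
      exact: measurable_powR.
    by apply: measurable_funM => //; exact: measurable_coord.
  - by apply: measurable_funTS; exact: measurable_funeM.
  move=> x yx; rewrite !muleA; apply: lee_wpmul2r; first by rewrite lee_fin ltW.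
  apply: (@le_trans _ _ ((depth c l x `^ (- d2))%:E * ((h ^+ N) `^ (- p))%:E *
    (C1%:E * (1 + avg b c l x `^ p) * wmeasure s (cube c l) `^ (p - 1)))%E).
    apply: lee_pmul; rewrite ?mule_ge0 ?lee_fin ?powR_ge0 ?poweR_ge0//.
      rewrite ler_wpM2r ?powR_ge0//; apply: dle => //; last exact: Dy.
      by rewrite mulr_ge0// ltW.
    exact: hG.
  rewrite le_eqVlt; apply/orP; left; apply/eqP.
  by rewrite /k (AC (2*3)%AC (3*2*5*4*1)%AC).
rewrite ge0_integralZl//; last exact: measurable_funTS.
apply: (@le_trans _ _ (k * (C2%:E * wmeasure w (cube c l)))%E).
  apply: lee_wpmul2l => //; exact: h2.
have hK' := hK c l l0.
have -> : (k * (C2%:E * wmeasure w (cube c l)) =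
   ((C1 * C2 * (h ^+ N) `^ (- p))%:E *
   (wmeasure w (cube c l) * wmeasure s (cube c l) `^ (p - 1))))%E.
  by rewrite /k !EFinM (AC (3*2)%AC (1*4*2*(5*3))%AC).
apply: (le_trans (lee_wpmul2l _ hK')); first by rewrite lee_fin !mulr_ge0 ?powR_ge0 ?ltW.
rewrite -EFinM lee_fin -!mulrA ler_pM2l// ler_pM2l//.
rewrite mulrCA ler_pM2l// /l exprMn powRM ?exprn_ge0 ?(ltW h0)//.
by rewrite mulrCA powRN mulVf ?mulr1// gt_eqF// powR_gt0// exprn_gt0.
Qed.

End near_part.

Section near_bound.
Context {R : realType} (n : nat).
Local Notation N := n.+1.
Local Notation V := 'rV[R]_N.
Local Notation mu := (lebesgue_rV N : {measure set V -> \bar R}).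
Implicit Types (c x y z : V) (l r h : R) (A E U : set V) (b : V -> V -> R) (F : V -> R).
Local Notation "x `n" := ((x : V) ord0 ord_max) (at level 2, format "x `n").

Definition near_op b (F : V -> R) r x : \bar R :=
  (\sum_(0 <= j <oo) (((r / 2 ^+ j) ^- N)%:E *
     \int[mu]_(y in rsec (r / 2 ^+ j) x) (b x y * F y)%:E))%E.

Variables (p : R) (p1 : 1 < p) (w : V -> R) (wP : Ap_weight p w).
Local Notation s := (dual_weight p w).
Local Notation q := (p / (p - 1)).
Let p0 : 0 < p. Proof. by rewrite (lt_trans ltr01). Qed.
Let w0 := Ap_gt0 wP.
Let mw := Ap_measurable wP.
Let ms := measurable_dual_weight p mw.

Let mpow (r : R) : measurable_fun setT (fun t : R => t `^ r).
Proof. exact: measurable_powR. Qed.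

Let mlast (h a : R) : measurable_fun setT (fun x : V => (x `n / h) `^ a).
Proof.
apply: (@measurableT_comp _ _ _ _ _ _ (fun t : R => t `^ a)); first exact: mpow.
by apply: measurable_funM => //; exact: measurable_coord.
Qed.

Lemma measurable_G b (e h : R) : mean_metric b ->
  measurable_fun setT (fun x => G p w b e h x `^ (p - 1))%E.
Proof.
move=> bP.
apply: (@measurableT_comp _ _ _ _ _ _ (fun t : \bar R => (t `^ (p - 1))%E)).
  exact: measurable_poweR.
apply: (@measurable_integral_rsec _ _ h (fun u : V * V =>
  (b u.1 u.2 * (u.2 `n / h) `^ (- e)) `^ q * s u.2)).
  apply: measurable_funM; last exact: (measurableT_comp ms measurable_snd).
  apply: (@measurableT_comp _ _ _ _ _ _ (fun t : R => t `^ q)); first exact: mpow.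
  apply: measurable_funM; first exact: (mm_measurable bP).
  exact: (measurableT_comp (mlast h (- e)) measurable_snd).
by move=> u; rewrite mulr_ge0 ?powR_ge0// ltW.
Qed.

Let mbF b (F : V -> R) : mean_metric b -> measurable_fun setT F ->
  measurable_fun setT (fun u : V * V => b u.1 u.2 * F u.2).
Proof.
move=> bP mF; apply: measurable_funM; first exact: (mm_measurable bP).
exact: (measurableT_comp mF measurable_snd).
Qed.

Lemma measurable_near_op b F r : mean_metric b -> measurable_fun setT F ->
  (forall x, 0 <= F x) -> 0 < r -> measurable_fun setT (near_op b F r).
Proof.
move=> bP mF F0 r0; apply: ge0_emeasurable_sum => [j x _ _|j _].
  rewrite mule_ge0 ?lee_fin ?invr_ge0 ?exprn_ge0 ?divr_ge0 ?exprn_ge0 ?(ltW r0)//.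
  by apply: integral_ge0 => y _; rewrite lee_fin mulr_ge0// (mm_ge0 bP).
apply: measurable_funeM.
apply: (@measurable_integral_rsec _ _ _ (fun u : V * V => b u.1 u.2 * F u.2)).
  exact: mbF.
by move=> u; rewrite mulr_ge0// (mm_ge0 bP).
Qed.

(** At scale h write the j-th term as (x_n / h)^e c_j. The factors (x_n / h)^e have a bounded sum
    over the scales h > x_n, so the sum of the c_j^p remains. Hoelder's inequality and Tonelli's
    theorem move the weight to y and produce (y_n / h)^(e p), which is summable over the scales for
    the same reason. *)
Lemma near_bound : exists2 C : R, 0 < C & forall b F r, mean_metric b ->
  measurable_fun setT F -> (forall x, 0 <= F x) -> 0 < r ->
  (\int[mu]_x (near_op b F r x `^ p * (w x)%:E) <=
   C%:E * \int[mu]_x (F x `^ p * w x)%:E)%E.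
Proof.
have [e e0 [C C0 hC]] := near_schur p1 wP.
have [B1 B10 hB1] := @nneseries_dyadic_le R e e0.
have ep0 : 0 < e * p by rewrite mulr_gt0.
have [B2 B20 hB2] := @nneseries_dyadic_le R _ ep0.
exists (B1 `^ p * (C * B2)); first by rewrite !mulr_gt0// powR_gt0.
move=> b F r bP mF F0 r0.
pose h j : R := r / 2 ^+ j.
have h0 j : 0 < h j by rewrite divr_gt0// exprn_gt0.
have b0 := mm_ge0 bP.
have hE j x : x `n / h j = x `n / r * 2 ^+ j.
  by rewrite /h; field; rewrite expf_neq0//= gt_eqF.
pose a j x := ((h j ^- N)%:E * \int[mu]_(y in rsec (h j) x) (b x y * F y)%:E)%E.
have a0 j x : (0 <= a j x)%E.
  rewrite mule_ge0 ?lee_fin ?invr_ge0 ?exprn_ge0 ?(ltW (h0 j))//.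
  by apply: integral_ge0 => y _; rewrite lee_fin mulr_ge0.
have ma j : measurable_fun setT (a j).
  apply: measurable_funeM.
  apply: (@measurable_integral_rsec _ _ _ (fun u : V * V => b u.1 u.2 * F u.2)).
    exact: mbF.
  by move=> u; rewrite mulr_ge0.
have anil j x : ~~ (0 < x `n < h j) -> a j x = 0%E.
  move=> nx; rewrite /a (_ : rsec _ _ = set0) ?integral_set0 ?mule0//.
  by apply/seteqP; split => // y [/= h1]; rewrite h1 in nx.
pose t j x := if 0 < x `n then if x `n / r * 2 ^+ j < 1 then
  (x `n / r * 2 ^+ j) `^ e else 0 else 0.
pose c j x := (((x `n / h j) `^ (- e))%:E * a j x)%E.
have c0 j x : (0 <= c j x)%E by rewrite mule_ge0// lee_fin powR_ge0.
have mc j : measurable_fun setT (c j).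
  by apply: emeasurable_funM => //; apply/measurable_EFinP.
have mcp j : measurable_fun setT (fun x => c j x `^ p)%E.
  apply: (@measurableT_comp _ _ _ _ _ _ (fun t : \bar R => (t `^ p)%E)) => //.
  exact: measurable_poweR.
have atc j x : (a j x <= (t j x)%:E * c j x)%E.
  have [/andP[x0 xh]|nx] := boolP (0 < x `n < h j); last first.
    by rewrite anil// mule_ge0// lee_fin /t; do 2?[case: ifP => // _]; exact: powR_ge0.
  rewrite /t x0 -hE ltr_pdivrMr// mul1r xh /c muleA -EFinM -powRD.
    by rewrite subrr powRr0 mul1e.
  by apply/implyP => _; rewrite gt_eqF// divr_gt0.
have sup x : (near_op b F r x `^ p <= (B1 `^ p)%:E * \sum_(0 <= j <oo) (c j x `^ p))%E.
  apply: (@nneseries_powR_sup _ p B1 (t ^~ x) (a ^~ x) (c ^~ x)) => //.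
    by move=> j; rewrite /t; do 2?[case: ifP => // _]; exact: powR_ge0.
  rewrite /t; case: (boolP (0 < x `n)) => x0; first by apply: hB1; rewrite divr_gt0.
  by rewrite eseries0// lee_fin; exact: ltW.
pose ph j y := (F y * (y `n / h j) `^ e) `^ p * w y.
have ph0 j y : 0 <= ph j y by rewrite mulr_ge0 ?powR_ge0// ltW.
have mph j : measurable_fun setT (ph j).
  apply: measurable_funM => //.
  apply: (@measurableT_comp _ _ _ _ _ _ (fun t : R => t `^ p)); first exact: mpow.
  exact: measurable_funM.
pose K j x := (((x `n / h j) `^ (- (e * p)))%:E * ((h j ^+ N) `^ (- p))%:E *
      G p w b e (h j) x `^ (p - 1) * (w x)%:E)%E.
have K0 j x : (0 <= K j x)%E.
  by rewrite !mule_ge0 ?lee_fin ?powR_ge0 ?poweR_ge0// ltW.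
have mK j : measurable_fun setT (K j).
  apply: emeasurable_funM; last exact/measurable_EFinP.
  apply: emeasurable_funM; last exact: measurable_G.
  apply: emeasurable_funM => //; exact/measurable_EFinP.
have cK j x : (c j x `^ p * (w x)%:E <=
    K j x * \int[mu]_(y in rsec (h j) x) (ph j y)%:E)%E.
  have I0 : (0 <= \int[mu]_(y in rsec (h j) x) (b x y * F y)%:E)%E.
    by apply: integral_ge0 => y _; rewrite lee_fin mulr_ge0.
  have mr := measurable_rsec (h j) x.
  have := @hoelder_weighted R _ _ mu p p1 w mw w0 (rsec (h j) x)
    (fun y => F y * (y `n / h j) `^ e) (fun y => b x y * (y `n / h j) `^ (- e)) mr.
  rewrite (eq_integral (fun y => (b x y * F y)%:E)); last first.
    move=> y /set_mem[_ /= /andP[y0 yh] _].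
    rewrite mulrACA -powRD; last by apply/implyP => _; rewrite gt_eqF// divr_gt0.
    by rewrite addNr powRr0 mulr1.
  move=> H; have {}H := H _ _ _ _.
  rewrite /c /a !poweRM ?lee_fin ?powR_ge0 ?invr_ge0 ?exprn_ge0 ?(ltW (h0 j))//; last first.
    by rewrite mule_ge0 ?lee_fin ?invr_ge0 ?exprn_ge0 ?(ltW (h0 j)).
  rewrite /K !poweR_EFin -powRrM mulNr.
  have -> : (h j ^- N) `^ p = (h j ^+ N) `^ (- p).
    by rewrite powRN -powR_inv1 ?exprn_ge0 ?(ltW (h0 j))// -powRrM mulN1r powRN.
  rewrite [leRHS](AC (4*1)%AC (1*2*(3*5)*4)%AC); apply: lee_wpmul2r.
    by rewrite lee_fin ltW.
  rewrite muleA; apply: lee_wpmul2l; first by rewrite mule_ge0 ?lee_fin ?powR_ge0.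
  apply: H.
  - apply: measurable_funTS; exact: measurable_funM.
  - apply: measurable_funTS; apply: measurable_funM => //; exact: (measurable_mm1 bP).
  - by move=> y _; rewrite mulr_ge0 ?powR_ge0.
  - by move=> y _; rewrite mulr_ge0 ?powR_ge0.
have mPhi j : measurable_fun setT (fun x => \int[mu]_(y in rsec (h j) x) (ph j y)%:E)%E.
  apply: (@measurable_integral_rsec _ _ _ (fun u : V * V => ph j u.2)) => //.
  exact: (measurableT_comp (mph j) measurable_snd).
have Phi0 j x : (0 <= \int[mu]_(y in rsec (h j) x) (ph j y)%:E)%E.
  by apply: integral_ge0 => y _; rewrite lee_fin.
pose chi j (y : V) : R := if 0 < y `n then if y `n / r * 2 ^+ j < 1 then
  (y `n / r * 2 ^+ j) `^ (e * p) else 0 else 0.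
have chi0 j y : 0 <= chi j y by rewrite /chi; do 2?[case: ifP => // _]; exact: powR_ge0.
(* Tonelli's theorem with the symmetry of [rel]: the inner integral is now over x in [rsec (h j) y],
   as in [near_schur]. The section is empty unless 0 < y_n < h, which is what [chi] records. *)
have swap j : (\int[mu]_x (K j x * \int[mu]_(y in rsec (h j) x) (ph j y)%:E) <=
    \int[mu]_y (C * (chi j y * (F y `^ p * w y)))%:E)%E.
  pose f (u : V * V) := (K j u.1 * (\1_(rel (h j)) u * ph j u.2)%:E)%E.
  have i0 u : 0 <= \1_(rel (h j)) u * ph j u.2 by rewrite mulr_ge0.
  have f0 u : (0 <= f u)%E by rewrite mule_ge0 ?lee_fin.
  have mi : measurable_fun setT (fun u => \1_(rel (h j)) u * ph j u.2).
    apply: measurable_funM; first by apply: measurable_indic; exact: measurable_rel.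
    exact: (measurableT_comp (mph j) measurable_snd).
  have mf : measurable_fun setT f.
    apply: emeasurable_funM; last exact/measurable_EFinP.
    exact: (measurableT_comp (mK j) measurable_fst).
  rewrite (eq_integral (fun x => \int[mu]_y f (x, y))%E); last first.
    move=> x _; rewrite (integral_rsecE (h j) (fun u => ph j u.2)) /fubini_F /f/=.
    rewrite ge0_integralZl//; last by move=> y _; rewrite lee_fin.
    apply: (measurable_fun_pair2 (f := fun u : V * V =>
      (\1_(rel (h j)) u * ph j u.2)%:E)); exact/measurable_EFinP.
  rewrite fubini_tonelli//; apply: ge0_le_integral => //.
  - by move=> y _; exact: integral_ge0.
  - exact: (measurable_fun_fubini_tonelli_G f mf f0).
  - apply/measurable_EFinP; apply: measurable_funM => //; apply: measurable_funM.
      apply: measurable_fun_ifT => //.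
        apply: measurable_fun_ltr => //; exact: measurable_coord.
      apply: measurable_fun_ifT => //.
        apply: measurable_fun_ltr => //; apply: measurable_funM => //.
        by apply: measurable_funM => //; exact: measurable_coord.
      under eq_fun do rewrite -hE.
      exact: mlast.
    apply: measurable_funM => //.
    by apply: (@measurableT_comp _ _ _ _ _ _ (fun t : R => t `^ p)).
  move=> y _.
  have -> : (\int[mu]_x f (x, y) = (ph j y)%:E * \int[mu]_(x in rsec (h j) y) K j x)%E.
    rewrite [in RHS]integral_mkcond -ge0_integralZl//; last 3 first.
    - by apply: (measurable_restrictT _ (measurable_rsec _ _)).1; exact: measurable_funTS.
    - by move=> x _; rewrite patchE; case: ifP.
    - by rewrite lee_fin.
    apply: eq_integral => x _; rewrite /f/= patchE indicE.
    have [xy|xy] := boolP (x \in rsec (h j) y).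
      rewrite mem_set ?mul1r 1?muleC//; apply: rel_sym; exact: set_mem xy.
    rewrite memNset ?mul0r ?mule0// => xy'; move: xy; rewrite mem_set//.
    exact: rel_sym.
  have [/andP[y0 yh]|ny] := boolP (0 < y `n < h j); last first.
    rewrite (_ : rsec _ _ = set0) ?integral_set0 ?mule0 ?lee_fin.
      by rewrite !mulr_ge0 ?powR_ge0 ?chi0// ltW.
    by apply/seteqP; split => // x [/= h1]; rewrite h1 in ny.
  apply: (@le_trans _ _ ((ph j y)%:E * C%:E)%E).
    by apply: lee_wpmul2l; [rewrite lee_fin|exact: hC].
  rewrite -EFinM lee_fin /ph /chi y0 -hE ltr_pdivrMr// mul1r yh.
  rewrite powRM ?powR_ge0// -powRrM le_eqVlt; apply/orP; left; apply/eqP.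
  by ring.
pose Z := (\int[mu]_x (F x `^ p * w x)%:E)%E.
have mFpw : measurable_fun setT (fun x => F x `^ p * w x).
  apply: measurable_funM => //.
  by apply: (@measurableT_comp _ _ _ _ _ _ (fun t : R => t `^ p)).
have mchi j : measurable_fun setT (chi j).
  apply: measurable_fun_ifT => //.
    apply: measurable_fun_ltr => //; exact: measurable_coord.
  apply: measurable_fun_ifT => //.
    apply: measurable_fun_ltr => //; apply: measurable_funM => //.
    by apply: measurable_funM => //; exact: measurable_coord.
  under eq_fun do rewrite -hE.
  exact: mlast.
have mcw j : measurable_fun setT (fun x => c j x `^ p * (w x)%:E)%E.
  by apply: emeasurable_funM => //; exact/measurable_EFinP.
have cw0 j x : (0 <= c j x `^ p * (w x)%:E)%E.
  by rewrite mule_ge0 ?poweR_ge0// lee_fin ltW.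
apply: (@le_trans _ _ (\int[mu]_x ((B1 `^ p)%:E *
    \sum_(0 <= j <oo) (c j x `^ p * (w x)%:E)))%E).
  apply: ge0_le_integral => //.
  - by move=> x _; rewrite mule_ge0 ?poweR_ge0// lee_fin ltW.
  - apply: emeasurable_funM; last exact/measurable_EFinP.
    apply: (@measurableT_comp _ _ _ _ _ _ (fun t : \bar R => (t `^ p)%E)).
      exact: measurable_poweR.
    exact: measurable_near_op.
  - apply: measurable_funeM; apply: ge0_emeasurable_sum => [j x _ _|j _];
      [exact: cw0|exact: mcw].
  move=> x _; apply: (@le_trans _ _ (((B1 `^ p)%:E * \sum_(0 <= j <oo) (c j x `^ p)) * (w x)%:E)%E).
    by apply: lee_wpmul2r; [rewrite lee_fin ltW|exact: sup].
  rewrite -muleA; apply: lee_wpmul2l; first by rewrite lee_fin powR_ge0.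
  rewrite muleC -nneseriesZl; last by move=> j _; exact: poweR_ge0.
  by apply: lee_nneseries => [j _ _|j _]; rewrite muleC.
rewrite ge0_integralZl//; last 3 first.
- by apply: ge0_emeasurable_sum => [j x _ _|j _]; [exact: cw0|exact: mcw].
- by move=> x _; apply: nneseries_ge0 => j _ _; exact: cw0.
- by rewrite lee_fin powR_ge0.
rewrite EFinM -muleA; apply: lee_wpmul2l; first by rewrite lee_fin powR_ge0.
rewrite integral_nneseries//.
apply: (@le_trans _ _ (\sum_(0 <= j <oo)
   \int[mu]_y (C * (chi j y * (F y `^ p * w y)))%:E)%E).
  apply: lee_nneseries => [j _ _|j _]; first exact: integral_ge0.
  apply: le_trans (swap j); apply: ge0_le_integral => //.
  by apply: emeasurable_funM.
have D0 j y : (0 <= (C * (chi j y * (F y `^ p * w y)))%:E)%E.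
  by rewrite lee_fin !mulr_ge0 ?powR_ge0 ?(ltW C0) ?chi0// ltW.
have mD j : measurable_fun setT (fun y => (C * (chi j y * (F y `^ p * w y)))%:E).
  by apply/measurable_EFinP; apply: measurable_funM => //; exact: measurable_funM.
rewrite -integral_nneseries// -ge0_integralZl//; last 3 first.
- exact/measurable_EFinP.
- by move=> x _; rewrite lee_fin mulr_ge0 ?powR_ge0// ltW.
- by rewrite lee_fin mulr_ge0// ltW.
apply: ge0_le_integral => //.
- by move=> x _; apply: nneseries_ge0 => j _ _; exact: D0.
- by apply: ge0_emeasurable_sum => [j x _ _|j _]; [exact: D0|exact: mD].
- by apply: measurable_funeM; exact/measurable_EFinP.
move=> y _.
have -> : (\sum_(0 <= j <oo) (C * (chi j y * (F y `^ p * w y)))%:E =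
  (C * (F y `^ p * w y))%:E * \sum_(0 <= j <oo) (chi j y)%:E)%E.
  rewrite -nneseriesZl; last by move=> j _; rewrite lee_fin.
  by apply: eq_eseriesr => j _; rewrite -EFinM; congr EFin; ring.
apply: (@le_trans _ _ ((C * (F y `^ p * w y))%:E * B2%:E)%E).
  apply: lee_wpmul2l; first by rewrite lee_fin !mulr_ge0 ?powR_ge0 ?(ltW C0)// ltW.
  rewrite /chi; case: (boolP (0 < y `n)) => y0; first by apply: hB2; rewrite divr_gt0.
  by rewrite eseries0// lee_fin; exact: ltW.
by rewrite -!EFinM mulrAC.
Qed.

End near_bound.

(** * Half-balls and the far part *)

Section euclidean_geometry.
Context {R : realType}.

Lemma enorm_ge0 n (x : 'rV[R]_n) : 0 <= enorm x.
Proof. exact: sqrtr_ge0. Qed.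

Lemma enorm_coord n (x : 'rV[R]_n) i : `|x ord0 i| <= enorm x.
Proof.
rewrite -sqrtr_sqr ler_sqrt; last by apply: sumr_ge0 => j _; exact: sqr_ge0.
by rewrite (bigD1 i)//= lerDl; apply: sumr_ge0 => j _; exact: sqr_ge0.
Qed.

Lemma enormN n (x : 'rV[R]_n) : enorm (- x) = enorm x.
Proof.
by congr Num.sqrt; apply: eq_bigr => i _; rewrite mxE sqrrN.
Qed.

Lemma enormC n (x y : 'rV[R]_n) : enorm (x - y) = enorm (y - x).
Proof. by rewrite -opprB enormN. Qed.

Lemma sqr_enorm n (x : 'rV[R]_n) : enorm x ^+ 2 = \sum_i x ord0 i ^+ 2.
Proof. by rewrite sqr_sqrtr// sumr_ge0// => i _; exact: sqr_ge0. Qed.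

Lemma enorm_le n (x : 'rV[R]_n.+1) t : 0 <= t -> (forall i, `|x ord0 i| <= t) ->
  enorm x <= n.+1%:R * t.
Proof.
move=> t0 xt; rewrite -(@ler_pXn2r _ 2)// ?nnegrE ?enorm_ge0 ?mulr_ge0//.
rewrite sqr_enorm; apply: (@le_trans _ _ (\sum_(i < n.+1) t ^+ 2)).
  by apply: ler_sum => i _; have := xt i; rewrite ler_norml => /andP[h1 h2]; nra.
rewrite sumr_const card_ord -[leLHS]mulr_natl exprMn.
apply: ler_wpM2r; first exact: sqr_ge0.
by rewrite expr2 ler_peMr// ler1n.
Qed.

Lemma cauchy_schwarz_sum n (x y : 'rV[R]_n) :
  (\sum_i x ord0 i * y ord0 i) <= enorm x * enorm y.
Proof.
set a := enorm x; set b := enorm y.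
have a0 : 0 <= a := enorm_ge0 x; have b0 : 0 <= b := enorm_ge0 y.
have [az|az] := eqVneq a 0.
  rewrite az mul0r big1// => i _; have := enorm_coord x i.
  by rewrite -/a az normr_le0 => /eqP ->; rewrite mul0r.
have [bz|bz] := eqVneq b 0.
  rewrite bz mulr0 big1// => i _; have := enorm_coord y i.
  by rewrite -/b bz normr_le0 => /eqP ->; rewrite mulr0.
have ab0 : 0 < a * b by rewrite mulr_gt0// lt_neqAle eq_sym ?az ?bz.
have H : 0 <= \sum_i (b * x ord0 i - a * y ord0 i) ^+ 2.
  by apply: sumr_ge0 => i _; exact: sqr_ge0.
have E : \sum_i (b * x ord0 i - a * y ord0 i) ^+ 2 =
   2 * (a * b) * (a * b - \sum_i x ord0 i * y ord0 i).
  rewrite (eq_bigr (fun i => b ^+ 2 * (x ord0 i ^+ 2) + a ^+ 2 * (y ord0 i ^+ 2)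
     - 2 * (a * b) * (x ord0 i * y ord0 i))); last by move=> i _; ring.
  rewrite big_split/= big_split/= -!mulr_sumr sumrN -mulr_sumr -!sqr_enorm -/a -/b.
  by ring.
have c0 : 0 < 2 * (a * b) by rewrite mulr_gt0.
by rewrite -subr_ge0 -(pmulr_rge0 _ c0) -E.
Qed.

Lemma enormD n (x y : 'rV[R]_n) : enorm (x + y) <= enorm x + enorm y.
Proof.
rewrite -(@ler_pXn2r _ 2)// ?nnegrE ?addr_ge0 ?enorm_ge0//.
rewrite sqrrD !sqr_enorm.
rewrite (eq_bigr (fun i => x ord0 i ^+ 2 + (x ord0 i * y ord0 i) *+ 2 + y ord0 i ^+ 2)); last first.
  by move=> i _; rewrite mxE sqrrD.
rewrite !big_split/= lerD2r lerD2l -big_split/=.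
rewrite (eq_bigr (fun i => 2 * (x ord0 i * y ord0 i))); last by move=> i _; ring.
by rewrite -mulr_sumr mulr2n -mulr2n -mulr_natl ler_pM2l// cauchy_schwarz_sum.
Qed.

Lemma enormB_triangle n (x y z : 'rV[R]_n) : enorm (x - z) <= enorm (x - y) + enorm (y - z).
Proof. by rewrite -(subrKA y) enormD. Qed.

Lemma measurable_eball n (x : 'rV[R]_n) (r : R) : measurable (eball x r).
Proof.
rewrite -[X in measurable X]setTI.
have mf : measurable_fun setT (fun y : 'rV[R]_n => enorm (y - x)).
  apply: measurableT_comp; first exact: measurable_enorm.
  apply: measurable_fun_rV => i.
  under eq_fun do rewrite !mxE.
  by apply: measurable_funB => //; exact: measurable_coord.
rewrite (_ : eball x r = (fun y => enorm (y - x)) @^-1` `]-oo, r[%classic).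
  by apply: mf => //; exact: measurable_itv.
by apply/seteqP; split => y /=; rewrite in_itv.
Qed.

Lemma measurable_halfspace n : measurable (@halfspace R n).
Proof.
rewrite (_ : @halfspace R n = [set x : 'rV[R]_n.+1 | `]0, +oo[%classic (x ord0 ord_max)]).
  by apply: measurable_coord_set; exact: measurable_itv.
by apply/seteqP; split => y /=; rewrite in_itv/= andbT.
Qed.

Lemma measurable_hball n (x : 'rV[R]_n.+1) (r : R) : measurable (hball x r).
Proof. by apply: measurableI; [exact: measurable_eball|exact: measurable_halfspace]. Qed.

End euclidean_geometry.

Section balls_cubes.
Context {R : realType} (n : nat).
Local Notation N := n.+1.
Local Notation V := 'rV[R]_N.
Local Notation mu := (lebesgue_rV N : {measure set V -> \bar R}).
Implicit Types (c x y z : V) (l r h rho : R) (A E U : set V).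
Local Notation "x `n" := ((x : V) ord0 ord_max) (at level 2, format "x `n").

(** The maximum pushes the cube up into the half-space, as [mm_mean] demands, while it still
    contains the half-ball of radius rho. *)
Definition outer_corner x rho : V :=
  \row_i if i == ord_max then Num.max 0 (x `n - rho) else x ord0 i - rho.

Lemma adm_outer x rho : adm (outer_corner x rho).
Proof. by rewrite /adm mxE eqxx le_max lexx. Qed.

Lemma eball_coord x y r i : eball x r y -> `|y ord0 i - x ord0 i| < r.
Proof.
by move=> xy; apply: le_lt_trans xy; have := enorm_coord (y - x) i; rewrite !mxE.
Qed.

Lemma hball_outer x rho : 0 < x `n ->
  hball x rho `<=` cube (outer_corner x rho) (2 * rho).
Proof.
move=> x0 y [xy y0] i; have := eball_coord i xy.
rewrite ltr_norml => /andP[h1 h2]; rewrite mxE.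
case: (eqVneq i ord_max) h1 h2 => [->|_] h1 h2; last by apply/andP; split; lra.
move: y0; rewrite /halfspace/= => y0.
by case: (leP 0 (x `n - rho)) => h3; apply/andP; split; lra.
Qed.

Lemma outer_mono x rho rho' : 0 < x `n -> rho <= rho' ->
  cube (outer_corner x rho) (2 * rho) `<=` cube (outer_corner x rho') (2 * rho').
Proof.
move=> x0 rr y hy i; move: (hy i); rewrite !mxE.
case: (eqVneq i ord_max) => [->|_]; last first.
  by move=> /andP[h1 h2]; apply/andP; split; lra.
case: (leP 0 (x `n - rho)) => h3; case: (leP 0 (x `n - rho')) => h4 /andP[h1 h2];
  by apply/andP; split; lra.
Qed.

(** The cube of side 8 rho centred at x. It may leave the half-space and only serves to compare
    masses of the weight. *)
Definition big_corner x rho : V := \row_i (x ord0 i - 4 * rho).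

Lemma outer_big x rho : 0 < x `n -> 0 < rho ->
  cube (outer_corner x rho) (2 * rho) `<=` cube (big_corner x rho) (8 * rho).
Proof.
move=> x0 r0 y hy i; move: (hy i); rewrite !mxE.
case: (eqVneq i ord_max) => [->|_]; last first.
  by move=> /andP[h1 h2]; apply/andP; split; lra.
by case: (leP 0 (x `n - rho)) => h3 /andP[h1 h2]; apply/andP; split; lra.
Qed.

Lemma eball_big x rho : 0 < rho -> eball x (2 * rho) `<=` cube (big_corner x rho) (8 * rho).
Proof.
move=> r0 y xy i; have := eball_coord i xy.
by rewrite ltr_norml mxE => /andP[h1 h2]; apply/andP; split; lra.
Qed.

Lemma small_hball x r : 0 < x `n -> 0 < r ->
  cube x (r / (2 * N%:R)) `<=` hball x r.
Proof.
move=> x0 r0 y xy.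
have N0 : 0 < N%:R :> R by rewrite ltr0n.
have e0 : 0 < r / (2 * N%:R) by rewrite divr_gt0// mulr_gt0.
split; last by move: (xy ord_max) => /andP[h _]; exact: lt_trans h.
apply: (@le_lt_trans _ _ (N%:R * (r / (2 * N%:R)))).
  apply: enorm_le; first exact: ltW.
  move=> i; rewrite !mxE; move: (xy i) => /andP[h1 h2].
  by rewrite ger0_norm ?subr_ge0 ?(ltW h1)// lerBlDl.
have -> : N%:R * (r / (2 * N%:R)) = r / 2.
  by rewrite invfM mulrCA (mulrCA N%:R) divff ?mulr1// gt_eqF.
lra.
Qed.

Lemma mu_hball_ge x r : 0 < x `n -> 0 < r ->
  (((r / (2 * N%:R)) ^+ N)%:E <= mu (hball x r))%E.
Proof.
move=> x0 r0; rewrite -(mu_cube x); last by rewrite divr_ge0 ?mulr_ge0 ?ler0n// ltW.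
apply: le_measure; rewrite ?inE; [exact: measurable_cube|exact: measurable_hball|].
exact: small_hball.
Qed.

End balls_cubes.

(** * Dilated cubes and doubling *)

Section far_part.
Context {R : realType} (n : nat).
Local Notation N := n.+1.
Local Notation V := 'rV[R]_N.
Local Notation mu := (lebesgue_rV N : {measure set V -> \bar R}).
Implicit Types (c x y z : V) (l r h rho : R) (A E U : set V) (b : V -> V -> R)
  (F : V -> R).
Local Notation "x `n" := ((x : V) ord0 ord_max) (at level 2, format "x `n").

Lemma ler_poweR_inv (p : R) (a b : \bar R) : 0 < p -> (0 <= a)%E -> (0 <= b)%E ->
  (a `^ p <= b `^ p)%E -> (a <= b)%E.
Proof.
move=> p0 a0 b0 ab.
have e t : (0 <= t -> t = (t `^ p) `^ p^-1)%E.
  by move=> t0; rewrite -poweRrM divff ?gt_eqF// poweRe1.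
rewrite (e a)// (e b)//; apply: gt0_ler_poweR;
  by rewrite ?in_itv/= ?leey ?andbT ?poweR_ge0// invr_ge0 ltW.
Qed.

(** Each doubling costs at most 2^N: in [avg_compare] the integral over the smaller cube is at most
    the integral over the larger one, and the latter is divided by the measure of the smaller
    cube. *)
Lemma avg_outer_le b x0 rho k x : mean_metric b -> 0 < x0 `n -> 0 < rho ->
  (avg b (outer_corner x0 (2 ^+ k * rho)) (2 * (2 ^+ k * rho)) x <=
   avg b (outer_corner x0 rho) (2 * rho) x + (k%:R * 2 ^+ N)%:E)%E.
Proof.
move=> bP x00 r0; elim: k => [|k IH]; first by rewrite expr0 !mul1r mul0r adde0.
set t := 2 ^+ k * rho in IH *.
have t0 : 0 < t by rewrite mulr_gt0// exprn_gt0.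
have -> : 2 ^+ k.+1 * rho = 2 * t by rewrite exprS mulrA.
have l0 : 0 < 2 * t by rewrite mulr_gt0.
have l20 : 0 < 2 * (2 * t) by rewrite mulr_gt0.
apply: le_trans (avg_compare bP _ (outer_corner x0 t) x l20 l0) _.
have -> : k.+1%:R * 2 ^+ N = k%:R * 2 ^+ N + 2 ^+ N :> R.
  by rewrite mulrSr mulrDl mul1r.
rewrite EFinD addeA; apply: leeD => //.
have ma : measurable_fun setT (avg b (outer_corner x0 (2 * t)) (2 * (2 * t))).
  exact: measurable_avg.
apply: (@le_trans _ _ (((2 * t) ^- N)%:E *
   \int[mu]_(z in cube (outer_corner x0 (2 * t)) (2 * (2 * t)))
     avg b (outer_corner x0 (2 * t)) (2 * (2 * t)) z)%E).
  apply: lee_wpmul2l; first by rewrite lee_fin invr_ge0 exprn_ge0// ltW.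
  apply: ge0_subset_integral => //.
  - exact: measurable_funTS.
  - by move=> z _; exact: avg_ge0.
  - by apply: outer_mono => //; rewrite ler_peMl ?(ltW t0)// ler1n.
apply: (le_trans (lee_wpmul2l _ (mm_mean bP l20 (adm_outer _ _)))).
  by rewrite lee_fin invr_ge0 exprn_ge0// ltW.
rewrite -EFinM lee_fin; move: (2 * t) l0 => u u0.
by rewrite exprMn mulrCA mulVf ?mulr1// expf_neq0// gt_eqF.
Qed.

Variables (p : R) (p1 : 1 < p) (w : V -> R) (wP : Ap_weight p w).

(** Doubling, as a case of the A_infinity condition: the smaller cube has a quarter of the side of
    the larger one. *)
Lemma wmeasure_outer : exists2 C : R, 0 < C & forall x rho, 0 < x `n -> 0 < rho ->
  (wmeasure w (cube (big_corner x rho) (8 * rho)) <=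
   C%:E * wmeasure w (cube (outer_corner x rho) (2 * rho)))%E.
Proof.
have t0 : 0 < (4^-1) ^+ N :> R by rewrite exprn_gt0// invr_gt0.
have [C C0 hC] := gw_Ainf (Ap_good_weight p1 wP) t0.
exists C => // x rho x0 r0; apply: hC.
- by rewrite mulr_gt0.
- exact: measurable_cube.
- exact: outer_big.
have [h1 h2] : 0 <= 8 * rho /\ 0 <= 2 * rho by split; rewrite mulr_ge0// ltW.
rewrite !mu_cube// -EFinM lee_fin -exprMn; apply: lerXn2r; rewrite ?nnegrE//; lra.
Qed.

Lemma wmeasure_hball : exists2 C : R, 0 < C & forall x r, 0 < x `n -> 0 < r ->
  (wmeasure w (cube (big_corner x (2 * r)) (8 * (2 * r))) <=
   C%:E * wmeasure w (hball x r))%E.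
Proof.
have N0 : 0 < N%:R :> R by rewrite ltr0n.
(* The half-ball contains a cube of side r / (2N), to be compared with the side 16 r. *)
have t0 : 0 < ((32 * N%:R)^-1) ^+ N :> R by rewrite exprn_gt0// invr_gt0 mulr_gt0.
have [C C0 hC] := gw_Ainf (Ap_good_weight p1 wP) t0.
exists C => // x r x0 r0; apply: hC.
- by rewrite !mulr_gt0.
- exact: measurable_hball.
- move=> y [xy _]; apply: eball_big; first by rewrite mulr_gt0.
  by apply: lt_le_trans xy _; rewrite mulrA ler_peMl ?(ltW r0)//; lra.
apply: le_trans (mu_hball_ge x0 r0).
have h1 : 0 <= 8 * (2 * r) by rewrite !mulr_ge0// ltW.
rewrite mu_cube// -EFinM lee_fin -exprMn le_eqVlt; apply/orP; left; apply/eqP.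
congr (_ ^+ _); rewrite !invfM.
have -> : 32^-1 = 8^-1 * 4^-1 :> R by field.
move: (N%:R^-1) => M; by field.
Qed.

Lemma wmeasure_cube_gt0 c l : 0 < l -> (0 < wmeasure w (cube c l))%E.
Proof.
move=> l0; have [K K0 hK] := Ap_real_bounds p1 wP.
have l0' := ltW l0.
have [|a [A [e [F [_ wa _ _ [/andP[a0 _] _ _ h]]]]]] :=
    hK 1 c l (cube c l) ltr01 l0 (measurable_cube c l) (@subset_refl _ _).
  by rewrite mul1e.
rewrite wa lte_fin lt_neqAle a0 andbT; apply/eqP => az.
move: h; rewrite -az mulr0 leNgt => /negP; apply.
by rewrite powR1 mul1r powR_gt0// exprn_gt0.
Qed.

End far_part.

Section local_bound.
Context {R : realType} (n : nat).
Local Notation N := n.+1.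
Local Notation V := 'rV[R]_N.
Local Notation mu := (lebesgue_rV N : {measure set V -> \bar R}).
Implicit Types (c x y z : V) (l r h rho : R) (A E U : set V) (b : V -> V -> R)
  (F : V -> R).
Local Notation "x `n" := ((x : V) ord0 ord_max) (at level 2, format "x `n").

Variables (p : R) (p1 : 1 < p) (w : V -> R) (wP : Ap_weight p w).
Local Notation s := (dual_weight p w).
Local Notation q := (p / (p - 1)).
Let p10 : 0 < p - 1. Proof. by rewrite subr_gt0. Qed.
Let p0 : 0 < p. Proof. by rewrite (lt_trans ltr01). Qed.
Let s0 := dual_weight_gt0 p (Ap_gt0 wP).
Let w0 := Ap_gt0 wP.
Let mw := Ap_measurable wP.
Let ms := measurable_dual_weight p mw.

Definition local_norm F x r : \bar R :=
  (\int[mu]_(y in hball x r) (F y `^ p * w y)%:E)%E.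

Lemma wmeasure_eball x r : 0 < x `n -> 0 < r ->
  exists2 a : R, 0 < a & wmeasure w (eball x r) = a%:E.
Proof.
move=> x0 r0.
have h1 : (wmeasure w (eball x r) < +oo)%E.
  apply: (@le_lt_trans _ _ (wmeasure w (cube (big_corner x (r / 2)) (8 * (r / 2))))).
    apply: wmeasure_le => //; first exact: measurable_eball.
    have -> : eball x r = eball x (2 * (r / 2)) by rewrite mulrC divfK.
    by apply: eball_big; rewrite divr_gt0.
  exact: (Ap_fin wP).
have h2 : (0 < wmeasure w (eball x r))%E.
  apply: (@lt_le_trans _ _ (wmeasure w (cube x (r / (2 * N%:R))))).
    by apply: (wmeasure_cube_gt0 p1 wP); rewrite divr_gt0// mulr_gt0// ltr0n.
  apply: wmeasure_le => //; first exact: measurable_eball.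
  by move=> y /(small_hball x0 r0)[].
have f : wmeasure w (eball x r) \is a fin_num by rewrite ge0_fin_numE// ltW.
by exists (fine (wmeasure w (eball x r))); rewrite ?fineK// fine_gt0// h2.
Qed.

Let mule_gather (a b c d e : \bar R) :
  (a * (b * (c * d)) * e = a * b * (d * e) * c)%E.
Proof. by rewrite (AC ((1*(1*(1*1)))*1)%AC (((1*2)*(4*5))*3)%AC). Qed.

(** Hoelder's inequality on the half-ball leaves a power of the dual mass of a cube, which the A_p
    condition turns into the inverse mass of w, and doubling turns that into the mass of a ball. The
    mean over the dilated cube is brought back to a fixed cube by [avg_outer_le], at the price of k
    + 1, so that x enters independently of k. The ball carries twice the radius of the half-ball,
    because in [tail_sum_le] the integration variable runs between these two radii. *)
Lemma far_term : exists2 C : R, 0 < C & forall b F x0 r (k : nat) x,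
  mean_metric b -> measurable_fun setT F -> (forall y, 0 <= F y) ->
  0 < x0 `n -> 0 < r ->
  (((2 ^+ k * r) ^- N)%:E *
     \int[mu]_(y in hball x0 (2 ^+ k.+1 * r)) (b x y * F y)%:E <=
   C%:E * (k.+1%:R%:E * (local_norm F x0 (2 ^+ k.+1 * r) `^ p^-1 *
     (wmeasure w (eball x0 (2 ^+ k.+2 * r)) `^ p^-1)^-1)) *
   (1 + avg b (outer_corner x0 (2 * r)) (2 * (2 * r)) x))%E.
Proof.
have [d d0 [C1 C10 h1]] := dual_bound p1 wP.
have [C3 C30 h3] := wmeasure_outer p1 wP.
have [K K0 hK] := Ap_cube wP.
(* The factors come from the dual bound, from doubling, from the A_p condition, and from the side l
   = 4 t of the cube measured against t = 2^k r. *)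
pose D := C1 * C3 * K * (4 ^+ N) `^ p.
have D0 : 0 < D by rewrite !mulr_gt0// powR_gt0// exprn_gt0.
exists (D `^ p^-1 * (2 * 2 ^+ N)).
  by rewrite mulr_gt0 ?powR_gt0// mulr_gt0// exprn_gt0.
move=> b F x0 r k x bP mF F0 x00 r0.
pose t := 2 ^+ k * r; have t0 : 0 < t by rewrite mulr_gt0// exprn_gt0.
pose rho := 2 ^+ k * (2 * r).
have rhoE : rho = 2 * t by rewrite /rho /t mulrCA.
have rho0 : 0 < rho by rewrite rhoE mulr_gt0.
have -> : 2 ^+ k.+1 * r = rho by rewrite rhoE exprS mulrA.
have -> : 2 ^+ k.+2 * r = 2 * rho by rewrite rhoE !exprS !mulrA.
rewrite -/t; set c := outer_corner x0 rho; set l := 2 * rho.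
have l0 : 0 < l by rewrite mulr_gt0.
have ac : adm c by exact: adm_outer.
have r20 : 0 < 2 * r by rewrite mulr_gt0.
have [om om0 omE] := wmeasure_eball x00 l0.
rewrite omE poweR_EFin inver gt_eqF ?powR_gt0//.
have fin y c' l' : 0 < l' -> adm c' -> avg b c' l' y = (fine (avg b c' l' y))%:E.
  by move=> l'0 ac'; rewrite fineK// ge0_fin_numE ?avg_lty// avg_ge0.
have u0le := avg_outer_le k x bP x00 r20.
have r40 : 0 < 2 * (2 * r) by rewrite mulr_gt0.
rewrite -/rho -/c -/l (fin x c l)// (fin x (outer_corner x0 (2 * r)))// in u0le;
  last exact: adm_outer.
have := h1 b c l x bP l0 ac.
rewrite (fin x c l)// [in X in _ -> X](fin x (outer_corner x0 (2 * r)))//; last exact: adm_outer.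
have u0 : 0 <= fine (avg b c l x) by rewrite fine_ge0// avg_ge0.
have v0 : 0 <= fine (avg b (outer_corner x0 (2 * r)) (2 * (2 * r)) x).
  by rewrite fine_ge0// avg_ge0.
move: u0 v0 u0le; set u := fine (avg b c l x); set v := fine _ => u0 v0.
rewrite -EFinD lee_fin => uv.
have fs : wmeasure s (cube c l) \is a fin_num.
  rewrite ge0_fin_numE; first exact: (Ap_dual_fin wP).
  by apply: integral_ge0 => z _; rewrite lee_fin ltW.
have fw : wmeasure w (cube c l) \is a fin_num.
  rewrite ge0_fin_numE; first exact: (Ap_fin wP).
  by apply: integral_ge0 => z _; rewrite lee_fin ltW.
have hK' := hK c l l0.
have h3' : (om%:E <= C3%:E * wmeasure w (cube c l))%E.
  apply: le_trans (h3 x0 rho x00 rho0).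
  rewrite -omE; apply: wmeasure_le => //; first exact: measurable_eball.
  exact: eball_big.
have a0 : 0 <= fine (wmeasure w (cube c l)).
  by rewrite fine_ge0//; apply: integral_ge0 => z _; rewrite lee_fin ltW.
have aE : wmeasure w (cube c l) = (fine (wmeasure w (cube c l)))%:E by rewrite fineK.
have SE : wmeasure s (cube c l) = (fine (wmeasure s (cube c l)))%:E by rewrite fineK.
move: aE a0; move: (fine (wmeasure w (cube c l))) => a aE a0.
move: SE; move: (fine (wmeasure s (cube c l))) => S SE.
rewrite aE SE poweR_EFin -EFinM lee_fin in hK'.
rewrite aE -EFinM lee_fin in h3'.
rewrite SE !poweR_EFin -EFinD -!EFinM => hd.
have mh := measurable_hball x0 rho.
have hQ : hball x0 rho `<=` cube c l by exact: hball_outer.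
set f := local_norm F x0 rho.
have f0 : (0 <= f)%E by apply: integral_ge0 => y _; rewrite lee_fin mulr_ge0 ?powR_ge0// ltW.
have b0 := mm_ge0 bP.
set I := (\int[mu]_(y in hball x0 rho) (b x y * F y)%:E)%E.
have I0 : (0 <= I)%E by apply: integral_ge0 => y _; rewrite lee_fin mulr_ge0.
have mbq : measurable_fun setT (fun z => b x z `^ q).
  apply: (@measurableT_comp _ _ _ _ _ _ (fun t : R => t `^ q)).
    exact: measurable_powR.
  exact: (measurable_mm1 bP).
have mi (e : R) : measurable_fun setT (fun z => (b x z `^ q * depth c l z `^ e * s z)%:E).
  apply/measurable_EFinP; apply: measurable_funM => //.
  by apply: measurable_funM => //; exact: measurable_depth.
have mi0 : measurable_fun setT (fun z => (b x z `^ q * s z)%:E).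
  by apply/measurable_EFinP; exact: measurable_funM.
have hI : (I `^ p <= (C1 * (1 + u `^ p) * S `^ (p - 1))%:E * f)%E.
  apply: le_trans (@hoelder_weighted R _ _ mu p p1 w mw w0 (hball x0 rho) F (b x) mh
     _ _ _ _) _.
  - exact: measurable_funTS.
  - by apply: measurable_funTS; exact: (measurable_mm1 bP).
  - by move=> y _.
  - by move=> y _.
  apply: lee_wpmul2r => //; apply: le_trans hd.
  apply: gt0_ler_poweR; rewrite ?in_itv/= ?leey ?andbT ?(ltW p10)//.
  - by apply: integral_ge0 => z _; rewrite lee_fin !mulr_ge0 ?powR_ge0// ltW.
  - by apply: integral_ge0 => z _; rewrite lee_fin !mulr_ge0 ?powR_ge0// ltW.
  apply: (@le_trans _ _ (\int[mu]_(z in cube c l) (b x z `^ q * s z)%:E)%E).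
    apply: ge0_subset_integral => //; first exact: measurable_funTS.
    by move=> z _; rewrite lee_fin mulr_ge0 ?powR_ge0// ltW.
  apply: ge0_le_integral => //.
  - by move=> z _; rewrite lee_fin mulr_ge0 ?powR_ge0// ltW.
  - exact: measurable_funTS.
  - exact: measurable_funTS.
  move=> z Qz; rewrite lee_fin ler_wpM2r ?(ltW (s0 z))//.
  have z0 := depth_gt0 l0 Qz; have z1 := depth_le1 l0 Qz.
  rewrite ler_peMr ?powR_ge0// powRN invf_ge1 ?powR_gt0//.
  have : depth c l z `^ d <= 1 `^ d.
    by apply: ge0_ler_powR; rewrite ?nnegrE ?(ltW d0) ?(ltW z0).
  by rewrite powR1.
apply: (@ler_poweR_inv _ p) => //.
- by rewrite mule_ge0// lee_fin invr_ge0 exprn_ge0// ltW.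
- rewrite !mule_ge0 ?poweR_ge0 ?lee_fin ?invr_ge0 ?powR_ge0 ?exprn_ge0 ?addr_ge0//.
  by rewrite mulr_ge0 ?powR_ge0// mulr_ge0 ?exprn_ge0.
rewrite poweRM//; last by rewrite lee_fin invr_ge0 exprn_ge0// ltW.
rewrite [in leRHS]mule_gather.
rewrite -!EFinD -!EFinM poweRM ?poweR_ge0//; last first.
  by rewrite lee_fin !mulr_ge0 ?powR_ge0 ?invr_ge0 ?powR_ge0 ?exprn_ge0 ?addr_ge0.
rewrite -poweRrM mulVf ?gt_eqF// poweRe1// !poweR_EFin.
apply: (@le_trans _ _ (((t ^- N) `^ p)%:E * ((C1 * (1 + u `^ p) * S `^ (p - 1))%:E * f))%E).
  by apply: lee_wpmul2l => //; rewrite lee_fin powR_ge0.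
rewrite muleA -EFinM; apply: lee_wpmul2r => //; rewrite lee_fin.
have Sp0 : 0 <= S `^ (p - 1) by exact: powR_ge0.
(* From u <= v + k 2^N one gets 1 + u <= 2^N (k + 1) (1 + v), and 1 + u^p <= (2 (1 + u))^p since p >
   1. *)
have hu : 1 + u `^ p <= (2 * 2 ^+ N * (k.+1%:R * (1 + v))) `^ p.
  have N1 : 1 <= 2 ^+ N :> R by rewrite exprn_ege1// ler1n.
  have uv' : 1 + u <= 2 ^+ N * (k.+1%:R * (1 + v)).
    rewrite mulrSr; have k0 : 0 <= k%:R :> R by rewrite ler0n.
    set X := 2 ^+ N in N1 uv *.
    have : 0 <= X * k%:R * v by rewrite !mulr_ge0// (le_trans ler01).
    have : 0 <= (X - 1) * (1 + v) by rewrite mulr_ge0 ?subr_ge0 ?addr_ge0.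
    nra.
  apply: (@le_trans _ _ ((2 * (1 + u)) `^ p)); last first.
    apply: ge0_ler_powR; rewrite ?nnegrE ?(ltW p0)//.
    - by rewrite mulr_ge0 ?addr_ge0.
    - by rewrite !mulr_ge0 ?exprn_ge0 ?addr_ge0.
    by rewrite -mulrA ler_pM2l.
  rewrite powRM ?addr_ge0//.
  have e1 : 1 <= (1 + u) `^ p.
    have : 1 `^ p <= (1 + u) `^ p by apply: ge0_ler_powR; rewrite ?nnegrE ?(ltW p0) ?addr_ge0// lerDl.
    by rewrite powR1.
  have e2 : u `^ p <= (1 + u) `^ p by apply: ge0_ler_powR; rewrite ?nnegrE ?(ltW p0) ?addr_ge0// lerDr.
  have e3 : 2 <= 2 `^ p :> R by apply: (le_trans _ (ler_powR _ (ltW p1))); rewrite ?powRr1// ler1n.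
  nra.
have hS : (t ^- N) `^ p * S `^ (p - 1) <= C3 * K * (4 ^+ N) `^ p / om.
  rewrite ler_pdivlMr//.
  have a0' : 0 < a by rewrite -(pmulr_rgt0 _ C30); exact: lt_le_trans h3'.
  have e1 : (l ^+ N) `^ p = (4 ^+ N) `^ p * (t ^+ N) `^ p.
    by rewrite -powRM ?exprn_ge0 ?(ltW t0)// -exprMn /l rhoE mulrA -natrM.
  have e2 : (t ^- N) `^ p * (t ^+ N) `^ p = 1.
    rewrite -powRM ?invr_ge0 ?exprn_ge0 ?(ltW t0)// mulVf ?powR1//.
    by rewrite expf_neq0// gt_eqF.
  rewrite e1 in hK'.
  apply: (@le_trans _ _ ((t ^- N) `^ p * (C3 * (K * ((4 ^+ N) `^ p * (t ^+ N) `^ p))))).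
    rewrite -mulrA; apply: ler_wpM2l; first exact: powR_ge0.
    apply: (@le_trans _ _ (C3 * (a * S `^ (p - 1)))); last by rewrite ler_pM2l.
    by rewrite mulrC mulrA; exact: ler_wpM2r.
  rewrite (_ : _ * _ = (C3 * K * (4 ^+ N) `^ p) * ((t ^- N) `^ p * (t ^+ N) `^ p)); last by ring.
  by rewrite e2 mulr1.
have -> : (D `^ p^-1 * (2 * 2 ^+ N) * k.+1%:R * ((om `^ p^-1)^-1 * (1 + v))) `^ p =
  D / om * (2 * 2 ^+ N * (k.+1%:R * (1 + v))) `^ p.
  rewrite (_ : _ * _ * _ * _ = (D `^ p^-1 * (om `^ p^-1)^-1) * (2 * 2 ^+ N * (k.+1%:R * (1 + v)))); last by ring.
  rewrite powRM; last 2 first.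
  - by rewrite mulr_ge0 ?powR_ge0// invr_ge0 powR_ge0.
  - by rewrite !mulr_ge0 ?exprn_ge0 ?addr_ge0.
  congr (_ * _); rewrite powRM ?invr_ge0 ?powR_ge0// -powRN -!powRrM.
  by rewrite mulVf ?gt_eqF// mulNr mulVf ?gt_eqF// powRr1 ?(ltW D0)// powR_inv1// ltW.
apply: (@le_trans _ _ (C1 * (C3 * K * (4 ^+ N) `^ p / om) *
    (2 * 2 ^+ N * (k.+1%:R * (1 + v))) `^ p)); last first.
  by rewrite le_eqVlt; apply/orP; left; apply/eqP; rewrite /D !mulrA.
have -> : (t ^- N) `^ p * (C1 * (1 + u `^ p) * S `^ (p - 1)) =
    C1 * ((t ^- N) `^ p * S `^ (p - 1)) * (1 + u `^ p) by ring.
apply: ler_pM => //.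
- by rewrite !mulr_ge0 ?powR_ge0// ltW.
- by rewrite addr_ge0 ?powR_ge0.
- by rewrite ler_pM2l.
Qed.

End local_bound.

(** * The dominating operator *)

Section kernel_decomposition.
Context {R : realType} (n : nat).
Local Notation N := n.+1.
Local Notation V := 'rV[R]_N.
Local Notation mu := (lebesgue_rV N : {measure set V -> \bar R}).
Implicit Types (c x y z : V) (l r h rho : R) (A E U : set V) (b : V -> V -> R)
  (F : V -> R).
Local Notation "x `n" := ((x : V) ord0 ord_max) (at level 2, format "x `n").

Definition tau x y : R := enorm (x - y) + x `n + y `n.

Lemma tau_gt0 x y : halfspace x -> halfspace y -> 0 < tau x y.
Proof.
move=> x0 y0; rewrite /tau /halfspace/= in x0 y0 *; have := enorm_ge0 (x - y); lra.
Qed.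

(** The real power is nonnegative and measurable on all pairs of points, including those where [tau]
    is not positive; on the half-space it is tau^(-N). *)
Definition kap x y : R := tau x y `^ (- N%:R).

Lemma kapE x y : halfspace x -> halfspace y -> kap x y = tau x y ^- N.
Proof. by move=> x0 y0; rewrite /kap powR_invn// ltW// tau_gt0. Qed.

Lemma measurable_tau : measurable_fun setT (fun u : V * V => tau u.1 u.2).
Proof.
have m1 i : measurable_fun setT (fun u : V * V => u.1 ord0 i).
  exact: (measurableT_comp (measurable_coord i) measurable_fst).
have m2 i : measurable_fun setT (fun u : V * V => u.2 ord0 i).
  exact: (measurableT_comp (measurable_coord i) measurable_snd).
apply: measurable_funD => //; apply: measurable_funD => //.
apply: measurableT_comp; first exact: measurable_enorm.
apply: measurable_fun_rV => i; under eq_fun do rewrite !mxE.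
exact: measurable_funB.
Qed.

Lemma measurable_kap : measurable_fun setT (fun u : V * V => kap u.1 u.2).
Proof.
apply: (@measurableT_comp _ _ _ _ _ _ (fun t : R => t `^ (- N%:R))).
  exact: measurable_powR.
exact: measurable_tau.
Qed.

Lemma le_nneseries_term (u : nat -> R) k : (forall j, 0 <= u j) ->
  ((u k)%:E <= \sum_(0 <= j <oo) (u j)%:E)%E.
Proof.
move=> u0; apply: le_trans (nneseries_lim_ge k.+1 _); last by move=> *; rewrite lee_fin.
by rewrite big_nat_recr//= leeDr// sume_ge0// => i _; rewrite lee_fin.
Qed.

Let sum3_lt (e a c h : R) : 0 <= e -> 0 < a -> 0 < c -> e + a + c < h ->
  [/\ 0 < a < h, 0 < c < h & e < h].
Proof. by move=> *; split; [apply/andP; split; lra|apply/andP; split; lra|lra]. Qed.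

Let sum3_ge (e a c P xx yx r : R) : 0 < a -> 0 < c -> 2 * P <= yx -> yx <= e + xx ->
  xx < r -> r <= P -> 2 * P <= 2 * (e + a + c).
Proof. by move=> *; lra. Qed.

(** If tau < r, the dyadic h = r / 2^j with h / 2 <= tau < h relates x and y, and y stays in the
    half-ball of radius 2r, so the near part only sees F there. If tau >= r, the dyadic shell around
    x0 that contains y has radius comparable to at most tau. Either way a single term suffices, with
    the loss 2^N. *)
Lemma tau_le x0 r x y : 0 < r -> hball x0 r x -> halfspace y ->
  ((tau x y ^- N)%:E <= (2 ^+ N)%:E * (
    \sum_(0 <= j <oo) ((r / 2 ^+ j) ^- N *
       (\1_(rsec (r / 2 ^+ j) x) y * \1_(hball x0 (2 * r)) y))%:E +
    \sum_(0 <= k <oo) ((2 ^+ k * r) ^- N * \1_(hball x0 (2 ^+ k.+1 * r)) y)%:E))%E.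
Proof.
move=> r0 [xx0 x00] y0; have t0 := tau_gt0 x00 y0.
have n1 j : 0 <= (r / 2 ^+ j) ^- N *
       (\1_(rsec (r / 2 ^+ j) x) y * \1_(hball x0 (2 * r)) y) :> R.
  apply: mulr_ge0; last by rewrite !indicE mulr_ge0.
  by rewrite invr_ge0 exprn_ge0// divr_ge0 ?exprn_ge0// ltW.
have n2 k : 0 <= (2 ^+ k * r) ^- N * \1_(hball x0 (2 ^+ k.+1 * r)) y :> R.
  apply: mulr_ge0; last by rewrite indicE.
  by rewrite invr_ge0 exprn_ge0// mulr_ge0 ?exprn_ge0// ltW.
have s1 : (0 <= \sum_(0 <= j <oo) ((r / 2 ^+ j) ^- N *
       (\1_(rsec (r / 2 ^+ j) x) y * \1_(hball x0 (2 * r)) y))%:E)%E.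
  by apply: nneseries_ge0 => j _ _; rewrite lee_fin.
have s2 : (0 <= \sum_(0 <= k <oo) ((2 ^+ k * r) ^- N *
    \1_(hball x0 (2 ^+ k.+1 * r)) y)%:E)%E.
  by apply: nneseries_ge0 => j _ _; rewrite lee_fin.
have powN (a c : R) : 0 < c -> c <= 2 * a -> a ^- N <= 2 ^+ N * c ^- N.
  move=> c0 ca; have a0 : 0 < a by rewrite -(pmulr_rgt0 _ (ltr0Sn R 1)); exact: lt_le_trans ca.
  rewrite ler_pdivlMr ?exprn_gt0// mulrC ler_pdivrMr ?exprn_gt0//.
  rewrite -exprMn; apply: lerXn2r => //; rewrite nnegrE; first exact: ltW.
  by rewrite mulr_ge0// ltW.
have key : exists2 c : R, tau x y ^- N <= 2 ^+ N * c &
   (c%:E <= \sum_(0 <= j <oo) ((r / 2 ^+ j) ^- N *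
       (\1_(rsec (r / 2 ^+ j) x) y * \1_(hball x0 (2 * r)) y))%:E +
    \sum_(0 <= k <oo) ((2 ^+ k * r) ^- N * \1_(hball x0 (2 ^+ k.+1 * r)) y)%:E)%E.
  have [tr|rt] := ltP (tau x y) r.
    have ex : exists j : nat, r / 2 ^+ j.+1 <= tau x y.
      exists (Num.truncn (r / tau x y)).
      rewrite ler_pdivrMr ?exprn_gt0// mulrC -ler_pdivrMr//.
      apply: (le_trans (ltW (truncnS_gt _))).
      by rewrite -natrX ler_nat ltnW// ltn_expl.
    pose j := ex_minn ex; pose h := r / 2 ^+ j.
    have h0 : 0 < h by rewrite divr_gt0// exprn_gt0.
    have th : tau x y < h.
      rewrite /h /j; case: ex_minnP => -[|k]; first by rewrite expr0 divr1.
      by move=> _ mk; rewrite ltNge; apply/negP => /mk; rewrite ltnn.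
    have ht : h <= 2 * tau x y.
      have : r / 2 ^+ j.+1 <= tau x y by rewrite /j; case: ex_minnP.
      rewrite exprS invfM mulrCA -/h ler_pdivrMl//.
    have dxy i : `|x ord0 i - y ord0 i| <= enorm (x - y).
      by have := enorm_coord (x - y) i; rewrite !mxE.
    have e0 := enorm_ge0 (x - y).
    rewrite /tau in th.
    rewrite /halfspace/= in x00 y0.
    exists (h ^- N); first exact: powN.
    apply: (@le_trans _ _ ((r / 2 ^+ j) ^- N *
       (\1_(rsec (r / 2 ^+ j) x) y * \1_(hball x0 (2 * r)) y))%:E); last first.
      by apply: le_trans (leeDl _ s2); exact: (le_nneseries_term j n1).
    rewrite !indicE !mem_set ?mulr1//.
      split => //; rewrite /eball/=; apply: (le_lt_trans (enormB_triangle y x x0)).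
      rewrite (enormC y x) mulr_natl mulr2n ltrD//.
      by apply: le_lt_trans tr; rewrite /tau -addrA lerDl addr_ge0// ltW.
    have [s3 s4 s5] := sum3_lt e0 x00 y0 th.
    by split; [exact: s3|exact: s4|move=> i; exact: le_lt_trans (dxy i) s5].
  have ex : exists k : nat, enorm (y - x0) < 2 ^+ k.+1 * r.
    exists (Num.truncn (enorm (y - x0) / r)).
    rewrite -ltr_pdivrMr//; apply: (lt_le_trans (truncnS_gt _)).
    by rewrite -natrX ler_nat ltnW// ltn_expl.
  pose k := ex_minn ex.
  exists ((2 ^+ k * r) ^- N).
    apply: powN; first by rewrite mulr_gt0// exprn_gt0.
    (* For k = 0 this is r <= 2 tau. Otherwise |y - x0| >= 2^k r by minimality, and |x - x0| < r <=
       2^(k-1) r leaves |x - y| >= 2^(k-1) r. *)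
    rewrite /k; case: ex_minnP => -[|m] _ mk.
      by rewrite expr0 mul1r; lra.
    have h1 : 2 ^+ m.+1 * r <= enorm (y - x0).
      by rewrite leNgt; apply/negP => /mk; rewrite ltnn.
    have h2 := enormB_triangle y x x0; rewrite (enormC y x) in h2.
    have xr : enorm (x - x0) < r := xx0.
    have h3 : r <= 2 ^+ m * r by rewrite ler_peMl ?(ltW r0)// exprn_ege1// ler1n.
    rewrite exprS -mulrA in h1 *.
    exact: (sum3_ge x00 y0 h1 h2 xr h3).
  apply: le_trans (leeDr _ s1).
  apply: le_trans (le_nneseries_term k n2).
  rewrite indicE mem_set ?mulr1// /hball; split => //.
  by rewrite /eball/= /k; case: ex_minnP.
have [c h1 h2] := key.
apply: (@le_trans _ _ (2 ^+ N * c)%:E); first by rewrite lee_fin.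
by rewrite EFinM; apply: lee_wpmul2l => //; rewrite lee_fin exprn_ge0.
Qed.

Lemma kernel_decomposition b F x0 r x : mean_metric b -> measurable_fun setT F ->
  (forall y, 0 <= F y) -> 0 < r -> hball x0 r x ->
  (\int[mu]_(y in @halfspace R n) (kap x y * (b x y * F y))%:E <=
   (2 ^+ N)%:E * (near_op b (fun y => (F y * \1_(hball x0 (2 * r)) y)%R) r x +
     \sum_(0 <= k <oo) (((2 ^+ k * r) ^- N)%:E *
        \int[mu]_(y in hball x0 (2 ^+ k.+1 * r)) (b x y * F y)%:E)))%E.
Proof.
move=> bP mF F0 r0 xx0.
have b0 := mm_ge0 bP.
have mb := measurable_mm1 bP x.
have mH := @measurable_halfspace R n.
have mB k := @measurable_hball R n x0 k.
have mbF : measurable_fun setT (fun y => b x y * F y) by exact: measurable_funM.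
pose u j y := (r / 2 ^+ j) ^- N *
       (\1_(rsec (r / 2 ^+ j) x) y * \1_(hball x0 (2 * r)) y) * (b x y * F y).
pose v k y := (2 ^+ k * r) ^- N * \1_(hball x0 (2 ^+ k.+1 * r)) y * (b x y * F y).
have u0 j y : 0 <= u j y.
  rewrite !mulr_ge0// invr_ge0 exprn_ge0// divr_ge0 ?exprn_ge0//; exact: ltW.
have v0 k y : 0 <= v k y.
  rewrite !mulr_ge0// invr_ge0 exprn_ge0// mulr_ge0 ?exprn_ge0//; exact: ltW.
have mu' j : measurable_fun setT (u j).
  apply: measurable_funM => //; apply: measurable_funM => //.
  by apply: measurable_funM; apply: measurable_indic => //; exact: measurable_rsec.
have mv' k : measurable_fun setT (v k).
  by apply: measurable_funM => //; apply: measurable_funM => //; exact: measurable_indic.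
have mtau : measurable_fun setT (fun y : V => kap x y).
  exact: (measurable_fun_pair2 x measurable_kap).
have mser (f : nat -> V -> R) : (forall j y, 0 <= f j y) -> (forall j, measurable_fun setT (f j)) ->
    measurable_fun setT (fun y => \sum_(0 <= j <oo) (f j y)%:E)%E.
  move=> f0 mf; apply: ge0_emeasurable_sum => [k y _ _|k _]; first by rewrite lee_fin.
  exact/measurable_EFinP.
apply: (@le_trans _ _ (\int[mu]_(y in @halfspace R n) ((2 ^+ N)%:E *
   (\sum_(0 <= j <oo) (u j y)%:E + \sum_(0 <= k <oo) (v k y)%:E)))%E).
  apply: ge0_le_integral => //.
  - by move=> y y0; rewrite lee_fin mulr_ge0 ?powR_ge0// mulr_ge0.
  - by apply: measurable_funTS; apply/measurable_EFinP; exact: measurable_funM.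
  - apply: measurable_funTS; apply: measurable_funeM; apply: emeasurable_funD; exact: mser.
  move=> y y0.
  rewrite kapE//; last by case: xx0.
  have : ((tau x y ^- N)%:E * (b x y * F y)%:E <= (2 ^+ N)%:E * (
    \sum_(0 <= j <oo) ((r / 2 ^+ j) ^- N *
       (\1_(rsec (r / 2 ^+ j) x) y * \1_(hball x0 (2 * r)) y))%:E +
    \sum_(0 <= k <oo) ((2 ^+ k * r) ^- N * \1_(hball x0 (2 ^+ k.+1 * r)) y)%:E) * (b x y * F y)%:E)%E.
    by apply: lee_wpmul2r; [rewrite lee_fin mulr_ge0|exact: tau_le].
  rewrite -EFinM -muleA => /le_trans; apply.
  apply: lee_wpmul2l; first by rewrite lee_fin exprn_ge0.
  rewrite ge0_muleDl; last 2 first.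
  - apply: nneseries_ge0 => j _ _; rewrite lee_fin mulr_ge0 ?mulr_ge0// invr_ge0 exprn_ge0//.
    by rewrite divr_ge0 ?exprn_ge0// ltW.
  - apply: nneseries_ge0 => j _ _; rewrite lee_fin mulr_ge0// invr_ge0 exprn_ge0//.
    by rewrite mulr_ge0 ?exprn_ge0// ltW.
  apply: leeD; rewrite muleC -nneseriesZl.
  - apply: lee_nneseries => [j _ _|j _]; last by rewrite -EFinM mulrC.
    rewrite -EFinM lee_fin mulrC; exact: u0.
  - move=> j _; rewrite lee_fin mulr_ge0 ?mulr_ge0// invr_ge0 exprn_ge0//.
    by rewrite divr_ge0 ?exprn_ge0// ltW.
  - apply: lee_nneseries => [j _ _|j _]; last by rewrite -EFinM mulrC.
    rewrite -EFinM lee_fin mulrC; exact: v0.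
  - move=> j _; rewrite lee_fin mulr_ge0// invr_ge0 exprn_ge0//.
    by rewrite mulr_ge0 ?exprn_ge0// ltW.
have s0 (f : nat -> V -> R) y : (forall j y, 0 <= f j y) ->
    (0 <= \sum_(0 <= j <oo) (f j y)%:E)%E.
  by move=> f0; apply: nneseries_ge0 => j _ _; rewrite lee_fin.
have mU : measurable_fun (@halfspace R n) (fun y => \sum_(0 <= j <oo) (u j y)%:E)%E.
  by apply: measurable_funTS; exact: mser.
have mW : measurable_fun (@halfspace R n) (fun y => \sum_(0 <= j <oo) (v j y)%:E)%E.
  by apply: measurable_funTS; exact: mser.
rewrite ge0_integralZl; last 4 first.
- exact: mH.
- exact: emeasurable_funD.
- by move=> y _; rewrite adde_ge0// s0.
- by rewrite lee_fin exprn_ge0.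
apply: lee_wpmul2l; first by rewrite lee_fin exprn_ge0.
rewrite ge0_integralD; last 5 first.
- exact: mH.
- by move=> y _; exact: s0.
- exact: mU.
- by move=> y _; exact: s0.
- exact: mW.
have indE (A : set V) (f : V -> R) : (\int[mu]_y (\1_A y * f y)%:E = \int[mu]_(y in A) (f y)%:E)%E.
  rewrite [RHS]integral_mkcond; apply: eq_integral => y _.
  by rewrite patchE indicE; case: ifPn; rewrite ?mul1r ?mul0r.
apply: leeD.
  rewrite integral_nneseries//; last 2 first.
  - by move=> j; apply: measurable_funTS; exact/measurable_EFinP.
  - by move=> j y _; rewrite lee_fin.
  apply: lee_nneseries => [j _ _|j _].
    by apply: integral_ge0 => y _; rewrite lee_fin.
  apply: (@le_trans _ _ (\int[mu]_y (u j y)%:E)%E).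
    apply: ge0_subset_integral => //; first exact/measurable_EFinP.
    by move=> y _; rewrite lee_fin.
  rewrite -(indE (rsec _ _)) -ge0_integralZl//; last 3 first.
  - apply/measurable_EFinP; apply: measurable_funM.
      by apply: measurable_indic; exact: measurable_rsec.
    by apply: measurable_funM => //; apply: measurable_funM => //; exact: measurable_indic.
  - by move=> y _; rewrite lee_fin !mulr_ge0.
  - by rewrite lee_fin invr_ge0 exprn_ge0// divr_ge0 ?exprn_ge0// ltW.
  rewrite le_eqVlt; apply/orP; left; apply/eqP; apply: eq_integral => y _.
  by rewrite -EFinM /u; congr EFin; move: (_ ^- N) => A; ring.
rewrite integral_nneseries//; last 2 first.
- by move=> j; apply: measurable_funTS; exact/measurable_EFinP.
- by move=> j y _; rewrite lee_fin.
apply: lee_nneseries => [j _ _|j _].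
  by apply: integral_ge0 => y _; rewrite lee_fin.
apply: (@le_trans _ _ (\int[mu]_y (v j y)%:E)%E).
  apply: ge0_subset_integral => //; first exact/measurable_EFinP.
  by move=> y _; rewrite lee_fin.
rewrite -(indE (hball _ _)) -ge0_integralZl//; last 3 first.
- by apply/measurable_EFinP; apply: measurable_funM => //; exact: measurable_indic.
- by move=> y _; rewrite lee_fin !mulr_ge0.
- by rewrite lee_fin invr_ge0 exprn_ge0// mulr_ge0 ?exprn_ge0// ltW.
rewrite le_eqVlt; apply/orP; left; apply/eqP; apply: eq_integral => y _.
by rewrite -EFinM /v; congr EFin; rewrite -!mulrA.
Qed.

End kernel_decomposition.

Section local_bound.
Context {R : realType} (n : nat).
Local Notation N := n.+1.
Local Notation V := 'rV[R]_N.
Local Notation mu := (lebesgue_rV N : {measure set V -> \bar R}).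
Implicit Types (c x y z : V) (l r h rho : R) (A E U : set V) (b : V -> V -> R)
  (F : V -> R).
Local Notation "x `n" := ((x : V) ord0 ord_max) (at level 2, format "x `n").

Lemma poweR_add_le (p : R) (a b : \bar R) : 0 < p -> (0 <= a)%E -> (0 <= b)%E ->
  ((a + b) `^ p <= (2 `^ p)%:E * (a `^ p + b `^ p))%E.
Proof.
move=> p0 a0 b0.
have h : (a + b <= 2%:E * maxe a b)%E.
  have -> : (2%:E * maxe a b = maxe a b + maxe a b)%E.
    by rewrite (natrD _ 1 1) EFinD ge0_muleDl ?lee_fin// mul1e.
  by apply: leeD; rewrite le_max lexx ?orbT.
have m0 : (0 <= maxe a b)%E by rewrite le_max a0.
apply: (@le_trans _ _ ((2%:E * maxe a b) `^ p)%E).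
  apply: gt0_ler_poweR; rewrite ?in_itv/= ?leey ?andbT ?(ltW p0) ?adde_ge0//.
  by rewrite mule_ge0// lee_fin.
rewrite poweRM ?lee_fin// poweR_EFin; apply: lee_wpmul2l; first by rewrite lee_fin powR_ge0.
by case: (leP a b) => _; [rewrite leeDr|rewrite leeDl]; rewrite ?poweR_ge0.
Qed.

Variables (p : R) (p1 : 1 < p) (w : V -> R) (wP : Ap_weight p w).
Let p0 : 0 < p. Proof. by rewrite (lt_trans ltr01). Qed.
Let w0 := Ap_gt0 wP.
Let mw := Ap_measurable wP.

(* The factor k.+1 is the growth of the means of b over dyadic dilates of a cube;
   it is absorbed by the logarithm in the condition on phi. *)
Definition tail_sum F x r : \bar R :=
  (\sum_(0 <= k <oo) (k.+1%:R%:E * (local_norm p w F x (2 ^+ k.+1 * r) `^ p^-1 *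
     (wmeasure w (eball x (2 ^+ k.+2 * r)) `^ p^-1)^-1)))%E.

Definition major_op b F x : \bar R :=
  (\int[mu]_(y in @halfspace R n) (kap x y * (b x y * F y))%:E)%E.

Lemma measurable_major_op b F : mean_metric b -> measurable_fun setT F ->
  (forall y, 0 <= F y) -> measurable_fun setT (major_op b F).
Proof.
move=> bP mF F0.
rewrite (_ : major_op b F = fubini_F (lebesgue_rV N)
  (fun u : V * V => (kap u.1 u.2 * (b u.1 u.2 * F u.2) * \1_(@halfspace R n) u.2)%:E)); last first.
  apply/funext => x; rewrite /fubini_F /major_op [LHS]integral_mkcond.
  apply: eq_integral => y _; rewrite patchE indicE.
  by case: ifPn => _ /=; rewrite ?mulr1 ?mulr0.
apply: measurable_fun_fubini_tonelli_F.
  apply/measurable_EFinP; apply: measurable_funM.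
    apply: measurable_funM; first exact: measurable_kap.
    apply: measurable_funM; first exact: (mm_measurable bP).
    exact: (measurableT_comp mF measurable_snd).
  apply: measurableT_comp measurable_snd; apply: measurable_indic.
  exact: measurable_halfspace.
by move=> u; rewrite lee_fin !mulr_ge0 ?powR_ge0 ?(mm_ge0 bP).
Qed.

Let mule_shuffle (a c d e s t : \bar R) :
  (a * s * (c * (d * (e * t))) = a * (c * (d * e)) * (s * t))%E.
Proof. by rewrite -!muleA; congr (_ * _)%E; rewrite !(muleCA s). Qed.

(** The near part is the global bound applied to F cut off at radius 2r. In the far part the sum
    over k no longer depends on x, apart from the factor 1 plus the mean over a fixed cube, and the
    p-th power of that factor is integrated against w by [weight_integral]. *)
Lemma local_bound : exists2 C : R, 0 < C & forall b F x0 r, mean_metric b ->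
  measurable_fun setT F -> (forall y, 0 <= F y) -> 0 < x0 `n -> 0 < r ->
  (\int[mu]_(x in hball x0 r) (major_op b F x `^ p * (w x)%:E) <=
   C%:E * (tail_sum F x0 r `^ p * wmeasure w (hball x0 r)))%E.
Proof.
have [Cn Cn0 hn] := near_bound p1 wP.
have [Cf Cf0 hf] := far_term p1 wP.
have [C4 C40 h4] := wmeasure_hball p1 wP.
have [d d0 H5] := weight_integral (Ap_good_weight p1 wP).
have [C5 C50 h5] := H5 p p0.
pose K : R := (2 ^+ N) `^ p * 2 `^ p.
have K0 : 0 < K by rewrite mulr_gt0// powR_gt0// exprn_gt0.
exists (K * (Cn * C4 + (Cf `^ p) * (2 `^ p * (C5 * C4)))).
  by rewrite mulr_gt0// addr_gt0// !mulr_gt0// powR_gt0.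
move=> b F x0 r bP mF F0 x00 r0.
have r20 : 0 < 2 * r by rewrite mulr_gt0.
have l0 : 0 < 2 * (2 * r) by rewrite mulr_gt0.
have mB := measurable_hball x0 r.
have mB2 := measurable_hball x0 (2 * r).
set F1 := fun y => F y * \1_(hball x0 (2 * r)) y.
have mF1 : measurable_fun setT F1.
  by apply: measurable_funM => //; exact: measurable_indic.
have F10 y : 0 <= F1 y by rewrite mulr_ge0// indicE.
set S := tail_sum F x0 r.
pose c := outer_corner x0 (2 * r); pose l := 2 * (2 * r).
have ac : adm c by exact: adm_outer.
pose u x := avg b c l x.
have u0 x : (0 <= u x)%E by exact: avg_ge0.
have t0 k : (0 <= k.+1%:R%:E * (local_norm p w F x0 (2 ^+ k.+1 * r) `^ p^-1 *
     (wmeasure w (eball x0 (2 ^+ k.+2 * r)) `^ p^-1)^-1))%E.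
  rewrite mule_ge0 ?lee_fin// mule_ge0 ?poweR_ge0//.
  by rewrite inve_ge0 poweR_ge0.
have S0 : (0 <= S)%E by apply: nneseries_ge0 => k _ _; exact: t0.
pose W := wmeasure w (hball x0 r).
have W0 : (0 <= W)%E by exact: wmeasure_ge0.
have near0 x : (0 <= near_op b F1 r x)%E.
  apply: nneseries_ge0 => k _ _; rewrite mule_ge0 ?lee_fin ?invr_ge0 ?exprn_ge0 ?divr_ge0 ?exprn_ge0 ?(ltW r0)//.
  by apply: integral_ge0 => y _; rewrite lee_fin mulr_ge0// (mm_ge0 bP).
have far x : (\sum_(0 <= k <oo) (((2 ^+ k * r) ^- N)%:E *
        \int[mu]_(y in hball x0 (2 ^+ k.+1 * r)) (b x y * F y)%:E) <=
     Cf%:E * S * (1 + u x))%E.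
  have u1 : (0 <= 1 + u x)%E by rewrite adde_ge0.
  have uE : (1 + u x)%E = (fine (1 + u x))%:E.
    rewrite fineK// ge0_fin_numE// lte_add_pinfty ?ltry//.
    exact: avg_lty.
  rewrite uE -muleA (muleC S) muleA -EFinM -nneseriesZl; last by move=> k _; exact: t0.
  apply: lee_nneseries => [k _ _|k _].
    rewrite mule_ge0 ?lee_fin ?invr_ge0 ?exprn_ge0 ?mulr_ge0 ?exprn_ge0 ?(ltW r0)//.
    by apply: integral_ge0 => y _; rewrite lee_fin mulr_ge0// (mm_ge0 bP).
  apply: le_trans (hf b F x0 r k x bP mF F0 x00 r0) _.
  by rewrite -/c -/l -/(u x) uE EFinM -muleA (muleC _ (fine _)%:E) muleA.
have pw x : hball x0 r x -> (major_op b F x `^ p <=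
    K%:E * (near_op b F1 r x `^ p + (Cf%:E * S * (1 + u x)) `^ p))%E.
  move=> xx0.
  have u1 : (0 <= Cf%:E * S * (1 + u x))%E.
    by rewrite mule_ge0 ?adde_ge0// mule_ge0// lee_fin ltW.
  apply: (@le_trans _ _ (((2 ^+ N)%:E * (near_op b F1 r x + Cf%:E * S * (1 + u x))) `^ p)%E).
    apply: gt0_ler_poweR; rewrite ?in_itv/= ?leey ?andbT ?(ltW p0)//.
    - apply: integral_ge0 => y _.
      by rewrite lee_fin !mulr_ge0 ?powR_ge0 ?(mm_ge0 bP).
    - by rewrite mule_ge0 ?lee_fin ?exprn_ge0// adde_ge0.
    apply: le_trans (kernel_decomposition bP mF F0 r0 xx0) _.
    by apply: lee_wpmul2l; [rewrite lee_fin exprn_ge0|exact: leeD].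
  rewrite poweRM ?lee_fin ?exprn_ge0 ?adde_ge0// poweR_EFin /K EFinM -[leRHS]muleA.
  by apply: lee_wpmul2l; [rewrite lee_fin powR_ge0|exact: poweR_add_le].
have mnear : measurable_fun setT (fun x => near_op b F1 r x `^ p)%E.
  apply: (@measurableT_comp _ _ _ _ _ _ (fun t : \bar R => (t `^ p)%E)).
    exact: measurable_poweR.
  exact: measurable_near_op.
have mu' : measurable_fun setT u by exact: measurable_avg.
have mfar : measurable_fun setT (fun x => (Cf%:E * S * (1 + u x)) `^ p)%E.
  apply: (@measurableT_comp _ _ _ _ _ _ (fun t : \bar R => (t `^ p)%E)).
    exact: measurable_poweR.
  by apply: measurable_funeM; exact: emeasurable_funD.
have mwE : measurable_fun setT (fun x => (w x)%:E) by exact/measurable_EFinP.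
have wE0 x : (0 <= (w x)%:E)%E by rewrite lee_fin ltW.
(* The near norm is absorbed into the tail sum: it occurs in the term k = 0, and doubling replaces
   the ball of radius 4r there by the half-ball of radius r. *)
have hS0 : (local_norm p w F x0 (2 * r) <= S `^ p * (C4%:E * W))%E.
  have [om om0 omE] := wmeasure_eball p1 wP x00 l0.
  set f := local_norm p w F x0 (2 * r).
  have f0 : (0 <= f)%E by apply: integral_ge0 => y _; rewrite lee_fin mulr_ge0 ?powR_ge0// ltW.
  have h1 : (f `^ p^-1 * (om `^ (- p^-1))%:E <= S)%E.
    have : (1%:R%:E * (f `^ p^-1 * (wmeasure w (eball x0 (2 * (2 * r))) `^ p^-1)^-1) <= S)%E.
      apply: le_trans (nneseries_lim_ge 1 _); last by move=> k _ _; exact: t0.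
      by rewrite big_nat1 /= expr1 !exprS expr0 mulr1 mulrA.
    by rewrite mul1e omE poweR_EFin inver gt_eqF ?powR_gt0// powRN.
  have h2 : (om%:E <= C4%:E * W)%E.
    apply: le_trans (h4 x0 r x00 r0); rewrite -omE; apply: wmeasure_le => //.
      exact: measurable_eball.
    exact: eball_big.
  apply: (@le_trans _ _ (S `^ p * om%:E)%E); last first.
    by apply: lee_wpmul2l => //; exact: poweR_ge0.
  have -> : f = ((f `^ p^-1 * (om `^ (- p^-1))%:E) `^ p * om%:E)%E.
    rewrite poweRM ?poweR_ge0 ?lee_fin ?powR_ge0// -poweRrM mulVf ?gt_eqF// poweRe1//.
    rewrite poweR_EFin -powRrM mulNr mulVf ?gt_eqF// powR_inv1 ?(ltW om0)//.
    by rewrite -muleA -EFinM mulVf ?gt_eqF// mule1.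
  apply: lee_wpmul2r; first by rewrite lee_fin ltW.
  apply: gt0_ler_poweR; rewrite ?in_itv/= ?leey ?andbT ?(ltW p0)//.
  by rewrite mule_ge0 ?poweR_ge0// lee_fin powR_ge0.
have hnear : (\int[mu]_(x in hball x0 r) (near_op b F1 r x `^ p * (w x)%:E) <=
    Cn%:E * (S `^ p * (C4%:E * W)))%E.
  apply: (@le_trans _ _ (\int[mu]_x (near_op b F1 r x `^ p * (w x)%:E))%E).
    apply: ge0_subset_integral => //; first exact: emeasurable_funM.
    by move=> x _; rewrite mule_ge0// poweR_ge0.
  apply: (le_trans (hn b F1 r bP mF1 F10 r0)).
  apply: lee_wpmul2l; first by rewrite lee_fin ltW.
  apply: le_trans hS0; rewrite /local_norm [leRHS]integral_mkcond.
  rewrite le_eqVlt; apply/orP; left; apply/eqP; apply: eq_integral => y _.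
  rewrite patchE /F1 indicE; case: ifPn => _; first by rewrite mulr1.
  by rewrite mulr0 powR0 ?gt_eqF// mul0r.
have hfar : (\int[mu]_(x in hball x0 r) ((Cf%:E * S * (1 + u x)) `^ p * (w x)%:E) <=
    (Cf `^ p)%:E * S `^ p * ((2 `^ p)%:E * (C5%:E * (C4%:E * W))))%E.
  have I0 x : (0 <= (1 + u x `^ p) * (w x)%:E)%E.
    by rewrite mule_ge0// adde_ge0// poweR_ge0.
  have mup : measurable_fun setT (fun x => u x `^ p)%E.
    apply: (@measurableT_comp _ _ _ _ _ _ (fun t : \bar R => (t `^ p)%E)) => //.
    exact: measurable_poweR.
  have mI : measurable_fun setT (fun x => (1 + u x `^ p) * (w x)%:E)%E.
    by apply: emeasurable_funM => //; exact: emeasurable_funD.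
  have e0 : (0 <= (Cf `^ p)%:E * S `^ p * (2 `^ p)%:E)%E.
    by rewrite !mule_ge0 ?lee_fin ?powR_ge0 ?poweR_ge0.
  apply: (@le_trans _ _ (\int[mu]_(x in hball x0 r)
     (((Cf `^ p)%:E * S `^ p * (2 `^ p)%:E) * ((1 + u x `^ p) * (w x)%:E)))%E).
    apply: ge0_le_integral => //.
    - by move=> x _; rewrite mule_ge0// poweR_ge0.
    - by apply: measurable_funTS; exact: emeasurable_funM.
    - by apply: measurable_funTS; exact: measurable_funeM.
    move=> x _; rewrite muleA; apply: lee_wpmul2r => //.
    rewrite poweRM ?adde_ge0//; last by rewrite mule_ge0// lee_fin ltW.
    rewrite poweRM ?lee_fin ?(ltW Cf0)// poweR_EFin -muleA -[leRHS]muleA.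
    rewrite -[leRHS]muleA.
    apply: lee_wpmul2l; first by rewrite lee_fin powR_ge0.
    apply: lee_wpmul2l; first exact: poweR_ge0.
    apply: le_trans (poweR_add_le _ _ _) _ => //.
    by rewrite poweR_EFin powR1.
  rewrite ge0_integralZl//; last exact: measurable_funTS.
  rewrite -[leLHS]muleA; apply: lee_wpmul2l.
    by rewrite mule_ge0 ?poweR_ge0// lee_fin powR_ge0.
  apply: lee_wpmul2l; first by rewrite lee_fin powR_ge0.
  have BQ : hball x0 r `<=` cube c l.
    move=> y [xy y0]; apply: hball_outer => //; split => //.
    by apply: lt_le_trans xy _; rewrite ler_peMl ?(ltW r0)// ler1n.
  apply: (@le_trans _ _ (\int[mu]_(x in cube c l) ((1 + u x `^ p) * (w x)%:E))%E).
    by apply: ge0_subset_integral => //; exact: measurable_funTS.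
  apply: (@le_trans _ _ (C5%:E * wmeasure w (cube c l))%E).
    apply: le_trans (h5 b c l bP l0 ac).
    apply: ge0_le_integral => //.
    - exact: measurable_funTS.
    - apply: measurable_funTS; apply: emeasurable_funM => //.
      apply: emeasurable_funM; first exact: emeasurable_funD.
      by apply/measurable_EFinP; exact: measurable_depth.
    move=> x Qx; apply: lee_wpmul2r => //.
    rewrite -[leLHS]mule1; apply: lee_wpmul2l; first by rewrite adde_ge0// poweR_ge0.
    have z0 := depth_gt0 l0 Qx; have z1 := depth_le1 l0 Qx.
    rewrite lee_fin powRN invf_ge1 ?powR_gt0//.
    have : depth c l x `^ d <= 1 `^ d.
      by apply: ge0_ler_powR; rewrite ?nnegrE ?(ltW d0) ?(ltW z0).
    by rewrite powR1.
  apply: lee_wpmul2l; first by rewrite lee_fin ltW.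
  apply: le_trans (h4 x0 r x00 r0); apply: wmeasure_le => //.
  exact: outer_big.
apply: (@le_trans _ _ (\int[mu]_(x in hball x0 r) (K%:E *
   (near_op b F1 r x `^ p * (w x)%:E + (Cf%:E * S * (1 + u x)) `^ p * (w x)%:E)))%E).
  apply: ge0_le_integral => //.
  - by move=> x _; rewrite mule_ge0// poweR_ge0.
  - apply: measurable_funTS; apply: emeasurable_funM => //.
    apply: (@measurableT_comp _ _ _ _ _ _ (fun t : \bar R => (t `^ p)%E)).
      exact: measurable_poweR.
    exact: measurable_major_op.
  - apply: measurable_funTS; apply: measurable_funeM.
    by apply: emeasurable_funD; exact: emeasurable_funM.
  move=> x xx0; rewrite -ge0_muleDl ?poweR_ge0// muleA.
  by apply: lee_wpmul2r => //; exact: pw.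
have m1 : measurable_fun (hball x0 r) (fun x => near_op b F1 r x `^ p * (w x)%:E)%E.
  by apply: measurable_funTS; exact: emeasurable_funM.
have m2 : measurable_fun (hball x0 r) (fun x => (Cf%:E * S * (1 + u x)) `^ p * (w x)%:E)%E.
  by apply: measurable_funTS; exact: emeasurable_funM.
have n1 x : (0 <= near_op b F1 r x `^ p * (w x)%:E)%E by rewrite mule_ge0// poweR_ge0.
have n2 x : (0 <= (Cf%:E * S * (1 + u x)) `^ p * (w x)%:E)%E by rewrite mule_ge0// poweR_ge0.
rewrite ge0_integralZl//; last 3 first.
- exact: emeasurable_funD.
- by move=> x _; rewrite adde_ge0.
- by rewrite lee_fin ltW.
rewrite ge0_integralD// (EFinM K) -[leRHS]muleA.
apply: lee_wpmul2l; first by rewrite lee_fin ltW.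
apply: (le_trans (leeD hnear hfar)); rewrite -/W.
have P0 : (0 <= S `^ p * W)%E by rewrite mule_ge0// poweR_ge0.
rewrite EFinD ge0_muleDl; last 2 first.
- by rewrite lee_fin mulr_ge0// ltW.
- by rewrite lee_fin !mulr_ge0 ?powR_ge0// ltW.
apply: leeD; rewrite le_eqVlt; apply/orP; left; apply/eqP.
  by rewrite (EFinM Cn) -muleA; congr (_ * _)%E; exact: muleCA.
rewrite (EFinM (Cf `^ p)) (EFinM (2 `^ p)) (EFinM C5); exact: mule_shuffle.
Qed.

End local_bound.

(** * The condition on phi *)

Section nonmeasurable_integrals.
Import HBNNSimple.
Local Open Scope ereal_scope.
Context d (T : measurableType d) {R : realType} (mu : {measure set T -> \bar R}).
Implicit Types (D : set T) (f g : T -> \bar R).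

(* No measurability is assumed: the integral of a nonnegative function is a
   supremum over the simple functions below it. *)
Lemma le_integral_ge0 D f g : (forall x, D x -> 0 <= f x) ->
  (forall x, D x -> f x <= g x) -> \int[mu]_(x in D) f x <= \int[mu]_(x in D) g x.
Proof.
move=> f0 fg; rewrite !ge0_integralE//; last first.
  by move=> x Dx; exact: le_trans (f0 _ Dx) (fg _ Dx).
apply: le_ereal_sup => _ [h /= hf <-]; exists h => //= x.
apply: le_trans (hf x) _; rewrite !patchE; case: ifPn => //.
by rewrite inE; exact: fg.
Qed.

(** A simple function below f, set to 0 on the exceptional null set, lies below g and has the same
    integral. *)
Lemma ae_le_integral_ge0 D f g : (forall x, D x -> 0 <= f x) ->
  (forall x, D x -> 0 <= g x) -> {ae mu, forall x, D x -> f x <= g x} ->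
  \int[mu]_(x in D) f x <= \int[mu]_(x in D) g x.
Proof.
move=> f0 g0 [U [mU U0 fgU]].
rewrite (ge0_integralE _ f0); apply: ge_ereal_sup => _ [h /= hf <-].
have -> : sintegral mu h = \int[mu]_(x in setT) (h x)%:E.
  by rewrite integral_nnsfun// patch_setT.
have mh : measurable_fun setT (fun x => (h x)%:E) by exact/measurable_EFinP.
rewrite (ge0_negligible_integral mU measurableT mh)//; last first.
  by move=> x _; rewrite lee_fin.
rewrite (integral_mkcond D) integral_mkcond setTD; apply: le_integral_ge0 => x _.
  by rewrite patchE; case: ifPn => // _; rewrite lee_fin.
rewrite patchE; case: ifPn => [xU|_]; last first.
  by rewrite patchE; case: ifPn => //; rewrite inE; exact: g0.
have := hf x; rewrite !patchE; case: ifPn => // /set_mem Dx /le_trans; apply.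
by apply: contrapT => nfg; move/set_mem : xU; apply; apply: fgU => /(_ Dx).
Qed.

Lemma ae_eq_integral_ge0 D f g : (forall x, D x -> 0 <= f x) ->
  (forall x, D x -> 0 <= g x) -> {ae mu, forall x, D x -> f x = g x} ->
  \int[mu]_(x in D) f x = \int[mu]_(x in D) g x.
Proof.
move=> f0 g0 fg; apply/eqP; rewrite eq_le; apply/andP; split;
  by apply: ae_le_integral_ge0 => //; apply: filterS fg => x + Dx => ->.
Qed.

Lemma ae_eq_integral_gen D f g : {ae mu, forall x, D x -> f x = g x} ->
  \int[mu]_(x in D) f x = \int[mu]_(x in D) g x.
Proof.
move=> fg; rewrite integralE [RHS]integralE; congr (_ - _);
  apply: ae_eq_integral_ge0 => //; apply: filterS fg => x + Dx => /(_ Dx) fgx.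
  by rewrite !funeposE fgx.
by rewrite !funenegE fgx.
Qed.

End nonmeasurable_integrals.

(** The k-th interval has length 2^(k+1) r, half of the denominator 2^(k+2) r in the lower bound for
    h, so it contributes at least T_k / 2 to the integral. *)
Lemma dyadic_tail {R : realType} (r : R) (T : nat -> \bar R) (h : R -> \bar R) : 0 < r ->
  (forall k, 0 <= T k)%E -> (forall t, r < t -> (0 <= h t)%E) ->
  (forall k t, 2 ^+ k.+1 * r < t < 2 ^+ k.+2 * r ->
    ((2 ^+ k.+2 * r)^-1%:E * T k <= h t)%E) ->
  (\sum_(0 <= k <oo) T k <=
    2%:E * \int[lebesgue_measure]_(t in `]r, +oo[) h t)%E.
Proof.
move=> r0 T0 h0 hT.
have e0 k : 0 < 2 ^+ k * r by rewrite mulr_gt0// exprn_gt0.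
pose I k : set (measurableTypeR R) := `]2 ^+ k.+1 * r, 2 ^+ k.+2 * r[%classic.
have mI k : measurable (I k) by exact: measurable_itv.
pose c k := ((2 ^+ k.+2 * r)^-1%:E * T k)%E.
have c0 k : (0 <= c k)%E by rewrite mule_ge0// lee_fin invr_ge0 ltW.
pose f k := cst (c k) \_ (I k).
have f0 k t : (0 <= f k t)%E.
  by rewrite /f patchE; case: ifPn => // _; exact: c0.
have muI k : lebesgue_measure (I k) = (2 ^+ k.+1 * r)%:E.
  rewrite (lebesgue_measure_itv `]2 ^+ k.+1 * r, 2 ^+ k.+2 * r[)/= lte_fin.
  by rewrite ltr_pM2r// ltr_eXn2l ?ltr1n// ltnSn -EFinD (exprS _ k.+1); congr EFin; ring.
have intf k : (2%:E * \int[lebesgue_measure]_t f k t = T k)%E.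
  transitivity (2%:E * (c k * lebesgue_measure (I k)))%E.
    by rewrite /f -integral_mkcond (integral_cst (lebesgue_measure) (mI k)).
  rewrite muI /c.
  rewrite -muleA (muleC (T k)) !muleA -!EFinM [X in X%:E](_ : _ = 1) ?mul1e//.
  rewrite (exprS _ k.+1); field; rewrite gt_eqF ?exprn_gt0//= gt_eqF//.
have -> : (\sum_(0 <= k <oo) T k =
    2%:E * \int[lebesgue_measure]_t (\sum_(0 <= k <oo) f k t))%E.
  rewrite integral_nneseries//.
    rewrite -nneseriesZl; last by move=> k _; apply: integral_ge0.
    by apply: eq_eseriesr => k _; rewrite intf.
  by move=> k; apply/(measurable_restrictT _ (mI k)); exact: measurable_cst.
apply: lee_wpmul2l => //; rewrite [leRHS]integral_mkcond; apply: le_integral_ge0 => t _.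
  by apply: nneseries_ge0 => k _ _.
have [[k Ik]|nI] := pselect (exists k, I k t).
  rewrite (@nneseriesD1 _ _ k)// eseries0 ?adde0.
    rewrite /f !patchE mem_set//=; move: (Ik); rewrite /I /= in_itv/= => tk.
    rewrite mem_set; last first.
      rewrite /= in_itv/= andbT; case/andP: tk => tk _; apply: le_lt_trans tk.
      by rewrite ler_peMl ?(ltW r0)// exprn_ege1// ler1n.
    exact: hT.
  move=> i _ ik; rewrite /f patchE memNset// => Ii; move: ik Ik Ii.
  rewrite /I /= !in_itv/= neq_ltn => /orP[] ik /andP[k1 k2] /andP[i1 i2].
    have := lt_trans k1 i2; rewrite ltr_pM2r// ltNge ler_weXn2l ?ler1n//.
  have := lt_trans i1 k2; rewrite ltr_pM2r// ltNge ler_weXn2l ?ler1n//.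
rewrite eseries0; last first.
  by move=> i _ _; rewrite /f patchE memNset// => Ii; apply: nI; exists i.
by rewrite patchE; case: ifPn => //; rewrite inE/= in_itv/= andbT; exact: h0.
Qed.

Section phi_condition.
Context {R : realType} (n : nat).
Local Notation N := n.+1.
Local Notation V := 'rV[R]_N.
Local Notation mu := (lebesgue_rV N : {measure set V -> \bar R}).
Implicit Types (x y : V) (r t : R) (F : V -> R).
Local Notation "x `n" := ((x : V) ord0 ord_max) (at level 2, format "x `n").
Variables (p : R) (p1 : 1 < p) (w : V -> R) (wP : Ap_weight p w).
Variable phi : V -> R -> R.
Hypothesis phi_gt0 : forall x r, 0 < r -> 0 < phi x r.
Let p0 : 0 < p. Proof. by rewrite (lt_trans ltr01). Qed.
Let w0 := Ap_gt0 wP.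
Let mw := Ap_measurable wP.
Let pV0 : 0 < p^-1. Proof. by rewrite invr_gt0. Qed.

Let poweR_mono (a b : \bar R) : (0 <= a)%E -> (a <= b)%E -> (a `^ p^-1 <= b `^ p^-1)%E.
Proof.
move=> a0 ab; apply: gt0_ler_poweR; rewrite ?in_itv/= ?leey ?andbT ?(ltW pV0)//.
exact: le_trans ab.
Qed.

Lemma wmeasure_hball_eball x s : 0 < x `n -> 0 < s ->
  (wmeasure w (hball x s) <= wmeasure w (eball x s))%E.
Proof.
move=> x0 s0; apply: wmeasure_le => //; [exact: measurable_hball|exact: measurable_eball|].
by move=> y [].
Qed.

Lemma wmeasure_hball_fin x s : 0 < x `n -> 0 < s ->
  exists2 c : R, 0 < c & wmeasure w (hball x s) = c%:E.
Proof.
move=> x0 s0.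
have [a a0 aE] := wmeasure_eball p1 wP x0 s0.
have [C C0 hC] := wmeasure_hball p1 wP.
have Wgt : (0 < wmeasure w (hball x s))%E.
  rewrite -(@pmule_rgt0 _ C%:E)//; apply: lt_le_trans (hC _ _ x0 s0).
  by apply: (wmeasure_cube_gt0 p1 wP); rewrite !mulr_gt0.
have [c cE] : exists c : R, wmeasure w (hball x s) = c%:E.
  exists (fine (wmeasure w (hball x s))); rewrite fineK// ge0_fin_numE ?(ltW Wgt)//.
  by apply: le_lt_trans (wmeasure_hball_eball x0 s0) _; rewrite aE ltry.
by exists c => //; rewrite -lte_fin -cE.
Qed.

Let normalized_le (q m c : R) (L : \bar R) : 0 < q -> 0 < c -> (0 <= L)%E ->
  (q^-1%:E * ((c%:E)^-1 * L) `^ p^-1 <= m%:E)%E ->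
  (L `^ p^-1 <= c%:E `^ p^-1 * (q * m)%:E)%E.
Proof.
move=> q0 c0 L0; rewrite lee_pdivrMl// inver gt_eqF// => h.
have -> : L = (c%:E * (c^-1%:E * L))%E by rewrite muleA -EFinM divff ?gt_eqF// mul1e.
rewrite poweRM ?mule_ge0 ?lee_fin ?invr_ge0 ?(ltW c0)//.
by apply: lee_wpmul2l; rewrite ?poweR_ge0// EFinM.
Qed.

Let W x t : \bar R := (wmeasure w (eball x t) `^ p^-1)%E.

Let W_mono x s t : s <= t -> (W x s <= W x t)%E.
Proof.
move=> st; apply: gt0_ler_poweR; rewrite ?in_itv/= ?leey ?andbT ?(ltW pV0)//;
  rewrite ?(wmeasure_ge0 _ w0)//.
apply: wmeasure_le => //; try exact: measurable_eball.
by move=> y xy; exact: lt_le_trans xy st.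
Qed.

Let E x t : \bar R :=
  ess_inf (mrestr (@lebesgue_measure R) (measurable_itv `]t, +oo[))
    (fun s => (phi x s)%:E * W x s)%E.

Let null_outside t : mrestr (@lebesgue_measure R) (measurable_itv `]t, +oo[)
  (~` `]t, +oo[%classic) = 0%E.
Proof.
rewrite /mrestr -[RHS](measure0 (@lebesgue_measure R)).
by congr (lebesgue_measure _); exact: setICl.
Qed.

Let E_ge0 x t : 0 <= t -> (0 <= E x t)%E.
Proof.
move=> t0; apply/ess_infP; exists (~` `]t, +oo[%classic); split.
- by apply: measurableC; exact: measurable_itv.
- exact: null_outside.
move=> s /= h1 h2; apply: h1; rewrite /= in_itv/= andbT in h2.
by rewrite mule_ge0 ?poweR_ge0// lee_fin ltW// phi_gt0// (le_lt_trans t0).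
Qed.

Let E_mono x s t : s <= t -> (E x s <= E x t)%E.
Proof.
move=> st; apply/ess_infP.
have [U [mU U0 hU]] := ess_inf_le (mrestr (@lebesgue_measure R) (measurable_itv `]s, +oo[))
    (fun s => (phi x s)%:E * W x s)%E.
exists U; split => //; apply/eqP; rewrite eq_le measure_ge0 andbT -U0.
apply: (@le_measure _ _ _ (@lebesgue_measure R) (U `&` `]t, +oo[%classic) (U `&` `]s, +oo[%classic)); rewrite ?inE;
  try by apply: measurableI => //.
by apply: setIS => u /=; rewrite !in_itv/= !andbT; exact: le_lt_trans.
Qed.

(** For every s > t the local norm at t is at most that at s, hence at most m phi(x, s)
    w(B_s)^(1/p). As the left side does not depend on s, the essential infimum over s may be
    taken. *)
Let local_norm_E x t F m : 0 < x `n -> 0 < t -> 0 < m -> measurable_fun setT F ->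
  (forall y, 0 <= F y) -> (morrey_norm p phi w F <= m%:E)%E ->
  (local_norm p w F x t `^ p^-1 <= m%:E * E x t)%E.
Proof.
move=> x0 t0 m0 mF F0 hm.
rewrite -lee_pdivrMl// -[leRHS]/(E x t); apply/ess_infP.
exists (~` `]t, +oo[%classic); split.
- by apply: measurableC; exact: measurable_itv.
- exact: null_outside.
move=> s /= h1 h2; apply: h1; rewrite /= in_itv/= andbT in h2.
have s0 : 0 < s by exact: lt_trans h2.
have ph := phi_gt0 x s0.
rewrite lee_pdivrMl//.
have [a a0 aE] := wmeasure_eball p1 wP x0 s0.
have [c c0 cE] := wmeasure_hball_fin x0 s0.
have Wle := wmeasure_hball_eball x0 s0.
have L1 : (local_norm p w F x t <= local_norm p w F x s)%E.
  apply: ge0_subset_integral => //.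
  - exact: measurable_hball.
  - exact: measurable_hball.
  - apply: measurable_funTS; apply/measurable_EFinP; apply: measurable_funM => //.
    by apply: (@measurableT_comp _ _ _ _ _ _ (fun u : R => u `^ p)) => //; exact: measurable_powR.
  - by move=> y _; rewrite lee_fin mulr_ge0 ?powR_ge0// ltW.
  - by move=> y [xy y0]; split => //; exact: lt_trans xy h2.
have LF0 u : (0 <= local_norm p w F x u)%E.
  by apply: integral_ge0 => y _; rewrite lee_fin mulr_ge0 ?powR_ge0// ltW.
have LE : local_norm p w F x s = (\int[mu]_(y in hball x s) (`|F y| `^ p * w y)%:E)%E.
  by apply: eq_integral => y _; rewrite ger0_norm.
have hX : ((phi x s)^-1%:E * ((wmeasure w (hball x s))^-1 * local_norm p w F x s) `^ p^-1 <= m%:E)%E.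
  apply: le_trans hm.
  apply: ereal_sup_ubound.
  exists x; exists s; split; [exact: x0|exact: s0|].
  rewrite LE; reflexivity.
rewrite cE in hX.
have h3 := normalized_le ph c0 (LF0 s) hX.
have h4 : (local_norm p w F x t `^ p^-1 <= local_norm p w F x s `^ p^-1)%E.
  by apply: poweR_mono; [exact: LF0|exact: L1].
apply: (le_trans h4); apply: (le_trans h3).
rewrite -cE EFinM muleCA (muleCA m%:E); apply: lee_wpmul2l; first by rewrite lee_fin ltW.
rewrite muleC; apply: lee_wpmul2l; first by rewrite lee_fin ltW.
by apply: poweR_mono; [exact: wmeasure_ge0|exact: Wle].
Qed.

Lemma tail_sum_le : phi_condition p w phi -> exists2 C : R, 0 < C &
  forall F x r m, 0 < x `n -> 0 < r -> 0 < m -> measurable_fun setT F ->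
  (forall y, 0 <= F y) -> (morrey_norm p phi w F <= m%:E)%E ->
  (tail_sum p w F x r <= (C * (m * phi x r))%:E)%E.
Proof.
move=> [C1 hC1].
(* The condition does not give the sign of C1, hence the absolute value; adding 1 makes C
   positive. *)
pose C := (2 * `|C1| + 1) / ln 2.
have ln2 : 0 < ln 2 :> R by rewrite ln_gt0// ltr1n.
exists C; first by rewrite divr_gt0// addrC ltr_pwDl// mulr_ge0.
move=> F x r m x0 r0 m0 mF F0 hm.
have e0 k : 0 < 2 ^+ k * r by rewrite mulr_gt0// exprn_gt0.
(* A lower bound for the integrand, up to the factor 1 / t, for t between 2^(k+1) r and 2^(k+2) r:
   the logarithm and the essential infimum are estimated at the left end, the mass of the ball at
   the right end. *)
pose T k := ((ln 2 * k.+1%:R)%:E * (E x (2 ^+ k.+1 * r) * (W x (2 ^+ k.+2 * r))^-1))%E.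
have W0 t : (0 <= W x t)%E by exact: poweR_ge0.
have EW0 s t : 0 <= s -> (0 <= E x s * (W x t)^-1)%E.
  by move=> s0; rewrite mule_ge0 ?E_ge0// inve_ge0.
have T0 k : (0 <= T k)%E.
  by rewrite mule_ge0 ?EW0 ?(ltW (e0 _))// lee_fin mulr_ge0// ltW.
have ph := phi_gt0 x r0.
have sumT : (\sum_(0 <= k <oo) T k <= (2 * `|C1| * phi x r)%:E)%E.
  apply: (le_trans (dyadic_tail r0 T0 _ _)); last first.
  - rewrite -mulrA EFinM; apply: lee_wpmul2l => //.
    apply: le_trans (hC1 x r r0) _; rewrite lee_fin ler_wpM2r ?(ltW ph)//.
    exact: ler_norm.
  - move=> k t /andP[t1 t2].
    have t0 : 0 < t by exact: lt_trans t1.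
    rewrite muleC; apply: lee_pmul.
    + exact: T0.
    + by rewrite lee_fin invr_ge0 ltW.
    + apply: lee_pmul.
      * by rewrite lee_fin mulr_ge0// ltW.
      * by rewrite EW0// ltW.
      * rewrite lee_fin (@le_trans _ _ (ln (t / r)))//; last by rewrite lerDr.
        rewrite mulrC mulrC mulr_natr -lnXn// ler_ln ?posrE ?exprn_gt0 ?divr_gt0//.
        by rewrite ler_pdivlMr// ltW.
      * apply: lee_pmul.
        - by rewrite E_ge0// ltW.
        - by rewrite inve_ge0.
        - by apply: E_mono; exact: ltW.
        - by rewrite lee_pV2; [apply: W_mono; exact: ltW|exact: W0|exact: W0].
    + by rewrite lee_fin lef_pV2 ?posrE// ltW.
  - move=> t rt; have t0 := lt_trans r0 rt.
    rewrite mule_ge0 ?lee_fin ?invr_ge0 ?(ltW t0)// mule_ge0 ?EW0 ?(ltW t0)// lee_fin.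
    by rewrite addr_ge0// ln_ge0// ler_pdivlMr// mul1r ltW.
apply: (@le_trans _ _ (\sum_(0 <= k <oo) ((m / ln 2)%:E * T k))%E).
  apply: lee_nneseries => k _.
    by rewrite mule_ge0 ?lee_fin// mule_ge0 ?poweR_ge0// inve_ge0 poweR_ge0.
  rewrite /T [leRHS]muleA -EFinM mulrA divfK ?gt_eqF// (mulrC m) (EFinM _ m) -[leRHS]muleA.
  apply: lee_wpmul2l; first by rewrite lee_fin.
  rewrite [leRHS]muleA; apply: lee_wpmul2r; first by rewrite inve_ge0 poweR_ge0.
  exact: local_norm_E.
rewrite nneseriesZl; last by move=> k _; exact: T0.
apply: (@le_trans _ _ ((m / ln 2)%:E * (2 * `|C1| * phi x r)%:E)%E).
  by apply: lee_wpmul2l => //; rewrite lee_fin divr_ge0// ltW.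
rewrite -EFinM lee_fin /C.
have -> : m / ln 2 * (2 * `|C1| * phi x r) = 2 * `|C1| / ln 2 * (m * phi x r) by ring.
by rewrite ler_wpM2r ?mulr_ge0 ?(ltW m0) ?(ltW ph)// ler_wpM2r ?invr_ge0 ?(ltW ln2)// lerDl.
Qed.

End phi_condition.

(** * Morrey norms of integral operators *)

Section morrey_estimates.
Context {R : realType} (n : nat).
Local Notation N := n.+1.
Local Notation V := 'rV[R]_N.
Local Notation mu := (lebesgue_rV N : {measure set V -> \bar R}).
Local Notation H := (@halfspace R n).
Implicit Types (x y : V) (r t m : R) (F f g : V -> R) (b : V -> V -> R).
Local Notation "x `n" := ((x : V) ord0 ord_max) (at level 2, format "x `n").
Variable p : R.
Hypothesis p1 : 1 < p.
Variable phi : V -> R -> R.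
Hypothesis phi_gt0 : forall x r, 0 < r -> 0 < phi x r.
Let p0 : 0 < p. Proof. by rewrite (lt_trans ltr01). Qed.
Let pV0 : 0 < p^-1. Proof. by rewrite invr_gt0. Qed.

Lemma poweR_le_mono (q : R) (a b : \bar R) : 0 < q -> (0 <= a)%E -> (a <= b)%E ->
  (a `^ q <= b `^ q)%E.
Proof.
move=> q0 a0 ab; apply: gt0_ler_poweR; rewrite ?in_itv/= ?leey ?andbT ?(ltW q0)//.
exact: le_trans ab.
Qed.

Lemma halfspace_cover : exists2 e : V, 0 < e `n &
  forall B : R, exists k : nat, forall x, H x -> (forall i, `|x ord0 i| <= B) ->
    hball e k.+1%:R x.
Proof.
exists (const_mx 1); first by rewrite mxE.
move=> B; have [k hk] : exists k : nat, N%:R * (`|B| + 1) < k.+1%:R.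
  by exists (Num.truncn (N%:R * (`|B| + 1))); exact: truncnS_gt.
exists k => x Hx xB; split => //; apply: le_lt_trans hk.
apply: enorm_le => [|i]; first by rewrite addr_ge0.
rewrite !mxE; apply: le_trans (ler_normB _ _) _; rewrite normr1 lerD2r.
by apply: le_trans (xB i) _; exact: ler_norm.
Qed.

Lemma morrey_norm_ge0 (w : V -> R) f : (0 <= morrey_norm p phi w f)%E.
Proof.
have [e e0 _] := halfspace_cover.
apply: ereal_sup_ge; exists ((phi e 1)^-1%:E *
  ((wmeasure w (hball e 1))^-1 *
    \int[mu]_(y in hball e 1) (`|f y| `^ p * w y)%:E) `^ p^-1)%E.
  by exists e; exists 1; split => //; exact: ltr01.
by rewrite mule_ge0 ?poweR_ge0// lee_fin invr_ge0 ltW// phi_gt0.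
Qed.

Lemma ae_wmeasure (w v : V -> R) : {ae mu, forall x, w x = v x} ->
  wmeasure w = wmeasure v.
Proof.
move=> wv; apply/funext => E; apply: ae_eq_integral_gen.
by apply: filterS wv => x -> _.
Qed.

Lemma morrey_norm_ae_weight (w v : V -> R) f : {ae mu, forall x, w x = v x} ->
  morrey_norm p phi w f = morrey_norm p phi v f.
Proof.
move=> wv; rewrite /morrey_norm (ae_wmeasure wv).
have E x r : (\int[mu]_(y in hball x r) (`|f y| `^ p * w y)%:E =
              \int[mu]_(y in hball x r) (`|f y| `^ p * v y)%:E)%E.
  by apply: ae_eq_integral_gen; apply: filterS wv => y -> _.
congr ereal_sup; apply/funext => c; apply/propext; split => -[x [r [x0 r0 ->]]];
  by exists x, r; split => //; rewrite (E x r).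
Qed.

Lemma morrey_norm_ae_le (w : V -> R) f g : (forall x, 0 <= w x) ->
  {ae mu, forall x, H x -> `|f x| <= `|g x|} ->
  (morrey_norm p phi w f <= morrey_norm p phi w g)%E.
Proof.
move=> w0 fg; apply: ge_ereal_sup => _ [x [r [x0 r0 ->]]].
apply: ereal_sup_ge; eexists; first by exists x, r; split.
apply: lee_wpmul2l; first by rewrite lee_fin invr_ge0 ltW// phi_gt0.
have W0 : (0 <= wmeasure w (hball x r))%E.
  by apply: integral_ge0 => y _; rewrite lee_fin.
have I0 (h : V -> R) : (0 <= \int[mu]_(y in hball x r) (`|h y| `^ p * w y)%:E)%E.
  by apply: integral_ge0 => y _; rewrite lee_fin mulr_ge0 ?powR_ge0.
apply: poweR_le_mono; first exact: pV0.
  by apply: mule_ge0; [rewrite inve_ge0; exact: W0|exact: I0].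
apply: lee_wpmul2l; first by rewrite inve_ge0; exact: W0.
apply: ae_le_integral_ge0.
- by move=> y _; rewrite lee_fin mulr_ge0 ?powR_ge0.
- by move=> y _; rewrite lee_fin mulr_ge0 ?powR_ge0.
apply: filterS fg => y + [_ Hy] => /(_ Hy) fgy.
by rewrite lee_fin ler_wpM2r// ge0_ler_powR ?nnegrE// ltW.
Qed.

Lemma morrey_norm_ae_eq (w : V -> R) f g : (forall x, 0 <= w x) ->
  {ae mu, forall x, H x -> f x = g x} ->
  morrey_norm p phi w f = morrey_norm p phi w g.
Proof.
move=> w0 fg; apply: le_anti; apply/andP; split; apply: morrey_norm_ae_le; try exact: w0.
  by apply: filterS fg => x fgx Hx; rewrite fgx.
by apply: filterS fg => x fgx Hx; rewrite fgx.
Qed.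

Variable w : V -> R.
Hypothesis wP : Ap_weight p w.
Let w0 := Ap_gt0 wP.
Let mw := Ap_measurable wP.

Lemma morrey_norm_bound f (M : R) : 0 <= M ->
  (forall x r, 0 < x `n -> 0 < r ->
    (\int[mu]_(y in hball x r) (`|f y| `^ p * w y)%:E <=
     ((M * phi x r) `^ p)%:E * wmeasure w (hball x r))%E) ->
  (morrey_norm p phi w f <= M%:E)%E.
Proof.
move=> M0 h; apply: ge_ereal_sup => _ [x [r [x0 r0 ->]]].
have ph := phi_gt0 x r0.
have [c c0 cE] := wmeasure_hball_fin p1 wP x0 r0.
rewrite lee_pdivrMl// -EFinM mulrC.
have -> : (M * phi x r)%:E = (((M * phi x r) `^ p)%:E `^ p^-1)%E.
  by rewrite poweR_EFin -powRrM divff ?gt_eqF// powRr1// mulr_ge0// ltW.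
have I0 : (0 <= \int[mu]_(y in hball x r) (`|f y| `^ p * w y)%:E)%E.
  by apply: integral_ge0 => y _; rewrite lee_fin mulr_ge0 ?powR_ge0// ltW.
have := h _ _ x0 r0; move: I0; set I := (\int[mu]_(y in _) _)%E => I0.
rewrite cE inver gt_eqF// => hI.
apply: poweR_le_mono; first exact: pV0.
  by apply: mule_ge0; [rewrite lee_fin invr_ge0 ltW|exact: I0].
by rewrite lee_pdivrMl// muleC; exact: hI.
Qed.

Hypothesis phi_cond : phi_condition p w phi.

Lemma major_local : exists2 C : R, 0 < C & forall b F m x r, mean_metric b ->
  measurable_fun setT F -> (forall y, 0 <= F y) -> 0 < m ->
  (morrey_norm p phi w F <= m%:E)%E -> 0 < x `n -> 0 < r ->
  (\int[mu]_(y in hball x r) (major_op b F y `^ p * (w y)%:E) <=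
   ((C * m * phi x r) `^ p)%:E * wmeasure w (hball x r))%E.
Proof.
have [C1 C10 h1] := local_bound p1 wP.
have [C2 C20 h2] := tail_sum_le p1 wP phi_gt0 phi_cond.
exists (C1 `^ p^-1 * C2); first by rewrite mulr_gt0// powR_gt0.
move=> b F m x r bP mF F0 m0 hm x0 r0.
apply: le_trans (h1 b F x r bP mF F0 x0 r0) _.
have ph := phi_gt0 x r0.
rewrite muleA; apply: lee_wpmul2r; first exact: wmeasure_ge0.
have -> : C1 `^ p^-1 * C2 * m * phi x r = C1 `^ p^-1 * (C2 * (m * phi x r)) by ring.
rewrite powRM ?powR_ge0//; last by rewrite !mulr_ge0// ltW.
rewrite -powRrM mulVf ?gt_eqF// powRr1 ?(ltW C10)// EFinM.
apply: lee_wpmul2l; first by rewrite lee_fin ltW.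
rewrite -poweR_EFin; apply: poweR_le_mono => //; last exact: h2.
apply: nneseries_ge0 => k _ _; rewrite mule_ge0 ?lee_fin// mule_ge0 ?poweR_ge0//.
by rewrite inve_ge0 poweR_ge0.
Qed.

(** The p-th power of the dominating operator is integrable against the positive weight w over
    half-balls that exhaust the half-space. This makes the integrals defining the operators converge
    at almost every x. *)
Lemma major_fin b F : mean_metric b -> measurable_fun setT F -> (forall y, 0 <= F y) ->
  (morrey_norm p phi w F < +oo)%E ->
  {ae mu, forall x, H x -> (major_op b F x < +oo)%E}.
Proof.
move=> bP mF F0 Foo.
have [C C0 h] := major_local.
have [m m0 hm] : exists2 m : R, 0 < m & (morrey_norm p phi w F <= m%:E)%E.
  have M0 := morrey_norm_ge0 w F.
  have Mfin : morrey_norm p phi w F \is a fin_num by rewrite ge0_fin_numE.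
  exists (fine (morrey_norm p phi w F) + 1).
    by rewrite ltr_wpDl// fine_ge0.
  by rewrite -[leLHS]fineK// lee_fin lerDl.
have [e e0 he] := halfspace_cover.
have A k : {ae mu, forall x, hball e k.+1%:R x -> (major_op b F x < +oo)%E}.
  have mB := measurable_hball e k.+1%:R.
  have M0 x : (0 <= major_op b F x)%E.
    apply: integral_ge0 => y _.
    by rewrite lee_fin !mulr_ge0 ?powR_ge0 ?(mm_ge0 bP).
  have int : mu.-integrable (hball e k.+1%:R)
      (fun x => major_op b F x `^ p * (w x)%:E)%E.
    apply/integrableP; split.
      apply: measurable_funTS; apply: emeasurable_funM; last exact/measurable_EFinP.
      apply: (@measurableT_comp _ _ _ _ _ _ (fun t : \bar R => (t `^ p)%E)).
        exact: measurable_poweR.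
      exact: measurable_major_op.
    under eq_integral do rewrite gee0_abs ?mule_ge0 ?poweR_ge0 ?lee_fin ?(ltW (w0 _))//.
    apply: le_lt_trans (h b F m e k.+1%:R bP mF F0 m0 hm e0 _) _ => //.
    have [c c0 ->] := wmeasure_hball_fin p1 wP e0 (ltr0Sn R k).
    by rewrite -EFinM ltry.
  apply: filterS (integrable_ae mB int) => x hx Bx.
  have := hx Bx; rewrite ltey; apply: contraTN => /eqP ->.
  by rewrite poweRyr ?gt_eqF// gt0_mulye ?lte_fin.
apply: filterS (ae_foralln A) => x hx Hx.
have [k hk] := he (enorm x); apply: (hx k); apply: hk => // i.
exact: enorm_coord.
Qed.

End morrey_estimates.

Section integral_operator.
Context {R : realType} (n : nat).
Local Notation N := n.+1.
Local Notation V := 'rV[R]_N.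
Local Notation mu := (lebesgue_rV N : {measure set V -> \bar R}).
Local Notation H := (@halfspace R n).
Implicit Types (x y : V) (r t m : R) (F f g : V -> R) (b : V -> V -> R).
Local Notation "x `n" := ((x : V) ord0 ord_max) (at level 2, format "x `n").
Variable p : R.
Hypothesis p1 : 1 < p.
Variable phi : V -> R -> R.
Hypothesis phi_gt0 : forall x r, 0 < r -> 0 < phi x r.
Variable w : V -> R.
Hypothesis wP : Ap_weight p w.
Hypothesis phi_cond : phi_condition p w phi.
Let p0 : 0 < p. Proof. by rewrite (lt_trans ltr01). Qed.
Let w0 := Ap_gt0 wP.
Let mw := Ap_measurable wP.
Let w0' x : 0 <= w x. Proof. exact: ltW. Qed.
Let mH : measurable H. Proof. exact: measurable_halfspace. Qed.

Definition borel_version f g :=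
  measurable_fun setT g /\ {ae mu, forall x, H x -> f x = g x}.

Lemma ex_borel_version f : ae_measurable mu H f -> exists g, borel_version f g.
Proof.
move=> [g mg fg]; exists (g \_ H); split.
  exact: ((measurable_restrictT _ mH).1 mg).
by apply: filterS fg => x fgx Hx; rewrite fgx// patchE mem_set.
Qed.

(** Here q is the kernel as given and Q a Borel version of it that obeys its bound at every pair.
    The hypothesis [hC] is the conclusion of [major_local] with its constant named and all b
    quantified, so that one C serves every kernel. *)
Variables (C c : R) (b : V -> V -> R) (Q : V * V -> R) (q : V -> V -> R).
Hypothesis c0 : 0 < c.
Hypothesis bP : mean_metric b.
Hypothesis mQ : measurable_fun setT Q.
Hypothesis Qle : forall x y, H x -> H y -> `|Q (x, y)| <= c * (kap x y * b x y).
Hypothesis qQ : {ae mu, forall x, H x -> {ae mu, forall y, H y -> q x y = Q (x, y)}}.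
Hypothesis C0 : 0 < C.
Hypothesis hC : forall b F m x r, mean_metric b ->
  measurable_fun setT F -> (forall y, 0 <= F y) -> 0 < m ->
  (morrey_norm p phi w F <= m%:E)%E -> 0 < x `n -> 0 < r ->
  (\int[mu]_(y in hball x r) (major_op b F y `^ p * (w y)%:E) <=
   ((C * m * phi x r) `^ p)%:E * wmeasure w (hball x r))%E.

Let op g x : \bar R := (\int[mu]_(y in H) (Q (x, y) * g y)%:E)%E.

Definition integral_op f x : R := \int[mu]_(y in H) (q x y * f y).
Local Notation S := integral_op.

Let mF g : measurable_fun setT g -> measurable_fun setT (fun y => `|g y|).
Proof. by move=> mg; exact: measurableT_comp. Qed.

Let mQg x g : measurable_fun setT g -> measurable_fun setT (fun y => Q (x, y) * g y).
Proof.
move=> mg; apply: measurable_funM => //.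
exact: (measurableT_comp mQ (measurable_pair1 x)).
Qed.

Let op_eq f g : borel_version f g ->
  {ae mu, forall x, H x -> (\int[mu]_(y in H) (q x y * f y)%:E = op g x)%E}.
Proof.
move=> [_ fg]; apply: filterS qQ => x + Hx => /(_ Hx) qx.
apply: ae_eq_integral_gen; apply: filterS2 fg qx => y fy qy Hy.
by rewrite fy// qy.
Qed.

Let major_ge0 F x : (forall y, 0 <= F y) -> (0 <= major_op b F x)%E.
Proof.
move=> F0; apply: integral_ge0 => y _.
by rewrite lee_fin !mulr_ge0 ?powR_ge0 ?(mm_ge0 bP).
Qed.

Let op_le g x : measurable_fun setT g -> H x ->
  (\int[mu]_(y in H) (`|Q (x, y) * g y|%R)%:E <= c%:E * major_op b (fun y => `|g y|%R) x)%E.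
Proof.
move=> mg Hx; rewrite /major_op -ge0_integralZl.
- apply: le_integral_ge0 => y Hy; rewrite lee_fin//.
  by rewrite normrM !mulrA ler_wpM2r// -mulrA; exact: Qle.
- exact: mH.
- apply: measurable_funTS; apply/measurable_EFinP; apply: measurable_funM.
    exact: (measurableT_comp (@measurable_kap _ _) (measurable_pair1 x)).
  apply: measurable_funM; last exact: mF.
  exact: (measurableT_comp (mm_measurable bP) (measurable_pair1 x)).
- by move=> y _; rewrite lee_fin !mulr_ge0 ?powR_ge0 ?(mm_ge0 bP).
- by rewrite lee_fin ltW.
Qed.

(** Tonelli's theorem is applied to the positive and the negative part separately, since the product
    is not known to be integrable on pairs. *)
Let measurable_op g : measurable_fun setT g -> measurable_fun setT (op g).
Proof.
move=> mg.
pose G (u : V * V) := (Q u * g u.2 * \1_H u.2)%:E.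
have mG : measurable_fun setT G.
  apply/measurable_EFinP; apply: measurable_funM.
    apply: measurable_funM => //.
    exact: (measurableT_comp mg measurable_snd).
  by apply: measurableT_comp measurable_snd; exact: measurable_indic.
rewrite (_ : op g = (fubini_F (lebesgue_rV N) G^\+ \- fubini_F (lebesgue_rV N) G^\-)%E).
  apply: emeasurable_funB; apply: measurable_fun_fubini_tonelli_F => //.
    exact: measurable_funepos.
  exact: measurable_funeneg.
apply/funext => x; rewrite /op integral_mkcond.
have -> : (fun y => (Q (x, y) * g y)%:E) \_ H = (fun y => G (x, y)).
  apply/funext => y; rewrite patchE /G /= indicE.
  by case: ifPn => _; rewrite ?mulr1 ?mulr0.
rewrite integralE /fubini_F; congr (_ - _)%E; apply: eq_integral => y _.
  by rewrite !funeposE.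
by rewrite !funenegE.
Qed.

Let norm_op f g : borel_version f g ->
  {ae mu, forall x, H x -> ((`|S f x|%R)%:E <= c%:E * major_op b (fun y => `|g y|%R) x)%E}.
Proof.
move=> fg; apply: filterS (op_eq fg) => x + Hx => /(_ Hx) E.
rewrite /integral_op /Rintegral E; case: fg => mg _.
(* Where the integral is infinite, the real-valued operator is 0 and the bound still holds. *)
apply: (@le_trans _ _ `|op g x|%E); first by case: (op g x) => //= *; rewrite normr0 leey.
apply: le_trans (op_le mg Hx).
apply: (le_trans (le_abse_integral _ mH _)).
  by apply: measurable_funTS; apply/measurable_EFinP; exact: mQg.
by [].
Qed.

Let norm_abs f g : borel_version f g ->
  (morrey_norm p phi w (fun y => `|g y|%R) <= morrey_norm p phi w f)%E.
Proof.
move=> [_ fg]; apply: morrey_norm_ae_le => //.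
by apply: filterS fg => x fgx Hx; rewrite fgx// normr_id.
Qed.

Let local_op f m x r : ae_measurable mu H f -> 0 < m ->
  (morrey_norm p phi w f <= m%:E)%E -> 0 < x `n -> 0 < r ->
  (\int[mu]_(y in hball x r) (`|S f y| `^ p * w y)%:E <=
   ((C * c * m * phi x r) `^ p)%:E * wmeasure w (hball x r))%E.
Proof.
move=> /ex_borel_version[g fg] m0 fm x0 r0.
have [mg _] := fg.
set F := fun y => `|g y|.
have hF := hC bP (mF mg) (fun y => normr_ge0 (g y)) m0 (le_trans (norm_abs fg) fm) x0 r0.
have cp0 : 0 <= c `^ p by exact: powR_ge0.
apply: (@le_trans _ _ (\int[mu]_(y in hball x r) ((c `^ p)%:E * (major_op b F y `^ p * (w y)%:E)))%E).
  apply: ae_le_integral_ge0.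
  - by move=> y _; rewrite lee_fin mulr_ge0 ?powR_ge0.
  - move=> y _; apply: mule_ge0; first by rewrite lee_fin.
    by apply: mule_ge0; [exact: poweR_ge0|rewrite lee_fin].
  apply: filterS (norm_op fg) => y + [_ Hy] => /(_ Hy) hy.
  rewrite muleA EFinM; apply: lee_wpmul2r; first by rewrite lee_fin.
  rewrite -!poweR_EFin -poweRM ?lee_fin ?(ltW c0)//; last first.
    by apply: major_ge0 => z; exact: normr_ge0.
  by apply: poweR_le_mono; [exact: p0|rewrite lee_fin|exact: hy].
rewrite ge0_integralZl.
- have -> : C * c * m * phi x r = c * (C * m * phi x r) by ring.
  have ph := phi_gt0 x r0.
  rewrite powRM ?(ltW c0)//; last by rewrite !mulr_ge0// ltW.
  by rewrite EFinM -[leRHS]muleA; apply: lee_wpmul2l.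
- exact: measurable_hball.
- apply: measurable_funTS; apply: emeasurable_funM; last exact/measurable_EFinP.
  apply: (@measurableT_comp _ _ _ _ _ _ (fun t : \bar R => (t `^ p)%E)).
    exact: measurable_poweR.
  exact: (measurable_major_op bP (mF mg) (fun y => normr_ge0 (g y))).
- by move=> y _; apply: mule_ge0; [exact: poweR_ge0|rewrite lee_fin].
- by rewrite lee_fin.
Qed.

Lemma integral_op_norm_le f m : ae_measurable mu H f -> 0 < m ->
  (morrey_norm p phi w f <= m%:E)%E ->
  (morrey_norm p phi w (S f) <= (C * c * m)%:E)%E.
Proof.
move=> mf m0 fm; apply: (morrey_norm_bound p1 phi_gt0 wP).
  by rewrite !mulr_ge0// ltW.
by move=> x r x0 r0; exact: local_op.
Qed.

Lemma integral_op_norm f : morrey p phi w f ->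
  (morrey_norm p phi w (S f) <= (C * c)%:E * morrey_norm p phi w f)%E.
Proof.
move=> [mf _ foo].
have ff : morrey_norm p phi w f \is a fin_num by rewrite ge0_fin_numE// morrey_norm_ge0.
have Cc : 0 < C * c by exact: mulr_gt0.
(* [integral_op_norm_le] takes a positive m, while the norm of f may vanish; hence an arbitrary
   slack e. *)
apply/lee_addgt0Pr => e e0; rewrite -(fineK ff) -EFinM -EFinD.
set m := fine _.
have m0 : 0 <= m by rewrite fine_ge0// morrey_norm_ge0.
have -> : C * c * m + e = C * c * (m + e / (C * c)).
  by rewrite mulrDr mulrCA divff ?gt_eqF// mulr1.
apply: integral_op_norm_le => //; first by rewrite ltr_wpDl// divr_gt0.
by rewrite -(fineK ff) lee_fin lerDl ltW// divr_gt0.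
Qed.

Let finite_op f g : morrey p phi w f -> borel_version f g ->
  {ae mu, forall x, H x -> mu.-integrable H (fun y => (Q (x, y) * g y)%:E)}.
Proof.
move=> [_ _ foo] fg; have [mg _] := fg.
have := major_fin p1 phi_gt0 wP phi_cond bP (mF mg) (fun y => normr_ge0 (g y))
  (le_lt_trans (norm_abs fg) foo).
apply: filterS => x + Hx => /(_ Hx) hx; apply/integrableP; split.
  by apply: measurable_funTS; apply/measurable_EFinP; exact: mQg.
apply: le_lt_trans (op_le mg Hx) _.
by apply: lte_mul_pinfty => //; rewrite lee_fin ltW.
Qed.

Lemma integral_op_integrable f : morrey p phi w f ->
  {ae mu, forall x, H x -> ae_integrable mu H (fun y => q x y * f y)}.
Proof.
move=> fM; have [mf _ _] := fM; have [g fg] := ex_borel_version mf.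
apply: filterS2 qQ (finite_op fM fg) => x qx hx Hx.
have [mg fgE] := fg; move/integrableP: (hx Hx) => [_ hI].
have E : {ae mu, forall y, H y -> q x y * f y = Q (x, y) * g y}.
  by apply: filterS2 fgE (qx Hx) => y fy qy Hy; rewrite fy// qy.
split.
  by exists (fun y => Q (x, y) * g y) => //; exact: measurable_funTS (mQg x mg).
apply: le_lt_trans hI; rewrite le_eqVlt; apply/orP; left; apply/eqP.
by apply: ae_eq_integral_gen; apply: filterS E => y Ey Hy; rewrite Ey.
Qed.

Lemma ae_measurable_integral_op f : ae_measurable mu H f -> ae_measurable mu H (S f).
Proof.
move=> /ex_borel_version[g fg]; have [mg _] := fg.
exists (fun x => fine (op g x)).
  apply: measurable_funTS; apply: (@measurableT_comp _ _ _ _ _ _ (@fine R)) => //.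
  exact: measurable_op.
by apply: filterS (op_eq fg) => x + Hx => /(_ Hx) <-.
Qed.

Lemma integral_op_morrey f : morrey p phi w f -> morrey p phi w (S f).
Proof.
move=> fM; have [mf _ foo] := fM.
have h : (morrey_norm p phi w (S f) < +oo)%E.
  apply: le_lt_trans (integral_op_norm fM) _; apply: lte_mul_pinfty => //.
  by rewrite lee_fin mulr_ge0// ltW.
split => //; first exact: ae_measurable_integral_op.
move=> K cK KH.
have [e e0 he] := @halfspace_cover R n.
have [B hB] : exists B : R, forall x, K x -> forall i, `|x ord0 i| <= B.
  have [M [_ hM]] := compact_bounded cK.
  exists (M + 1) => x Kx i; apply: le_trans (hM (M + 1) _ x Kx); last by rewrite ltrDl.
  rewrite [leRHS]mx_normE.
  exact: (le_bigmax 0%:nng (fun i : 'I_1 * 'I_N => `|x i.1 i.2|%:nng) (ord0, i)).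
have [k hk] := he B.
have KB : K `<=` hball e k.+1%:R by move=> x Kx; apply: hk; [exact: KH|exact: hB].
apply: (@le_lt_trans _ _ (\int[mu]_(y in hball e k.+1%:R) (`|S f y| `^ p * w y)%:E)%E).
  rewrite integral_mkcond [leRHS]integral_mkcond; apply: le_integral_ge0 => y _.
    by rewrite patchE; case: ifPn => // _; rewrite lee_fin mulr_ge0 ?powR_ge0.
  rewrite !patchE; case: ifPn => [/set_mem Ky|_].
    by rewrite mem_set//; exact: KB.
  by case: ifPn => // _; rewrite lee_fin mulr_ge0 ?powR_ge0.
have M0 : (0 <= morrey_norm p phi w f)%E by exact: morrey_norm_ge0.
have ff : morrey_norm p phi w f \is a fin_num by rewrite (ge0_fin_numE M0); exact: foo.
have m0 : 0 < fine (morrey_norm p phi w f) + 1 by rewrite ltr_wpDl// fine_ge0.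
have fm : (morrey_norm p phi w f <= (fine (morrey_norm p phi w f) + 1)%:E)%E.
  by rewrite -[leLHS](fineK ff) lee_fin lerDl.
apply: (le_lt_trans (local_op mf m0 fm e0 (ltr0Sn R k))).
have [d d0 ->] := wmeasure_hball_fin p1 wP e0 (ltr0Sn R k).
by rewrite -EFinM ltry.
Qed.

(** Almost everywhere S g - S f = S (g - f), because both integrals converge there; the norm bound
    is then applied to g - f. The factor 2 in the choice of delta gives the strict inequality. *)
Lemma integral_op_continuous : morrey_continuous p phi w S.
Proof.
split; first exact: integral_op_morrey.
move=> f fM e e0.
have Cc : 0 < C * c by exact: mulr_gt0.
exists (e / (2 * (C * c))); first by rewrite divr_gt0// mulr_gt0.
move=> g gM gf.
have [mf _ _] := fM; have [mg _ _] := gM.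
have [f' ff'] := ex_borel_version mf; have [g' gg'] := ex_borel_version mg.
have hh : borel_version (g \- f) (g' \- f').
  split; first by apply: measurable_funB; [case: gg'|case: ff'].
  by case: gg' => _; case: ff' => _; apply: filterS2 => x fx gx Hx /=; rewrite fx// gx.
have mh : ae_measurable mu H (g \- f).
  by case: hh => mh' ghE; exists (g' \- f') => //; exact: measurable_funTS.
rewrite (@morrey_norm_ae_eq _ _ _ p1 _ phi_gt0 w _ (S (g \- f)))//; last first.
  have A f1 f2 : morrey p phi w f1 -> borel_version f1 f2 -> {ae mu, forall x, H x ->
      S f1 x = fine (op f2 x) /\ mu.-integrable H (fun y => (Q (x, y) * f2 y)%:E)}.
    move=> M1 v12; apply: filterS2 (op_eq v12) (finite_op M1 v12) => x E I Hx.
    by split; [rewrite /integral_op /Rintegral E|exact: I].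
  apply: filterS3 (A _ _ fM ff') (A _ _ gM gg') (op_eq hh) => x + + Ah Hx.
  move=> /(_ Hx)[Ef If] /(_ Hx)[Eg Ig].
  rewrite [RHS]/integral_op /Rintegral (Ah Hx) /= Ef Eg -fineB.
  - congr fine; rewrite -integralB//.
    by apply: eq_integral => y _; rewrite /= -EFinB mulrBr.
  - by apply: (integrable_fin_num mH); exact: Ig.
  - by apply: (integrable_fin_num mH); exact: If.
apply: le_lt_trans (integral_op_norm_le mh _ (ltW gf)) _.
  by rewrite divr_gt0// mulr_gt0.
rewrite lte_fin [ltLHS](_ : _ = e / 2); first by rewrite gtr_pMr// invf_lt1// ltr1n.
by field; rewrite !gt_eqF.
Qed.

End integral_operator.

(** * Muckenhoupt weights and functions of bounded mean oscillation *)

Lemma integral_gt0 d (T : measurableType d) (R : realType)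
    (mu : {measure set T -> \bar R}) (D : set T) (f : T -> \bar R) :
  measurable D -> (0 < mu D)%E -> measurable_fun D f -> (forall x, D x -> (0 < f x)%E) ->
  (0 < \int[mu]_(x in D) f x)%E.
Proof.
move=> mD D0 mf f0.
have I0 : (0 <= \int[mu]_(x in D) f x)%E.
  by apply: integral_ge0 => x Dx; apply: ltW; exact: f0.
rewrite lt_neqAle I0 andbT; apply/eqP => /esym E.
have : (\int[mu]_(x in D) `|f x| = 0)%E.
  by rewrite -[RHS]E; apply: eq_integral => x /set_mem Dx; rewrite gee0_abs// ltW// f0.
move/(ae_eq_integral_abs mu mD mf) => [U [mU U0 hU]].
have DU : D `<=` U by move=> x Dx; apply: hU => /(_ Dx) fx; have := f0 _ Dx; rewrite fx ltxx.
have : (mu D <= mu U)%E by apply: le_measure; rewrite ?inE.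
by rewrite U0 leNgt D0.
Qed.

Section Ap_borel.
Context {R : realType} (n : nat).
Local Notation N := n.+1.
Local Notation V := 'rV[R]_N.
Local Notation mu := (lebesgue_rV N : {measure set V -> \bar R}).
Implicit Types (c x y : V) (r l : R) (v : V -> R).

Lemma cube_eball c l : 0 < l -> cube c l `<=` eball c (2 * N%:R * l).
Proof.
move=> l0 y Qy; apply: (@le_lt_trans _ _ (N%:R * l)).
  apply: enorm_le => [|i]; first exact: ltW.
  by rewrite !mxE; have /andP[h1 h2] := Qy i; rewrite ler_norml; lra.
by rewrite -mulrA ltr_pMl ?ltr1n// mulr_gt0// ltr0n.
Qed.

Lemma eball_cube c r : eball c r `<=` cube (c - const_mx r) (2 * r).
Proof.
move=> y /eball_coord h i; have := h i; rewrite !mxE ltr_norml; lra.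
Qed.

Lemma mu_eball c r : 0 < r -> exists2 a : R, 0 < a <= (2 * r) ^+ N & mu (eball c r) = a%:E.
Proof.
move=> r0; have r20 : 0 <= 2 * r by rewrite mulr_ge0// ltW.
have h1 : (mu (eball c r) <= ((2 * r) ^+ N)%:E)%E.
  rewrite -(mu_cube (c - const_mx r) r20); apply: le_measure; rewrite ?inE.
  - exact: measurable_eball.
  - exact: measurable_cube.
  - exact: eball_cube.
have l0 : 0 < r / (2 * N%:R) by rewrite divr_gt0// mulr_gt0// ltr0n.
have h2 : (((r / (2 * N%:R)) ^+ N)%:E <= mu (eball c r))%E.
  rewrite -(mu_cube c (ltW l0)); apply: le_measure; rewrite ?inE.
  - exact: measurable_cube.
  - exact: measurable_eball.
  - move=> y /(cube_eball l0); congr (eball _ _ _).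
    by rewrite mulrC divfK// gt_eqF// mulr_gt0// ltr0n.
have f : mu (eball c r) \is a fin_num.
  by rewrite ge0_fin_numE ?measure_ge0//; apply: le_lt_trans h1 (ltry _).
exists (fine (mu (eball c r))); last by rewrite fineK.
rewrite -lte_fin -lee_fin fineK// h1 andbT; apply: lt_le_trans h2.
by rewrite lte_fin exprn_gt0.
Qed.

Variable p : R.
Hypothesis p1 : 1 < p.
Let p10 : 0 < p - 1. Proof. by rewrite subr_gt0. Qed.
Let p0 : 0 < p. Proof. by rewrite (lt_trans ltr01). Qed.

Lemma in_Ap_borel w : in_Ap p w -> exists v, [/\ measurable_fun setT v,
  forall x, 0 < v x & {ae mu, forall x, w x = v x}].
Proof.
move=> [[_ [[g mg gw] _]] wpos _].
(* The value 1 is taken only on a null set, because w is positive almost everywhere. *)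
exists (fun x => if 0 < g x then g x else 1); split.
- apply: measurable_fun_ifT => //; first exact: measurable_fun_ltr.
- by move=> x; case: ifPn.
- by apply: filterS2 gw wpos => x /(_ I) -> ->.
Qed.

Lemma Ap_const_borel w v : (forall x, 0 < v x) -> {ae mu, forall x, w x = v x} ->
  Ap_const p w = ereal_sup [set c | exists x r, 0 < r /\
    c = ((mu (eball x r))^-1 * wmeasure v (eball x r) *
      ((mu (eball x r))^-1 * wmeasure (dual_weight p v) (eball x r)) `^ (p - 1))%E].
Proof.
move=> v0 wv; rewrite /Ap_const.
have E1 x r : mean mu (eball x r) (EFin \o w) =
    ((mu (eball x r))^-1 * wmeasure v (eball x r))%E.
  by rewrite -(ae_wmeasure wv).
have E2 x r : mean mu (eball x r) (fun y => ((w y)%:E^-1) `^ (p - 1)^-1)%E =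
    ((mu (eball x r))^-1 * wmeasure (dual_weight p v) (eball x r))%E.
  congr (_ * _)%E; apply: ae_eq_integral_gen; apply: filterS wv => y -> _.
  rewrite inver gt_eqF// poweR_EFin /dual_weight -(@powR_inv1 _ (v y)) ?(ltW (v0 y))//.
  by rewrite -powRrM mulN1r.
congr ereal_sup; apply/seteqP; split => _ [x [r [r0 ->]]]; exists x, r;
  by rewrite E1 E2.
Qed.

Section eball_bounds.
Variables (w v : V -> R) (A : R).
Hypotheses (v0 : forall x, 0 < v x) (mv : measurable_fun setT v)
  (wv : {ae mu, forall x, w x = v x}) (wA : (Ap_const p w <= A%:E)%E).
Local Notation s := (dual_weight p v).

Let ms : measurable_fun setT s. Proof. exact: measurable_dual_weight. Qed.

Let wmeasure_gt0 (u : V -> R) x r : (forall x, 0 < u x) -> measurable_fun setT u -> 0 < r ->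
  (0 < wmeasure u (eball x r))%E.
Proof.
move=> u0 mu' r0; apply: integral_gt0.
- exact: measurable_eball.
- by have [a /andP[a0 _] ->] := mu_eball x r0.
- by apply: measurable_funTS; exact/measurable_EFinP.
- by move=> y _; rewrite lte_fin.
Qed.

Lemma eball_bounds x r : 0 < r -> exists W S : R,
  [/\ 0 < W, 0 < S, wmeasure v (eball x r) = W%:E, wmeasure s (eball x r) = S%:E &
   W * S `^ (p - 1) <= A * ((2 * r) ^+ N) `^ p].
Proof.
move=> r0; have [a /andP[a0 ale] aE] := mu_eball x r0.
have ai0 : 0 < a^-1 by rewrite invr_gt0.
have h : (a^-1%:E * wmeasure v (eball x r) * (a^-1%:E * wmeasure s (eball x r)) `^ (p - 1) <= A%:E)%E.
  apply: le_trans wA; rewrite (Ap_const_borel v0 wv); apply: ereal_sup_ubound.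
  by exists x, r; split => //; rewrite aE inver gt_eqF.
have := wmeasure_gt0 x v0 mv r0.
have := wmeasure_gt0 x (dual_weight_gt0 p v0) ms r0.
move: h; case: (wmeasure v _) => [W| |]//; case: (wmeasure s _) => [S| |]//.
- rewrite -!EFinM lee_fin !lte_fin => h S0 W0.
  exists W, S; split => //.
  apply: (@le_trans _ _ (A * a `^ p)).
    have ES : S `^ (p - 1) = a `^ (p - 1) * (a^-1 * S) `^ (p - 1).
      by rewrite -powRM ?mulr_ge0 ?(ltW a0) ?(ltW ai0) ?(ltW S0)// mulrA divff ?mul1r// gt_eqF.
    rewrite ES -(mulr_powRB1 (ltW a0) p0).
    have -> : W * (a `^ (p - 1) * (a^-1 * S) `^ (p - 1)) =
        (a^-1 * W * (a^-1 * S) `^ (p - 1)) * (a * a `^ (p - 1)).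
      by field; rewrite gt_eqF.
    by rewrite ler_wpM2r// mulr_ge0 ?powR_ge0// ltW.
  have A0 : 0 <= A.
    by apply: le_trans h; rewrite !mulr_ge0 ?powR_ge0 ?(ltW W0) ?(ltW ai0).
  rewrite ler_wpM2l// ge0_ler_powR ?nnegrE ?(ltW p0) ?(ltW a0)//.
  by rewrite exprn_ge0// mulr_ge0// ltW.
(* In this and the next two cases an infinite factor makes the product infinite, since the other
   factor is positive; this contradicts the bound A. *)
- rewrite !lte_fin => + _ W0; rewrite gt0_muley ?lte_fin// poweRyr ?gt_eqF//.
  by rewrite gt0_muley// -EFinM lte_fin mulr_gt0.
- rewrite lte_fin => + S0 _; rewrite gt0_muley ?lte_fin// gt0_mulye//.
  by rewrite -EFinM poweR_EFin lte_fin powR_gt0// mulr_gt0.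
- by move=> + _ _; rewrite gt0_muley ?lte_fin// poweRyr ?gt_eqF// mulyy.
Qed.

End eball_bounds.

Lemma Ap_weight_exists w : in_Ap p w -> exists2 v, Ap_weight p v & {ae mu, forall x, w x = v x}.
Proof.
move=> wA; have [v [mv v0 wv]] := in_Ap_borel wA; exists v => //.
have [_ _ Afin] := wA.
have [A A0 hA] : exists2 A : R, 0 < A & (Ap_const p w <= A%:E)%E.
  move: Afin; case: (Ap_const p w) => [a| |]// _; last by exists 1; rewrite ?ltr01 ?leNye.
  by exists (`|a| + 1); rewrite ?ltr_wpDl// lee_fin (le_trans (ler_norm a))// lerDl.
have B := eball_bounds v0 mv wv hA.
have ms := measurable_dual_weight p mv.
have s0 := dual_weight_gt0 p v0.
have cube0 c l : l <= 0 -> cube c l = set0.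
  move=> l0; apply/seteqP; split => // y /(_ ord0) /andP[h1 h2].
  by have := lt_le_trans h1 h2; rewrite ltrDl ltNge l0.
have rpos l : 0 < l -> 0 < 2 * N%:R * l by move=> l0; rewrite !mulr_gt0// ltr0n.
have le (u : V -> R) c l : (forall x, 0 < u x) -> measurable_fun setT u -> 0 < l ->
    (wmeasure u (cube c l) <= wmeasure u (eball c (2 * N%:R * l)))%E.
  move=> u0 mu' l0; apply: wmeasure_le => //; first exact: measurable_eball.
  exact: cube_eball.
split => //.
- move=> c l; have [l0|l0] := leP l 0.
    by rewrite cube0// /wmeasure integral_set0 ltry.
  apply: le_lt_trans (le _ c _ v0 mv l0) _.
  by have [W [S [_ _ -> _ _]]] := B c _ (rpos _ l0); rewrite ltry.
- move=> c l; have [l0|l0] := leP l 0.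
    by rewrite cube0// /wmeasure integral_set0 ltry.
  apply: le_lt_trans (le _ c _ s0 ms l0) _.
  by have [W [S [_ _ _ -> _]]] := B c _ (rpos _ l0); rewrite ltry.
(* A cube of side l lies in a ball of radius 2 N l, whose measure is at most (4 N l)^N. *)
exists (A * ((4 * N%:R) ^+ N) `^ p).
  by rewrite mulr_gt0// powR_gt0// exprn_gt0// mulr_gt0// ltr0n.
move=> c l l0; have [W [S [W0 S0 WE SE h]]] := B c _ (rpos _ l0).
apply: (@le_trans _ _ (W%:E * S%:E `^ (p - 1))%E).
  apply: lee_pmul; rewrite ?poweR_ge0 ?wmeasure_ge0//.
    by rewrite -WE; exact: le.
  apply: gt0_ler_poweR; rewrite ?in_itv/= ?leey ?andbT ?(ltW p10)//.
  - exact: wmeasure_ge0.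
  - by rewrite lee_fin ltW.
  - by rewrite -SE; exact: le.
rewrite poweR_EFin -EFinM lee_fin; apply: (le_trans h).
have N0 : 0 <= 4 * N%:R :> R by rewrite mulr_ge0.
have -> : ((2 * (2 * N%:R * l)) ^+ N) `^ p = ((4 * N%:R) ^+ N) `^ p * (l ^+ N) `^ p.
  rewrite -powRM ?exprn_ge0 ?(ltW l0)// -exprMn.
  by congr ((_ ^+ _) `^ _); ring.
by rewrite mulrA.
Qed.

(** It permits the factor [w]^(1/p) to be divided out of a constant that depends on w. *)
Lemma Ap_const_gt0 (w : V -> R) : in_Ap p w -> exists2 a : R, 0 < a & Ap_const p w = a%:E.
Proof.
move=> wA; have [v vP wv] := Ap_weight_exists wA.
have [_ _ Afin] := wA.
have v0 := Ap_gt0 vP; have mv := Ap_measurable vP.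
have h : (0 < Ap_const p w)%E.
  rewrite (Ap_const_borel v0 wv).
  have [a /andP[a0 _] aE] := mu_eball 0 ltr01.
  have mB := measurable_eball (0 : V) 1.
  have pos (u : V -> R) : (forall x, 0 < u x) -> measurable_fun setT u ->
      (0 < (mu (eball (0%R : V) 1%R))^-1 * wmeasure u (eball (0%R : V) 1%R))%E.
    move=> u0 mu'; rewrite aE inver gt_eqF// mule_gt0 ?lte_fin ?invr_gt0//.
    apply: integral_gt0 => //; first by rewrite aE.
      by apply: measurable_funTS; exact/measurable_EFinP.
    by move=> x _; rewrite lte_fin.
  apply: (@lt_le_trans _ (\bar R) ((mu (eball (0%R : V) 1%R))^-1 * wmeasure v (eball (0%R : V) 1%R) *
    ((mu (eball (0%R : V) 1%R))^-1 * wmeasure (dual_weight p v) (eball (0%R : V) 1%R)) `^ (p - 1))%E); last first.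
    by apply: ereal_sup_ubound; exists 0, 1; split => //; exact: ltr01.
  rewrite mule_gt0// ?poweR_gt0 ?pos//; first exact: dual_weight_gt0.
  exact: measurable_dual_weight.
exists (fine (Ap_const p w)); last by rewrite fineK// gt0_fin_numE.
by rewrite fine_gt0// h.
Qed.

End Ap_borel.

(** * Functions of bounded mean oscillation as pseudometrics *)

Section bmo.
Context {R : realType} (n : nat).
Local Notation N := n.+1.
Local Notation V := 'rV[R]_N.
Local Notation mu := (lebesgue_rV N : {measure set V -> \bar R}).
Local Notation H := (@halfspace R n).
Implicit Types (c x y z : V) (r l D : R).
Local Notation "x `n" := ((x : V) ord0 ord_max) (at level 2, format "x `n").

Lemma mu_hball x r : 0 < x `n -> 0 < r ->
  exists2 s : R, 0 < s <= (2 * r) ^+ N & mu (hball x r) = s%:E.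
Proof.
move=> x0 r0; have [a /andP[a0 ale] aE] := mu_eball x r0.
have h1 : (mu (hball x r) <= a%:E)%E.
  rewrite -aE; apply: le_measure; rewrite ?inE.
  - exact: measurable_hball.
  - exact: measurable_eball.
  - by move=> y [].
have f : mu (hball x r) \is a fin_num.
  by rewrite ge0_fin_numE ?measure_ge0//; apply: le_lt_trans h1 (ltry _).
exists (fine (mu (hball x r))); last by rewrite fineK.
rewrite -lte_fin -lee_fin fineK//; apply/andP; split; last first.
  by apply: le_trans h1 _; rewrite lee_fin.
apply: lt_le_trans (mu_hball_ge x0 r0).
by rewrite lte_fin exprn_gt0// divr_gt0// mulr_gt0// ltr0n.
Qed.

Variables (a g : V -> R) (D : R).
Hypotheses (D0 : 0 < D) (aD : (bmo_norm a <= D%:E)%E) (mg : measurable_fun setT g)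
  (ag : {ae mu, forall x, H x -> a x = g x}).

(** If the mean of a over the half-ball were infinite, so would be the oscillation, against [aD];
    hence the mean is a real m. *)
Lemma bmo_mean x r : 0 < x `n -> 0 < r -> exists m : R,
  (\int[mu]_(y in hball x r) `|g y - m|%R%:E <= D%:E * mu (hball x r))%E.
Proof.
move=> x0 r0; have [s /andP[s0 _] sE] := mu_hball x0 r0.
have h : (mean mu (hball x r) (fun y => `|(a y)%:E -
    mean mu (hball x r) (EFin \o a)|%E) <= D%:E)%E.
  by apply: le_trans aD; apply: ereal_sup_ubound; exists x; exists r; split.
have inf (f : V -> \bar R) : (forall y, f y = +oo)%E -> mean mu (hball x r) f = +oo%E.
  move=> fy; rewrite /mean (eq_integral (cst +oo%E)); last by move=> y _; exact: fy.
  rewrite integral_cst; last exact: measurable_hball.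
  by rewrite sE gt0_mulye ?lte_fin// inver gt_eqF// gt0_muley// lte_fin invr_gt0.
move: h; case: (mean mu (hball x r) (EFin \o a)) => [m| |] h.
- exists m; move: h.
  rewrite /mean sE inver gt_eqF// lee_pdivrMl// => h.
  rewrite (muleC D%:E); apply: le_trans h.
  rewrite le_eqVlt; apply/orP; left; apply/eqP; apply: ae_eq_integral_gen.
  by apply: filterS ag => y agy [_ Hy]; rewrite agy.
- by move: h; rewrite inf.
- by move: h; rewrite inf.
Qed.

(** The double mean of |g x - g y| over a cube is at most twice the mean of |g - m|. The cube lies
    in a half-ball of measure at most (4N)^N times its own, whence the normalizing constant. *)
Lemma bmo_mean_metric :
  mean_metric (fun x y => `|g x - g y| / (2 * (4 * N%:R) ^+ N * D)).
Proof.
pose k : R := 2 * (4 * N%:R) ^+ N * D.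
have k0 : 0 < k by rewrite !mulr_gt0// exprn_gt0// mulr_gt0// ltr0n.
have ki0 : 0 <= k^-1 by rewrite invr_ge0 ltW.
rewrite -/k; split.
- apply: measurable_funM => //; apply: measurableT_comp => //.
  by apply: measurable_funB; apply: measurableT_comp.
- by move=> x y; rewrite mulr_ge0.
- by move=> x y; rewrite distrC.
- by move=> x y z; rewrite -mulrDl ler_wpM2r// ler_distD.
move=> c l l0 ac.
(* The centre is the upper corner of the cube: unlike c, it always lies in the open half-space. *)
pose z : V := c + const_mx l.
have z0 : 0 < z `n by rewrite !mxE ltr_wpDl.
have r0 : 0 < 2 * N%:R * l by rewrite !mulr_gt0// ltr0n.
have QB : cube c l `<=` hball z (2 * N%:R * l).
  move=> y Qy; split; last by have /andP[h _] := Qy ord_max; exact: le_lt_trans h.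
  apply: (@le_lt_trans _ _ (N%:R * l)); last first.
    by rewrite -mulrA ltr_pMl ?ltr1n// mulr_gt0// ltr0n.
  apply: enorm_le => [|i]; first exact: ltW.
  by rewrite !mxE; have /andP[h1 h2] := Qy i; rewrite ler_norml; lra.
have [m hm] := bmo_mean z0 r0.
have [s /andP[s0 sle] sE] := mu_hball z0 r0.
have mQ := measurable_cube c l.
have mgm : measurable_fun setT (fun y => `|g y - m|).
  by apply: measurableT_comp => //; exact: measurable_funB.
have mgmE : measurable_fun (cube c l) (fun y => `|g y - m|%R%:E).
  by apply: measurable_funTS; exact/measurable_EFinP.
pose I := (\int[mu]_(y in cube c l) `|g y - m|%R%:E)%E.
have I0 : (0 <= I)%E by apply: integral_ge0 => y _; rewrite lee_fin.
have IT : (I <= (D * (4 * N%:R * l) ^+ N)%:E)%E.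
  apply: (@le_trans _ _ (\int[mu]_(y in hball z (2 * N%:R * l)) `|g y - m|%R%:E)%E).
    apply: ge0_subset_integral => //; first exact: measurable_hball.
    by apply: measurable_funTS; exact/measurable_EFinP.
  apply: (le_trans hm); rewrite sE -EFinM lee_fin ler_wpM2l ?(ltW D0)//.
  by apply: (le_trans sle); rewrite (_ : 2 * (2 * N%:R * l) = 4 * N%:R * l)//; ring.
have [i iE] : exists i, I = i%:E.
  by exists (fine I); rewrite fineK// ge0_fin_numE//; apply: le_lt_trans IT (ltry _).
have i0 : 0 <= i by rewrite -lee_fin -iE.
have hi : i <= D * (4 * N%:R * l) ^+ N by rewrite -lee_fin -iE.
have lN : 0 < l ^+ N by rewrite exprn_gt0.
have muQ : mu (cube c l) = (l ^+ N)%:E by rewrite mu_cube// ltW.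
have cstI (t : R) : (\int[mu]_(y in cube c l) t%:E = (t * l ^+ N)%:E)%E.
  by rewrite EFinM -muQ; exact: (integral_cst mu mQ t%:E).
have inner x : (avg (fun x y => (`|g x - g y| / k)%R) c l x <=
    (k^-1 * `|g x - m| + k^-1 * (l ^- N * i))%:E)%E.
  rewrite /avg; apply: (@le_trans _ _ ((l ^- N)%:E *
     \int[mu]_(y in cube c l) ((k^-1)%:E * (`|g x - m|%R%:E + `|g y - m|%R%:E)))%E).
    apply: lee_wpmul2l; first by rewrite lee_fin invr_ge0 ltW.
    apply: le_integral_ge0 => y _; first by rewrite lee_fin mulr_ge0.
    rewrite -EFinD -EFinM lee_fin mulrC ler_wpM2l//.
    by rewrite (distrC (g y)); exact: ler_distD.
  rewrite ge0_integralZl//; last first.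
    by move=> y _; rewrite -EFinD lee_fin addr_ge0.
    apply: emeasurable_funD => //; exact: measurable_cst.
  rewrite ge0_integralD//.
  rewrite cstI -/I iE -EFinD -!EFinM lee_fin.
  rewrite le_eqVlt; apply/orP; left; apply/eqP; field.
  by rewrite gt_eqF// gt_eqF.
apply: (@le_trans _ _ (\int[mu]_(x in cube c l)
    ((k^-1)%:E * `|g x - m|%R%:E + (k^-1 * (l ^- N * i))%:E))%E).
  apply: le_integral_ge0 => x _; last first.
    by apply: le_trans (inner x) _; rewrite -EFinM -EFinD.
  rewrite mule_ge0 ?lee_fin ?invr_ge0 ?(ltW lN)//.
  by apply: integral_ge0 => y _; rewrite lee_fin mulr_ge0.
have j0 : 0 <= k^-1 * (l ^- N * i) by rewrite !mulr_ge0// invr_ge0 ltW.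
rewrite ge0_integralD//; last 2 first.
- by move=> x _; rewrite mule_ge0.
- exact: measurable_funeM.
rewrite ge0_integralZl// cstI -/I iE -!EFinM -EFinD lee_fin.
have -> : k^-1 * i + k^-1 * (l ^- N * i) * l ^+ N = 2 * i / k.
  by field; rewrite !gt_eqF.
rewrite ler_pdivrMr//.
apply: (@le_trans _ _ (2 * (D * (4 * N%:R * l) ^+ N))); first by rewrite ler_pM2l.
by rewrite le_eqVlt; apply/orP; left; apply/eqP; rewrite /k exprMn; ring.
Qed.

End bmo.

Section unit_metric.
Context {R : realType} (n : nat).
Local Notation N := n.+1.
Local Notation V := 'rV[R]_N.
Local Notation mu := (lebesgue_rV N : {measure set V -> \bar R}).

Lemma mean_metric1 : mean_metric (fun _ _ : V => 1 : R).
Proof.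
split => //; first by move=> x y z; rewrite lerDl.
move=> c l l0 _; have muQ : mu (cube c l) = (l ^+ N)%:E by rewrite mu_cube// ltW.
have lN : 0 < l ^+ N by rewrite exprn_gt0.
have mQ := measurable_cube c l.
rewrite (eq_integral (cst 1%E)); last first.
  move=> x _; rewrite /avg (integral_cst _ mQ 1%E) mul1e [X in (_ * X)%E]muQ.
  by rewrite -EFinM mulVf// gt_eqF.
by rewrite integral_cst// mul1e muQ.
Qed.

End unit_metric.

(** * Null sets *)

Section product_null_sets.
Local Open Scope ereal_scope.
Context d1 d2 (T1 : measurableType d1) (T2 : measurableType d2) {R : realType}.

Lemma integral_eq0_ae d (T : measurableType d) (mu : {measure set T -> \bar R})
    (f : T -> \bar R) : measurable_fun setT f -> (forall x, 0 <= f x) ->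
  \int[mu]_x f x = 0 -> {ae mu, forall x, f x = 0}.
Proof.
move=> mf f0 If.
have : \int[mu]_(x in setT) `|f x| = 0.
  by rewrite -[RHS]If; apply: eq_integral => x _; rewrite gee0_abs.
move/(ae_eq_integral_abs mu measurableT mf); apply: filterS => x /(_ I).
exact.
Qed.

Lemma ae_eq0_integral d (T : measurableType d) (mu : {measure set T -> \bar R})
    (f : T -> \bar R) : measurable_fun setT f ->
  {ae mu, forall x, f x = 0} -> \int[mu]_x f x = 0.
Proof.
move=> mf f0; rewrite -(integral0 mu setT); apply: ae_eq_integral => //.
by apply: filterS f0 => x ->.
Qed.

Lemma ae_section (m1 : {measure set T1 -> \bar R})
    (m2 : {sigma_finite_measure set T2 -> \bar R}) (P : T1 * T2 -> Prop) :
  {ae (m1 \x m2), forall z, P z} -> {ae m1, forall x, {ae m2, forall y, P (x, y)}}.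
Proof.
move=> [U [mU U0 hU]].
have : {ae m1, forall x, m2 (xsection U x) = 0}.
  apply: integral_eq0_ae => //; first exact: measurable_fun_xsection.
apply: filterS => x Ux; exists (xsection U x); split => //.
  exact: measurable_xsection.
by move=> y /= nP; rewrite /xsection/= inE; apply: hU.
Qed.

(** The two iterated integrals of the indicator of U agree, by uniqueness of the product measure. *)
Lemma ae_section_swap (m1 : {sigma_finite_measure set T1 -> \bar R})
    (m2 : {sigma_finite_measure set T2 -> \bar R}) (U : set (T1 * T2)) :
  measurable U -> {ae m2, forall y, m1 (ysection U y) = 0} ->
  {ae m1, forall x, m2 (xsection U x) = 0}.
Proof.
move=> mU hU; apply: integral_eq0_ae => //; first exact: measurable_fun_xsection.
have := @product_measure_unique _ _ T1 T2 R m1 m2 (m1 \x^ m2)%E.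
move/(_ (fun A B mA mB => product_measure2E m1 m2 mA mB) _ mU).
rewrite /product_measure1 /product_measure2 /= => ->.
by apply: ae_eq0_integral => //; exact: measurable_fun_ysection.
Qed.

End product_null_sets.

(** * Invariance of null sets under y -> d - y *)

Section reflection.
Context {R : realType}.

Definition reflection (d : R) (t : measurableTypeR R) : measurableTypeR R := d - t.

Lemma measurable_reflection d : measurable_fun setT (reflection d).
Proof. by apply: measurable_funB => //; exact: measurable_cst. Qed.

HB.instance Definition _ d := isMeasurableFun.Build _ _ _ _ (reflection d)
  (measurable_reflection d).

Lemma lebesgue_reflection (d : R) (A : set (measurableTypeR R)) : measurable A ->
  lebesgue_measure A = lebesgue_measure (reflection d @^-1` A).
Proof.
apply: (lebesgue_measure_unique (mu := pushforward lebesgue_measure (reflection d))).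
move=> X /ocitvP[->|[[a b] /= ab ->]]; first by rewrite !measure0.
rewrite /pushforward (_ : _ @^-1` _ = `[d - b, d - a[%classic); last first.
  apply/seteqP; split => t /=; rewrite /reflection !in_itv/= => /andP[h1 h2];
    by apply/andP; split; lra.
rewrite (lebesgue_measure_itv `]a, b]) (lebesgue_measure_itv `[d - b, d - a[) /= !lte_fin.
by rewrite ltrD2l ltrN2 ab -!EFinD; congr EFin; ring.
Qed.

Lemma measurable_reflect n (d : 'rV[R]_n) (A : set 'rV[R]_n) : measurable A ->
  measurable [set y : 'rV[R]_n | A (d - y)].
Proof.
move=> mA; rewrite -[X in measurable X]setTI.
have : measurable_fun setT (fun y : 'rV[R]_n => d - y).
  apply: measurable_fun_rV => i.
  rewrite (_ : (fun y => _) = fun y : 'rV[R]_n => d ord0 i - y ord0 i).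
    by apply: measurable_funB => //; exact: measurable_coord.
  by apply/funext => y; rewrite !mxE.
by move=> /(_ measurableT A mA).
Qed.

(** Induction on the dimension by slices over the first coordinate: almost every slice of A is null,
    the reflection on the line preserves Lebesgue measure, and the induction hypothesis reflects the
    slices. *)
Lemma lebesgue_rV_reflect0 n (d : 'rV[R]_n) (A : set 'rV[R]_n) : measurable A ->
  lebesgue_rV n A = 0%E -> lebesgue_rV n [set y : 'rV[R]_n | A (d - y)] = 0%E.
Proof.
elim: n d A => [|n IH] d A mA.
  by move=> <-; congr (lebesgue_rV 0 _); apply/seteqP; split => y /=;
    rewrite [y]thinmx0 [d]thinmx0 subr0.
rewrite /= /lebesgue_step /pushforward => A0.
have mC (B : set 'rV[R]_n.+1) : measurable B -> measurable (@rV_cons R n @^-1` B).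
  by move=> mB; rewrite -[X in measurable X]setTI; exact: measurable_rV_cons.
have mS (B : set 'rV[R]_n.+1) : measurable B -> measurable_fun setT
    (fun t => lebesgue_rV n (xsection (@rV_cons R n @^-1` B) t)).
  by move=> mB; apply: measurable_fun_xsection; exact: mC.
have mA' := measurable_reflect d mA.
set f := fun t => lebesgue_rV n (xsection (@rV_cons R n @^-1` A) t).
have f0 : {ae lebesgue_measure, forall t, f t = 0%E}.
  by apply: integral_eq0_ae => //; exact: mS.
apply: ae_eq0_integral; first exact: mS.
case: f0 => [Z [mZ Z0 hZ]].
exists (reflection (d ord0 ord0) @^-1` Z); split.
- by rewrite -[X in measurable X]setTI; exact: measurable_reflection.
- exact: etrans (esym (lebesgue_reflection _ mZ)) Z0.
move=> t /= ht; apply: hZ => /= ft; apply: ht.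
rewrite /= in ft.
pose d' : 'rV[R]_n := \row_i d ord0 (lift ord0 i).
rewrite -(IH d' _ _ ft); last by apply: measurable_xsection; exact: mC.
have E z : d - rV_cons (t, z) = rV_cons (reflection (d ord0 ord0) t, d' - z).
  apply/rowP => i; rewrite !mxE; case: splitP => j ij; rewrite !mxE.
    by congr (d _ _ - _); apply: ord_inj; rewrite ij [j]ord1.
  by congr (d _ _ - _); apply: ord_inj; rewrite ij lift0.
by congr (lebesgue_rV n _); apply/seteqP; split => z /=;
  rewrite /xsection/= !inE/= E.
Qed.

Lemma ae_reflect n (d : 'rV[R]_n) (P : 'rV[R]_n -> Prop) :
  {ae lebesgue_rV n, forall y, P y} -> {ae lebesgue_rV n, forall y, P (d - y)}.
Proof.
move=> [A [mA A0 hA]]; exists [set y | A (d - y)]; split.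
- exact: measurable_reflect.
- exact: lebesgue_rV_reflect0.
- by move=> y; exact: hA.
Qed.

End reflection.

(** * Bounds on the kernel *)

Section kernel_bound.
Context {R : realType} (n : nat).
Local Notation N := n.+1.
Local Notation V := 'rV[R]_N.
Local Notation mu := (lebesgue_rV N).
Implicit Types (x y xi : V).

Lemma continuous_enorm : continuous (@enorm R N).
Proof.
have cs s : continuous (fun y : V => \sum_(i <- s) y ord0 i ^+ 2).
  elim: s => [|i s IH] x.
    rewrite (_ : (fun y : V => _) = cst 0); first exact: cst_continuous.
    by apply/funext => y; rewrite big_nil.
  rewrite (_ : (fun y : V => _) =
    (fun y : V => y ord0 i ^+ 2) \+ (fun y => \sum_(i <- s) y ord0 i ^+ 2)).
    apply: continuousD; last exact: IH.
    apply: (@continuous_comp _ _ _ (fun y : V => y ord0 i) (fun t : R => t ^+ 2)).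
      exact: coord_continuous.
    exact: exprn_continuous.
  by apply/funext => y; rewrite big_cons.
move=> x; apply: (@continuous_comp _ _ _ (fun y : V => \sum_i y ord0 i ^+ 2) (@Num.sqrt R)).
  exact: cs.
exact: sqrt_continuous.
Qed.

Lemma enorm_eq0 x : (enorm x == 0) = (x == 0).
Proof.
apply/eqP/eqP => [x0|->]; last first.
  by rewrite /enorm big1 ?sqrtr0// => i _; rewrite mxE expr0n.
apply/rowP => i; rewrite mxE; apply/eqP; rewrite -normr_le0 -x0.
exact: enorm_coord.
Qed.

Lemma enorm_gt0 x : (0 < enorm x) = (x != 0).
Proof. by rewrite lt_neqAle enorm_ge0 andbT eq_sym enorm_eq0. Qed.

Lemma enormZ t x : 0 <= t -> enorm (t *: x) = t * enorm x.
Proof.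
move=> t0; rewrite /enorm (eq_bigr (fun i => t ^+ 2 * x ord0 i ^+ 2)); last first.
  by move=> i _; rewrite mxE exprMn.
by rewrite -mulr_sumr sqrtrM ?sqr_ge0// sqrtr_sqr ger0_norm.
Qed.

Lemma nbhs_cube x (U : set V) : nbhs x U -> exists2 l : R, 0 < l & cube x l `<=` U.
Proof.
move=> /nbhs_ballP[e /= e0 h]; exists (e / 2); first by rewrite divr_gt0.
move=> y Qy; apply: h; split => // i j; rewrite [i]ord1 /ball/= /ball_/=.
have /andP[h1 h2] := Qy j.
by rewrite ltr_norml; apply/andP; split; lra.
Qed.

Variable K : V -> V -> R.
Hypothesis K_cz : cz_kernel K.

Let sigma := @surface_measure R N.

Lemma kernel_le_sphere : exists2 M : R, 0 <= M &
  {ae (mu \x^ sigma)%E, forall z, `|K z.1 z.2| <= M}.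
Proof.
have [_ _ [M hM]] := K_cz.
have E0 x : multi_partial (fun _ : 'I_N => 0%N) (K x) = K x.
  rewrite /multi_partial (_ : flatten _ = [::])//.
  by elim: (enum 'I_N) => //=.
have s0 : (\sum_(i < N) 0 <= 2 * N)%N by rewrite big1.
have := hM (fun=> 0%N) s0.
(* The norm of exponent +oo is 0 by convention if the whole space has measure 0; in that case every
   property holds almost everywhere. *)
rewrite Lnorm.unlock /=; case: ifPn => [_ h|h _]; last first.
  exists 0 => //; exists setT; split => //.
  by apply/eqP; rewrite eq_le measure_ge0 andbT leNgt.
exists (Num.max M 0); first by rewrite le_max lexx orbT.
move/ess_supP: h; apply: filterS => z /=.
by rewrite E0 lee_fin le_max => ->.
Qed.

(** Surface measure is N times the image of Lebesgue measure on the annulus under [direction], so a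
    null set of directions pulls back to a null set of the annulus. [ae_section_swap] then turns the
    statement for almost every xi into one for almost every x. *)
Lemma kernel_le_annulus : exists2 M : R, 0 <= M &
  {ae mu, forall x, exists2 U : set V, (measurable U /\ mu U = 0%E) &
    forall xi, 0 < enorm xi < 1 -> ~ U xi -> `|K x (direction xi)| <= M}.
Proof.
have [M M0 [U [mU U0 hU]]] := kernel_le_sphere; exists M => //.
pose f xi := mu (ysection U xi).
have mf : measurable_fun setT f by exact: measurable_fun_ysection.
pose Z := f @^-1` ~` [set 0%E].
have mZ : measurable Z.
  by rewrite -[X in measurable X]setTI; apply: mf => //; apply: measurableC; exact: emeasurable_set1.
have mann := @measurable_annulus R N.
have mdZ (W : set V) : measurable W -> measurable (@direction R N @^-1` W).
  by move=> mW; rewrite -[X in measurable X]setTI; exact: measurable_direction.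
have Z0 : mu (@direction R N @^-1` Z `&` [set x : V | 0 < enorm x < 1]) = 0%E.
  have [W [mW W0 hW]] : {ae sigma, forall xi, f xi = 0%E}.
    by apply: integral_eq0_ae => //; exact: U0.
  have W1 : mu (@direction R N @^-1` W `&` [set x : V | 0 < enorm x < 1]) = 0%E.
    move/eqP: W0; rewrite /sigma /surface_measure /mscale/= mule_eq0 eqe pnatr_eq0/=.
    by move/eqP.
  apply/eqP; rewrite eq_le measure_ge0 andbT -W1; apply: le_measure; rewrite ?inE.
  - by apply: measurableI => //; exact: mdZ.
  - by apply: measurableI => //; exact: mdZ.
  - by move=> y [Zy ay]; split => //; exact: hW.
pose U' := [set z : V * V | 0 < enorm z.2 < 1 /\ U (z.1, direction z.2)].
have mU' : measurable U'.
  have -> : U' = (snd @^-1` [set x : V | 0 < enorm x < 1]) `&`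
      ((fun z : V * V => (z.1, direction z.2)) @^-1` U) by [].
  apply: measurableI; rewrite -[X in measurable X]setTI.
    exact: measurable_snd.
  have : measurable_fun setT (fun z : V * V => (z.1, direction z.2)).
    apply: measurable_fun_pair; first exact: measurable_fst.
    exact: (measurableT_comp (@measurable_direction R N) measurable_snd).
  by apply.
have := @ae_section_swap _ _ V V R mu mu U' mU'.
have hU' : {ae mu, forall y, mu (ysection U' y) = 0%E}.
  exists (@direction R N @^-1` Z `&` [set x : V | 0 < enorm x < 1]); split => //.
    by apply: measurableI => //; exact: mdZ.
  move=> y /= ny; have ay : 0 < enorm y < 1.
    apply: contrapT => nay; apply: ny; rewrite (_ : ysection U' y = set0) ?measure0//.
    by apply/seteqP; split => // x; rewrite /ysection/= inE => -[].
  split => //= fy; apply: ny; rewrite -[RHS]fy; congr (mu _).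
  by apply/seteqP; split => x; rewrite /ysection/= !inE => // -[].
move=> /(_ hU'); apply: filterS => x hx.
exists (xsection U' x); first by split => //; exact: measurable_xsection.
move=> xi xi1 nU; apply: contrapT => h; apply: nU; rewrite /xsection/= inE; split => //.
exact: hU.
Qed.

(* Continuity of K x turns the almost everywhere bound on the annulus into a bound
   at every point. *)
Lemma kernel_bound : exists2 M : R, 0 <= M &
  {ae mu, forall x xi, xi != 0 -> `|K x xi| <= M * enorm xi ^- N}.
Proof.
have [M M0 h] := kernel_le_annulus; exists M => //.
have [_ hK _] := K_cz.
apply: filterS2 h hK => x [U [mU U0] hU] [sm hom _ _] xi xi0.
have e0 : 0 < enorm xi by rewrite enorm_gt0.
have Kd z : z != 0 -> K x (direction z) = enorm z ^+ N * K x z.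
  move=> z0; rewrite /direction hom//; last by rewrite invr_gt0 enorm_gt0.
  by rewrite -exprVn invrK.
rewrite leNgt; apply/negP => hlt.
(* The quantity |K x z| |z|^N is homogeneous of degree 0, so xi may be rescaled to norm 1/2, in the
   interior of the annulus. By continuity the reverse inequality would hold on a whole cube around
   it, and that cube would be contained in the null set U. *)
pose eta := (2 * enorm xi)^-1 *: xi.
have t0 : 0 < (2 * enorm xi)^-1 by rewrite invr_gt0 mulr_gt0.
have eta0 : eta != 0 by rewrite scaler_eq0 negb_or gt_eqF.
have enormeta : enorm eta = 2^-1.
  by rewrite enormZ ?ltW// invfM -mulrA mulVf ?mulr1// gt_eqF.
have K1 : M < `|K x eta| * enorm eta ^+ N.
  rewrite enormeta hom// -exprVn invrK normrM ger0_norm ?exprn_ge0 ?mulr_ge0 ?enorm_ge0//.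
  rewrite mulrAC -exprMn mulrAC divff// mul1r.
  by rewrite -ltr_pdivrMl ?exprn_gt0// mulrC.
have cK : {for eta, continuous (K x)} by have [] := sm [::] eta eta0.
have cv : (fun z => `|K x z| * enorm z ^+ N) @ eta --> `|K x eta| * enorm eta ^+ N.
  apply: (@continuousM R V (fun z => `|K x z|) (fun z => enorm z ^+ N) eta).
    apply: (@continuous_comp _ _ _ (K x) (fun t : R => `|t|)); first exact: cK.
    exact: norm_continuous.
  apply: (@continuous_comp _ _ _ (@enorm R N) (fun t : R => t ^+ N)).
    exact: continuous_enorm.
  exact: exprn_continuous.
have ce := @continuous_enorm eta.
have e1 : 0 < enorm eta by rewrite enormeta.
have e2 : enorm eta < 1 by rewrite enormeta invf_lt1// ltr1n.
have [l1 l10 h1] := nbhs_cube (cvgr_gt _ cv _ K1).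
have [l2 l20 h2] := nbhs_cube (cvgr_gt _ ce _ e1).
have [l3 l30 h3] := nbhs_cube (cvgr_lt _ ce _ e2).
pose l := Num.min l1 (Num.min l2 l3).
have l0 : 0 < l by rewrite !lt_min l10 l20.
have sub l' : l <= l' -> cube eta l `<=` cube eta l'.
  by move=> ll z Qz i; have /andP[-> zi] := Qz i; apply: le_trans zi _; rewrite lerD2l.
have Ql z : cube eta l z -> 0 < enorm z < 1 /\ M < `|K x z| * enorm z ^+ N.
  move=> Qz; split; last by apply: h1; apply: sub Qz; rewrite ge_min lexx.
  apply/andP; split; [apply: h2|apply: h3]; apply: sub Qz; by rewrite !ge_min lexx !orbT.
have QU : cube eta l `<=` U.
  move=> z /Ql[z1 z2]; apply: contrapT => nU; have := hU _ z1 nU.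
  have z0 : z != 0 by rewrite -enorm_gt0; case/andP: z1.
  rewrite Kd// normrM ger0_norm ?exprn_ge0 ?enorm_ge0// mulrC leNgt z2//.
have : (mu (cube eta l) <= 0)%E.
  by rewrite -U0; apply: le_measure; rewrite ?inE//; exact: measurable_cube.
have -> : mu (cube eta l) = (l ^+ N)%:E by exact: mu_cube (ltW l0).
by rewrite lee_fin leNgt exprn_gt0.
Qed.

End kernel_bound.

(** * Distance to the generalized reflection *)

Section generalized_reflection.
Context {R : realType} (n : nat).
Local Notation N := n.+1.
Local Notation V := 'rV[R]_N.
Local Notation mu := (lebesgue_rV N).
Local Notation H := (@halfspace R n).
Implicit Types (x y xi : V) (A : V -> 'M[R]_N) (B : 'M[R]_N).
Local Notation "x `n" := ((x : V) ord0 ord_max) (at level 2, format "x `n").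

Lemma quadratic_formE B xi :
  \sum_i \sum_j B i j * xi ord0 i * xi ord0 j = (xi *m B *m xi^T) ord0 ord0.
Proof.
rewrite mxE exchange_big; apply: eq_bigr => j _; rewrite !mxE mulr_suml.
by apply: eq_bigr => i _; rewrite (mulrC (xi _ _)).
Qed.

Lemma sqr_enormE xi : enorm xi ^+ 2 = (xi *m 1%:M *m xi^T) ord0 ord0.
Proof.
by rewrite sqr_enorm mulmx1 mxE; apply: eq_bigr => i _; rewrite mxE expr2.
Qed.

Let e (i : 'I_N) : V := delta_mx ord0 i.

Lemma bilinear_deltaE B i j : (e i *m B *m (e j)^T) ord0 ord0 = B i j.
Proof. by rewrite -rowE trmx_delta -colE !mxE. Qed.

Let bilinearDl B (s : R) (u v z : V) :
  ((u + s *: v) *m B *m z^T) ord0 ord0 =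
  (u *m B *m z^T) ord0 ord0 + s * (v *m B *m z^T) ord0 ord0.
Proof.
rewrite mulmxDl -scalemxAl mulmxDl -scalemxAl.
by move: (u *m B *m _) (v *m B *m _) => P Q; rewrite !mxE.
Qed.

Let bilinearDr B (s : R) (u v z : V) :
  (z *m B *m (u + s *: v)^T) ord0 ord0 =
  (z *m B *m u^T) ord0 ord0 + s * (z *m B *m v^T) ord0 ord0.
Proof.
rewrite linearD/= linearZ/= mulmxDr -scalemxAr.
by move: (_ *m B *m u^T) (_ *m B *m v^T) => P Q; rewrite !mxE.
Qed.

Let bilinearD B i j (s : R) : ((e i + s *: e j) *m B *m (e i + s *: e j)^T) ord0 ord0 =
  B i i + s * (B i j + B j i) + s ^+ 2 * B j j.
Proof. by rewrite bilinearDl !bilinearDr !bilinear_deltaE; ring. Qed.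

(** The diagonal entries are values of the quadratic form at unit vectors. Its values at e_n + e_i
    and e_n - e_i bound the entry of index (n, i) from above and from below, as the diagonal entries
    are positive. *)
Lemma elliptic_row (Lambda : R) A : 0 < Lambda -> elliptic Lambda A ->
  {ae mu, forall x, H x -> Lambda^-1 <= A x ord_max ord_max /\
     forall i, `|A x ord_max i| <= Lambda}.
Proof.
move=> L0 [_ symA ell]; apply: filterS ell => x + Hx => /(_ Hx) h.
have Li0 : 0 < Lambda^-1 by rewrite invr_gt0.
have hB xi : Lambda^-1 * (xi *m 1%:M *m xi^T) ord0 ord0 <= (xi *m A x *m xi^T) ord0 ord0 <=
    Lambda * (xi *m 1%:M *m xi^T) ord0 ord0.
  by rewrite -sqr_enormE -quadratic_formE.
have dg i : Lambda^-1 <= A x i i <= Lambda.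
  by have := hB (e i); rewrite !bilinear_deltaE mxE eqxx !mulr1.
split; first by have /andP[] := dg ord_max.
move=> i; have [->|ni] := eqVneq i ord_max.
  by have /andP[h1 h2] := dg ord_max; rewrite ger0_norm// (le_trans _ h1)// ltW.
have sym : A x i ord_max = A x ord_max i by rewrite -[in LHS]symA// mxE.
have d1 := dg i; have d2 := dg ord_max.
have q1 := hB (e ord_max + 1 *: e i); have q2 := hB (e ord_max + (-1) *: e i).
move: q1 q2; rewrite !bilinearD !mxE !eqxx (negbTE ni) eq_sym (negbTE ni) sym.
move: d1 d2 Li0 L0; move: (A x ord_max i) (A x i i) (A x ord_max ord_max) Lambda^-1 => a b d L.
rewrite /= !mulr1n !mulr0n => /andP[? ?] /andP[? ?] ? ? /andP[? ?] /andP[? ?].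
by rewrite ler_norml; apply/andP; split; lra.
Qed.

(** As v_n = 1, the reflected point has last coordinate -x_n, so E is at least x_n + y_n. The
    reflection moves x by at most 2 x_n N m <= 2 N m E, which bounds |x - y|. *)
Lemma tau_le_reflection (m : R) (v : V) x y : 0 <= m -> v `n = 1 ->
  (forall i, `|v ord0 i| <= m) -> H x -> H y ->
  tau x y <= (2 + 2 * N%:R * m) * enorm (x - (2 * x `n) *: v - y).
Proof.
move=> m0 vn vm Hx Hy; set E := enorm _.
have h1 : x `n + y `n <= E.
  apply: le_trans (enorm_coord _ ord_max); rewrite !mxE vn mulr1.
  have -> : x `n - 2 * x `n - y `n = - (x `n + y `n) by ring.
  by rewrite normrN ler_norm.
have h2 : enorm (x - y) <= E + 2 * x `n * (N%:R * m).
  have -> : x - y = (x - (2 * x `n) *: v - y) + (2 * x `n) *: v.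
    by rewrite addrAC subrK.
  apply: le_trans (enormD _ _) _; rewrite lerD2l enormZ ?mulr_ge0 ?(ltW Hx)//.
  by rewrite ler_wpM2l ?mulr_ge0 ?(ltW Hx)//; exact: enorm_le.
have Hx' : 0 < x `n := Hx; have Hy' : 0 < y `n := Hy.
have N0 : 0 <= N%:R * m by rewrite mulr_ge0.
rewrite /tau -/E; move: h1 h2 N0 Hx' Hy'.
rewrite -[2 * N%:R * m]mulrA.
move: (enorm (x - y)) (x `n) (y `n) E (N%:R * m) => a b d E k; nra.
Qed.

End generalized_reflection.

(** * Borel version of the reflected kernel *)

Section kernel_version.
Context {R : realType} (n : nat).
Local Notation N := n.+1.
Local Notation V := 'rV[R]_N.
Local Notation mu := (lebesgue_rV N).
Local Notation H := (@halfspace R n).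
Implicit Types (x y xi : V) (A : V -> 'M[R]_N).
Local Notation "x `n" := ((x : V) ord0 ord_max) (at level 2, format "x `n").

Lemma borel_reflection (Lambda : R) A : 0 < Lambda -> elliptic Lambda A ->
  exists2 T : V -> V, measurable_fun setT T &
    {ae mu, forall x, H x -> refl A x = T x}.
Proof.
move=> L0 ell; have [mA _ _] := ell.
have [g hg] := choice (fun i => ex_borel_version (mA ord_max i)).
exists (fun x => \row_i (x ord0 i - 2 * x `n * (g ord_max x `^ (-1) * g i x))).
  apply: measurable_fun_rV => i.
  rewrite (_ : (fun x => _) = fun x : V => x ord0 i - 2 * x `n * (g ord_max x `^ (-1) * g i x)); last first.
    by apply/funext => x; rewrite mxE.
  apply: measurable_funB; first exact: measurable_coord.
  apply: measurable_funM.
    by apply: measurable_funM => //; exact: measurable_coord.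
  apply: measurable_funM; last exact: (hg i).1.
  apply: (@measurableT_comp _ _ _ _ _ _ (fun t : R => t `^ (-1))).
    exact: measurable_powR.
  exact: (hg ord_max).1.
have gA : {ae mu, forall x, forall i, H x -> A x ord_max i = g i x}.
  by apply: filter_forall => i; exact: (hg i).2.
apply: filterS2 gA (elliptic_row L0 ell) => x gx + Hx => /(_ Hx)[An _].
rewrite /refl /refl_at; apply/rowP => i; rewrite !mxE !gx// powR_inv1//.
by rewrite -gx// (le_trans _ An)// invr_ge0 ltW.
Qed.

Variable K : V -> V -> R.
Hypothesis K_cz : cz_kernel K.

Lemma borel_kernel : exists2 g : V * V -> R, measurable_fun setT g &
  {ae mu, forall x, {ae mu, forall xi, xi != 0 -> K x xi = g (x, xi)}}.
Proof.
have [[g mg gK] _ _] := K_cz.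
pose D := [set z : V * V | z.2 != 0].
have mD : measurable D.
  rewrite (_ : D = (fun z : V * V => enorm z.2) @^-1` `]0, +oo[%classic); last first.
    by apply/seteqP; split => z; rewrite /D /= in_itv/= andbT enorm_gt0.
  rewrite -[X in measurable X]setTI.
  exact: (measurableT_comp (@measurable_enorm R N) measurable_snd).
exists (g \_ D); first exact: ((measurable_restrictT _ mD).1 mg).
apply: filterS (ae_section gK) => x; apply: filterS => xi h xi0.
by rewrite patchE mem_set// h.
Qed.

Lemma kernel_version (Lambda : R) : 0 < Lambda -> exists2 c : R, 0 < c &
  forall A, elliptic Lambda A -> exists Q : V * V -> R, [/\ measurable_fun setT Q,
    forall x y, H x -> H y -> `|Q (x, y)| <= c * kap x y &
    {ae mu, forall x, H x -> {ae mu, forall y, H y -> K x (refl A x - y) = Q (x, y)}}].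
Proof.
move=> L0; have [M M0 hM] := kernel_bound K_cz.
have [g mg gK] := borel_kernel.
pose m := 1 + Lambda ^+ 2.
have m0 : 0 <= m by rewrite addr_ge0// sqr_ge0.
pose Cr := 2 + 2 * N%:R * m.
have Cr0 : 0 < Cr by rewrite ltr_wpDr// !mulr_ge0.
pose c := (M + 1) * Cr ^+ N.
have c0 : 0 < c by rewrite mulr_gt0 ?exprn_gt0// ltr_wpDl.
exists c => // A ell; have [T mT hT] := borel_reflection L0 ell.
pose G (u : V * V) := g (u.1, T u.1 - u.2).
have mG : measurable_fun setT G.
  apply: (measurableT_comp mg); apply: measurable_fun_pair; first exact: measurable_fst.
  apply: measurable_fun_rV => i.
  rewrite (_ : (fun u : V * V => _) = fun u => T u.1 ord0 i - u.2 ord0 i); last first.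
    by apply/funext => u; rewrite !mxE.
  apply: measurable_funB.
    exact: (measurableT_comp (@measurable_coord R N i) (measurableT_comp mT measurable_fst)).
  exact: (measurableT_comp (@measurable_coord R N i) measurable_snd).
(* The truncation makes the bound hold at every pair of points; for almost every x it changes the
   kernel only on a null set of y, by [kernel_bound] and [tau_le_reflection]. *)
exists (fun u => if `|G u| <= c * kap u.1 u.2 then G u else 0); split.
- apply: measurable_fun_ifT => //; apply: measurable_fun_ler.
    exact: measurableT_comp.
  by apply: measurable_funM => //; exact: measurable_kap.
- by move=> x y Hx Hy /=; case: ifPn => //; rewrite normr0 mulr_ge0 ?powR_ge0// ltW.
have hTR : {ae mu, forall x, H x -> [/\ refl A x = T x,
    Lambda^-1 <= A x ord_max ord_max & forall i, `|A x ord_max i| <= Lambda]}.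
  apply: filterS2 hT (elliptic_row L0 ell) => x Tx Rx Hx.
  by have [An Ai] := Rx Hx; split => //; exact: Tx.
apply: filterS3 hM gK hTR => x Mx gx /[swap] Hx /(_ Hx)[Tx An Ai].
have An0 : 0 < A x ord_max ord_max by apply: lt_le_trans An; rewrite invr_gt0.
pose v : V := (A x ord_max ord_max)^-1 *: row ord_max (A x).
have vn : v `n = 1 by rewrite !mxE mulVf// gt_eqF.
have vm i : `|v ord0 i| <= m.
  rewrite !mxE normrM gtr0_norm ?invr_gt0//.
  apply: (@le_trans _ _ (Lambda * Lambda)); last by rewrite /m expr2 lerDr.
  apply: ler_pM => //; first by rewrite invr_ge0 ltW.
  by rewrite -[leRHS]invrK lef_pV2 ?posrE ?invr_gt0.
(* For fixed x, the exceptional arguments xi of [K] become the points y = T x - xi, again a null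
   set. *)
have ae1 := ae_reflect (T x) gx.
apply: filterS ae1 => y hy Hy.
have tl : tau x y <= Cr * enorm (refl A x - y) by exact: tau_le_reflection.
have t0 : 0 < tau x y by exact: tau_gt0.
have E0 : 0 < enorm (refl A x - y).
  by rewrite -(@pmulr_rgt0 _ Cr)//; exact: lt_le_trans tl.
have ne : refl A x - y != 0 by rewrite -enorm_gt0.
have KG : K x (refl A x - y) = G (x, y).
  by rewrite /G /= -hy -Tx.
rewrite -KG ifT//= kapE//.
apply: (le_trans (Mx _ ne)).
apply: (@le_trans _ _ (M * (Cr ^+ N * tau x y ^- N))).
  apply: ler_wpM2l => //.
  rewrite -lef_pV2 ?posrE ?invr_gt0 ?mulr_gt0 ?invr_gt0 ?exprn_gt0//.
  rewrite invfM !invrK ler_pdivrMl ?exprn_gt0// -exprMn.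
  by rewrite lerXn2r ?nnegrE ?(ltW t0)// mulr_ge0 ?ltW.
rewrite /c -mulrA ler_wpM2r//; last by rewrite lerDl.
by rewrite mulr_ge0 ?invr_ge0 ?exprn_ge0 ?(ltW Cr0) ?(ltW t0).
Qed.

End kernel_version.

(** * The operators *)

Section operator_bounds.
Context {R : realType} (n : nat).
Local Notation N := n.+1.
Local Notation V := 'rV[R]_N.
Local Notation mu := (lebesgue_rV N : {measure set V -> \bar R}).
Local Notation H := (@halfspace R n).
Implicit Types (x y : V) (f a : V -> R).
Variables (p : R) (phi : V -> R -> R).
Hypotheses (p1 : 1 < p) (phi_gt0 : forall x r, 0 < r -> 0 < phi x r).

Definition bounded_op w (q : V -> V -> R) (k : \bar R) : Prop :=
  [/\ forall f, morrey p phi w f -> {ae mu, forall x, H x ->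
        ae_integrable mu H (fun y => q x y * f y)},
      morrey_continuous p phi w (integral_op q) &
      forall f, morrey p phi w f ->
        (morrey_norm p phi w (integral_op q f) <= k * morrey_norm p phi w f)%E].

Lemma bounded_op_ae_weight w v q k : {ae mu, forall x, w x = v x} ->
  bounded_op v q k -> bounded_op w q k.
Proof.
move=> wv.
have En : morrey_norm p phi w = morrey_norm p phi v.
  by apply/funext => f; exact: morrey_norm_ae_weight.
have Em : morrey p phi w = morrey p phi v.
  have E f D : (\int[mu]_(y in D) (`|f y| `^ p * w y)%:E =
      \int[mu]_(y in D) (`|f y| `^ p * v y)%:E)%E.
    by apply: ae_eq_integral_gen; apply: filterS wv => y -> _.
  apply/funext => f; apply/propext; rewrite /morrey En.
  by split => -[mf h foo]; split => // D cD DH; have := h D cD DH; rewrite E.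
by rewrite /bounded_op /morrey_continuous En Em.
Qed.

(** C is chosen before the kernel and the pseudometric, so one constant serves both operators, every
    elliptic matrix and every a. *)
Lemma integral_op_bounded w : Ap_weight p w -> phi_condition p w phi ->
  exists2 C : R, 0 < C & forall (c : R) b (Q : V * V -> R) q, 0 < c -> mean_metric b ->
    measurable_fun setT Q ->
    (forall x y, H x -> H y -> `|Q (x, y)| <= c * (kap x y * b x y)) ->
    {ae mu, forall x, H x -> {ae mu, forall y, H y -> q x y = Q (x, y)}} ->
    bounded_op w q (C * c)%:E.
Proof.
move=> wP phi_cond.
have [C C0 hC] := major_local p1 phi_gt0 wP phi_cond.
exists C; first exact: C0.
move=> c b Q q c0 bP mQ Qle qQ.
split.
- exact: (integral_op_integrable p1 phi_gt0 wP phi_cond c0 bP mQ Qle qQ).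
- exact: (integral_op_continuous p1 phi_gt0 wP phi_cond c0 bP mQ Qle qQ C0 hC).
- exact: (integral_op_norm p1 phi_gt0 wP c0 bP mQ Qle qQ C0 hC).
Qed.

Lemma bmo_norm_ge0 a : (0 <= bmo_norm a)%E.
Proof.
apply: ereal_sup_ge; eexists; first by exists 0; exists 1; split; [exact: ltr01|reflexivity].
by rewrite /mean mule_ge0 ?inve_ge0 ?measure_ge0//; apply: integral_ge0.
Qed.

Lemma bounded_op_weaken w q (k m : R) : k <= m ->
  bounded_op w q k%:E -> bounded_op w q m%:E.
Proof.
move=> km [h1 h2 h3]; split => // f fM; apply: le_trans (h3 f fM) _.
by apply: lee_wpmul2r; rewrite ?lee_fin//; exact: morrey_norm_ge0.
Qed.

End operator_bounds.

Unset Implicit Arguments.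

Theorem theorem2 (R : realType) (n : nat) (p Lambda : R)
    (w : 'rV[R]_n.+1 -> R) (phi : 'rV[R]_n.+1 -> R -> R)
    (K : 'rV[R]_n.+1 -> 'rV[R]_n.+1 -> R)
    (p_gt1 : 1 < p) (Lambda_gt0 : 0 < Lambda)
    (w_Ap : in_Ap p w) (phi_w : phi_weight phi)
    (phi_cond : phi_condition p w phi) (K_cz : cz_kernel K) :
  exists C : R,
    forall A : 'rV[R]_n.+1 -> 'M[R]_n.+1, elliptic Lambda A ->
    [/\ forall f, morrey p phi w f ->
          {ae lebesgue_rV n.+1, forall x, @halfspace R n x ->
            ae_integrable (lebesgue_rV n.+1) (@halfspace R n)
              (Kt_integrand K A f x)},
        morrey_continuous p phi w (Kt K A) &
        forall f, morrey p phi w f ->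
          (morrey_norm p phi w (Kt K A f)
             <= C%:E * Ap_const p w `^ p^-1 * morrey_norm p phi w f)%E] /\
    forall a, BMO a ->
    [/\ forall f, morrey p phi w f ->
          {ae lebesgue_rV n.+1, forall x, @halfspace R n x ->
            ae_integrable (lebesgue_rV n.+1) (@halfspace R n)
              (Ct_integrand K A a f x)},
        morrey_continuous p phi w (Ct K A a) &
        forall f, morrey p phi w f ->
          (morrey_norm p phi w (Ct K A a f)
             <= C%:E * Ap_const p w `^ p^-1 * bmo_norm a
                * morrey_norm p phi w f)%E].
Proof.
have [phi_gt0 _ _] := phi_w.
have [v vP wv] := Ap_weight_exists p_gt1 w_Ap.
have [k0 k00 kE] := Ap_const_gt0 p_gt1 w_Ap.
have phi_cond_v : phi_condition p v phi.
  by move: phi_cond; rewrite /phi_condition (ae_wmeasure wv).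
have [C1 C10 hC1] := integral_op_bounded p_gt1 phi_gt0 vP phi_cond_v.
have [c c0 hc] := kernel_version K_cz Lambda_gt0.
pose kb : R := 2 * (4 * n.+1%:R) ^+ n.+1.
have kb0 : 0 < kb by rewrite mulr_gt0// exprn_gt0// mulr_gt0// ltr0n.
have kp : 0 < k0 `^ p^-1 by rewrite powR_gt0.
(* The sum 1 + kb covers both choices of b: the constant 1 needs the factor 1, and the oscillation
   of a needs its normalization kb. The division cancels the factor [w]^(1/p) of the statement. *)
exists (C1 * c * (1 + kb) / k0 `^ p^-1) => A ell.
have [Q [mQ Qle hQ]] := hc A ell.
have -> : ((C1 * c * (1 + kb) / k0 `^ p^-1)%:E * Ap_const p w `^ p^-1 =
    (C1 * c * (1 + kb))%:E)%E.
  by rewrite kE poweR_EFin -EFinM divfK// gt_eqF.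
have cc : 0 < C1 * c by rewrite mulr_gt0.
split.
  suff : bounded_op p phi w (fun x y => K x (refl A x - y)) (C1 * c * (1 + kb))%:E by [].
  apply: (bounded_op_ae_weight wv).
  apply: (@bounded_op_weaken _ _ _ _ phi_gt0 _ _ (C1 * c)).
    by rewrite ler_peMr ?(ltW cc)// lerDl ltW.
  apply: (hC1 c (fun _ _ => 1) Q) => //; first exact: mean_metric1.
  by move=> x y Hx Hy; rewrite mulr1; exact: Qle.
move=> a [[ma _] afin].
have [g [mg ag]] := ex_borel_version ma.
pose q x y := K x (refl A x - y) * (a x - a y).
have B0 := bmo_norm_ge0 a.
have Bfin : bmo_norm a \is a fin_num by rewrite ge0_fin_numE.
set B := fine (bmo_norm a).
have BE : bmo_norm a = B%:E by rewrite fineK.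
have hq D : 0 < D -> B <= D -> bounded_op p phi w q (C1 * c * kb * D)%:E.
  move=> D0 BD; apply: (bounded_op_ae_weight wv).
  have -> : C1 * c * kb * D = C1 * (c * kb * D) by rewrite !mulrA.
  have aD : (bmo_norm a <= D%:E)%E by rewrite BE lee_fin.
  apply: (hC1 _ _ (fun u => Q u * (g u.1 - g u.2)) _ _ (bmo_mean_metric D0 aD mg ag)).
  - by rewrite !mulr_gt0.
  - apply: measurable_funM => //; apply: measurable_funB.
      exact: (measurableT_comp mg measurable_fst).
    exact: (measurableT_comp mg measurable_snd).
  - move=> x y Hx Hy; rewrite normrM /=.
    have -> : c * kb * D * (kap x y * (`|g x - g y| / (2 * (4 * n.+1%:R) ^+ n.+1 * D))) =
      c * kap x y * `|g x - g y|.
      by rewrite -/kb; field; rewrite !gt_eqF.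
    by rewrite ler_wpM2r//; exact: Qle.
  have ag' := ag; apply: filterS2 hQ ag' => x hx agx Hx.
  apply: filterS2 (hx Hx) ag => y hy agy Hy.
  by rewrite /q /= hy// agx// agy.
have B1 : 0 < B + 1 by rewrite ltr_wpDl// fine_ge0.
have B2 : B <= B + 1 by rewrite lerDl.
have [q1 q2 _] := hq _ B1 B2.
split => // f fM.
have [_ _ foo] := fM.
have f0 : (0 <= morrey_norm p phi w f)%E by exact: morrey_norm_ge0.
have ff : morrey_norm p phi w f \is a fin_num by rewrite (ge0_fin_numE f0).
set m := fine (morrey_norm p phi w f).
have mE : morrey_norm p phi w f = m%:E by rewrite fineK.
have m0 : 0 <= m by rewrite fine_ge0.
apply/lee_addgt0Pr => e e0.
(* The norm of a may vanish while [hq] requires D > 0, so D = B + d is used. This d keeps the excess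
   C1 c kb m d below e, and the 1 in the denominator covers the case m = 0. *)
pose d := e / (C1 * c * kb * m + 1).
have k1 : 0 <= C1 * c * kb * m by rewrite !mulr_ge0// ltW.
have d0 : 0 < d by rewrite divr_gt0// ltr_wpDl.
have Bd : 0 < B + d by rewrite ltr_wpDl// fine_ge0.
have BdB : B <= B + d by rewrite lerDl ltW.
have [_ _ hn] := hq _ Bd BdB.
apply: le_trans (hn f fM) _.
rewrite BE mE -!EFinM -EFinD lee_fin.
have kd : C1 * c * kb * m * d <= e.
  by rewrite /d mulrA ler_pdivrMr ?ltr_wpDl// mulrC ler_wpM2l ?(ltW e0)// lerDl.
have -> : C1 * c * kb * (B + d) * m = C1 * c * kb * B * m + C1 * c * kb * m * d by ring.
apply: lerD kd; rewrite ler_wpM2r// ler_wpM2r ?fine_ge0//.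
by rewrite ler_wpM2l ?(ltW cc)// lerDr.
Qed.
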